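(* Let $\mathcal{G}$ be a locally compact, $\sigma$-compact and (topologically) amenable groupoid with a Haar system. Then an element $1+a\in C^*_r(\mathcal{G})^+$ (with $a\in C^*_r(\mathcal{G})$) is invertible if and only if $1+\lambda_x(a)$ is invertible for every $x\in\mathcal{G}^{(0)}$, where $\lambda_x$ is the regular representation at $x$.
   Context: A locally compact groupoid $\mathcal{G}$ (unit space $\mathcal{G}^{(0)}$, source $s$, range $r$, $\mathcal{G}_x=s^{-1}(x)$) carries a locally compact Hausdorff topology for which composition and inversion are continuous and $r$ is open. A (right) Haar system is a family $\{\mu_x:x\in\mathcal{G}^{(0)}\}$ of positive regular Radon measures on $\mathcal{G}$ such that $\mathrm{supp}\,\mu_x=\mathcal{G}_x$; $x\mapsto\int f\,d\mu_x$ is continuous for every $f\in C_c(\mathcal{G})$; and $\int_{\mathcal{G}_{r(\gamma)}}f(\gamma'\gamma)\,d\mu_{r(\gamma)}(\gamma')=\int_{\mathcal{G}_{s(\gamma)}}f(\gamma')\,d\mu_{s(\gamma)}(\gamma')$ for all $\gamma\in\mathcal{G}$, $f\in C_c(\mathcal{G})$. $C_c(\mathcal{G})$ is a $*$-algebra with $(f*g)(\gamma)=\int_{\mathcal{G}_{s(\gamma)}}f(\gamma\alpha^{-1})g(\alpha)\,d\mu_{s(\gamma)}(\alpha)$, $f^*(\gamma)=\overline{f(\gamma^{-1})}$. The regular representation $\lambda_x:C_c(\mathcal{G})\to\mathfrak{B}(L^2(\mathcal{G}_x;\mu_x))$ is $(\lambda_x(f)\xi)(\gamma)=\int_{\mathcal{G}_x}f(\gamma\alpha^{-1})\xi(\alpha)\,d\mu_x(\alpha)$.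 $C^*_r(\mathcal{G})$ is the completion of $C_c(\mathcal{G})$ in the norm $\sup_x\|\lambda_x(f)\|$, $\lambda_x$ extends to it, and $C^*_r(\mathcal{G})^+=C^*_r(\mathcal{G})\oplus\mathbb{C}$ is its unitization. $\mathcal{G}$ is topologically amenable if there is a sequence of families $m^{(n)}=\{m^{(n)}_x:x\in\mathcal{G}^{(0)}\}$ of positive finite Radon measures on $\mathcal{G}$ such that: $\|m^{(n)}_x\|_1\le1$ and $m^{(n)}_x(\mathcal{G}\setminus s^{-1}(x))=0$ for all $x,n$; $x\mapsto\int f\,dm^{(n)}_x$ is continuous for all $f\in C_c(\mathcal{G})$ and all $n$; $\|m^{(n)}_x\|_1\to1$ uniformly on compact subsets of $\mathcal{G}^{(0)}$; $\|m^{(n)}_{s(\gamma)}-\gamma m^{(n)}_{r(\gamma)}\|_1\to0$ uniformly on compact subsets of $\mathcal{G}$, where $\gamma m$ is the push-forward under right multiplication $\alpha\mapsto\alpha\gamma$, $\mathcal{G}_{r(\gamma)}\to\mathcal{G}_{s(\gamma)}$. *)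

(* Defs.v *)
From HB Require Import structures.
From mathcomp Require Import all_boot all_order all_algebra.
From mathcomp Require Import complex.
From mathcomp Require Import all_classical all_reals all_analysis.
From mathcomp Require Import measurable_realfun.

Set Implicit Arguments.
Unset Strict Implicit.
Unset Printing Implicit Defensive.

Import Order.TTheory GRing.Theory Num.Theory numFieldNormedType.Exports.

Local Open Scope classical_set_scope.
Local Open Scope ring_scope.
Local Open Scope complex_scope.
Local Open Scope quotient_scope.

(* Complex numbers with the topology of their modulus. *)
HB.instance Definition _ (R : rcfType) := NormedModule.copy R[i] R[i]^o.

Section complex_functions.
Context d (T : measurableType d) (R : realType).
Implicit Types (f g : T -> R[i]) (mu : {measure set T -> \bar R}).

Definition cabs f : T -> R := fun x => complex.Re `|f x|.

Definition cmeasurable f :=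
  measurable_fun setT (fun x => complex.Re (f x)) /\
  measurable_fun setT (fun x => complex.Im (f x)).

Definition cintegral mu (D : set T) f : R[i] :=
  (\int[mu]_(x in D) complex.Re (f x) +i* \int[mu]_(x in D) complex.Im (f x))%C.

Definition cL2 mu : {pred T -> R[i]} :=
  mem [set f | cmeasurable f /\ finite_norm mu 2%:E (cabs f)].

Lemma cabsE f x :
  cabs f x = Num.sqrt (complex.Re (f x) ^+ 2 + complex.Im (f x) ^+ 2).
Proof. by rewrite /cabs normc_def. Qed.

Lemma cmodC (z : R[i]) : (complex.Re `|z|)%:C = `|z|.
Proof. by rewrite normc_def. Qed.

Lemma cmod_ge0 (z : R[i]) : 0 <= complex.Re `|z|.
Proof. by rewrite normc_def sqrtr_ge0. Qed.

Lemma cabs_ge0 f x : 0 <= cabs f x.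
Proof. by rewrite cabsE sqrtr_ge0. Qed.

Lemma cabsD f g x : cabs (f + g) x <= cabs f x + cabs g x.
Proof. by rewrite -lecR rmorphD /= !cmodC ler_normD. Qed.

Lemma cabsZ (a : R[i]) f : cabs (a *: f) = complex.Re `|a| *: cabs f.
Proof.
apply/funext => x; apply: complexI.
rewrite [RHS]rmorphM /= !cmodC; exact: (normrM a (f x)).
Qed.

Lemma cabs_eq0 f x : (cabs f x == 0) = (f x == 0).
Proof.
apply/eqP/eqP => fx; last by rewrite /cabs fx normr0.
by apply: normr0_eq0; rewrite -cmodC -[complex.Re _]/(cabs f x) fx.
Qed.

Lemma measurable_cabs f : cmeasurable f -> measurable_fun setT (cabs f).
Proof.
case=> mr mi; rewrite (_ : cabs f = Num.sqrt \o
    (fun x => complex.Re (f x) ^+ 2 + complex.Im (f x) ^+ 2)); last first.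
  by apply/funext => x; rewrite cabsE.
apply: measurableT_comp.
  by apply: continuous_measurable_fun; exact: sqrt_continuous.
by apply: measurable_funD; apply: measurable_funX.
Qed.

Section norm2.
Variable mu : {measure set T -> \bar R}.
Local Notation N f := ('N[mu]_2%:E[EFin \o cabs f])%E.

Lemma cL2P f : f \in cL2 mu <-> cmeasurable f /\ (N f < +oo)%E.
Proof. by split=> [/set_mem|H]; [|apply/mem_set]. Qed.

Lemma cmeasurableD f g : cmeasurable f -> cmeasurable g -> cmeasurable (f + g).
Proof.
move=> [fr fi] [gr gi]; split.
  rewrite (_ : (fun x => _) = (fun x => complex.Re (f x)) \+ (fun x => complex.Re (g x))).
    exact: measurable_funD.
  by apply/funext => x; rewrite /= raddfD.
rewrite (_ : (fun x => _) = (fun x => complex.Im (f x)) \+ (fun x => complex.Im (g x))).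
  exact: measurable_funD.
by apply/funext => x; rewrite /= raddfD.
Qed.

Lemma cmeasurableZ a f : cmeasurable f -> cmeasurable (a *: f).
Proof.
case: a => a b; move=> [fr fi]; split.
  rewrite (_ : (fun x => _) =
    (fun x => a * complex.Re (f x)) \- (fun x => b * complex.Im (f x))).
    by apply: measurable_funB; apply: measurable_funM.
  by apply/funext => x; rewrite fctE /=; case: (f x).
rewrite (_ : (fun x => _) =
    (fun x => a * complex.Im (f x)) \+ (fun x => b * complex.Re (f x))).
  by apply: measurable_funD; apply: measurable_funM.
by apply/funext => x; rewrite fctE /=; case: (f x).
Qed.

Lemma Lnorm_cabs_ge0 f : (0 <= N f)%E. Proof. exact: Lnorm_ge0. Qed.

Lemma Lnorm_cabsZ a f : f \in cL2 mu -> N (a *: f)%R = ((complex.Re `|a|)%:E * N f)%E.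
Proof.
move=> /cL2P[mf Nf]; rewrite cabsZ.
have fL : cabs f \in Lfun mu 2%:E.
  rewrite inE; apply/andP; split; apply/mem_set => //.
  exact: measurable_cabs.
have := LnormZ (Lfun_Sub (lee1n 2) fL) (complex.Re `|a|).
rewrite /= ger0_norm; last exact: cmod_ge0.
by [].
Qed.

Lemma measurable_abspow (h : T -> R) : measurable_fun setT h ->
  measurable_fun setT (fun x => `|(h x)%:E| `^ 2)%E.
Proof.
move=> mh; apply/measurable_EFinP.
apply: (@measurableT_comp _ _ _ _ _ _ (@powR R ^~ 2)) => //.
exact: measurableT_comp.
Qed.

Lemma Lnorm_cabsD f g : cmeasurable f -> cmeasurable g -> (N (f + g)%R <= N f + N g)%E.
Proof.
move=> mf mg.
apply: (@le_trans _ _ ('N[mu]_2%:E[EFin \o (cabs f \+ cabs g)%R])%E); last first.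
  apply: minkowski_EFin => //; [exact: measurable_cabs..|exact: ler1n].
rewrite unlock /Lnorm; apply: gt0_ler_poweR.
- by rewrite invr_ge0.
- by rewrite in_itv/= leey andbT integral_ge0.
- by rewrite in_itv/= leey andbT integral_ge0.
apply: ge0_le_integral => //.
- by move=> x _; exact: poweR_ge0.
- by apply: measurable_abspow; apply: measurable_cabs; exact: cmeasurableD.
- by apply: measurable_abspow; apply: measurable_funD; exact: measurable_cabs.
- move=> x _; apply: gt0_ler_poweR; rewrite ?in_itv/= ?leey ?andbT ?lee_fin//.
  rewrite !ger0_norm ?cabs_ge0 ?addr_ge0 ?cabs_ge0//; exact: cabsD.
Qed.

Lemma cL2_submod_closed : submod_closed (cL2 mu).
Proof.
split.
  apply/cL2P; split.
    by split; exact: measurable_cst.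
  rewrite (_ : _ \o _ = cst 0%E) ?Lnorm0//.
  by apply/funext => x /=; rewrite /cabs normr0.
move=> a f g fL gL; have /cL2P[mf Nf] := fL; have /cL2P[mg Ng] := gL.
have maf := cmeasurableZ a mf.
apply/cL2P; split; first exact: cmeasurableD.
apply: le_lt_trans (Lnorm_cabsD maf mg) _.
rewrite lte_add_pinfty// Lnorm_cabsZ// lte_mul_pinfty//.
by rewrite lee_fin cmod_ge0.
Qed.

HB.instance Definition _ := GRing.isSubmodClosed.Build _ _ (cL2 mu)
  cL2_submod_closed.

End norm2.
End complex_functions.

Section L2.
Context d (T : measurableType d) (R : realType).
Variable mu : {measure set T -> \bar R}.

Definition L2fun := {f : T -> R[i] | f \in cL2 mu}.
HB.instance Definition _ := SubType.on L2fun.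
HB.instance Definition _ := Choice.on L2fun.
HB.instance Definition _ := [SubChoice_isSubLmodule of L2fun by <:].

(* [L2 mu] is the space of square-integrable complex functions modulo
   almost-everywhere equality; it is a [normedModType R[i]]. *)
Definition L2eq (f g : L2fun) := `[< \forall x \ae mu, val f x = val g x >].

Lemma L2eq_refl : reflexive L2eq.
Proof. by move=> f; apply/asboolP; exact: aeW. Qed.

Lemma L2eq_sym : symmetric L2eq.
Proof.
by move=> f g; apply/asboolP/asboolP; apply: filterS => x ->.
Qed.

Lemma L2eq_trans : transitive L2eq.
Proof.
move=> g f h /asboolP fg /asboolP gh; apply/asboolP.
by apply: filterS2 fg gh => x -> ->.
Qed.

Canonical L2eq_equiv := EquivRel L2eq L2eq_refl L2eq_sym L2eq_trans.

Definition L2 := {eq_quot L2eq}.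
HB.instance Definition _ := Choice.on L2.
HB.instance Definition _ := EqQuotient.on L2.

Lemma L2_eqP (f g : L2fun) :
  \pi_L2 f = \pi_L2 g <-> \forall x \ae mu, val f x = val g x.
Proof. by split=> [/eqmodP/asboolP|?]; [|apply/eqmodP/asboolP]. Qed.

Lemma L2_reprP (f : L2fun) : \forall x \ae mu, val (repr (\pi_L2 f)) x = val f x.
Proof. by apply/L2_eqP; rewrite reprK. Qed.

Definition L2add (u v : L2) : L2 := \pi_L2 (repr u + repr v).
Definition L2opp (u : L2) : L2 := \pi_L2 (- repr u).
Definition L2scale (a : R[i]) (u : L2) : L2 := \pi_L2 (a *: repr u).

Let addE f g : L2add (\pi_L2 f) (\pi_L2 g) = \pi_L2 (f + g).
Proof.
apply/L2_eqP; apply: filterS2 (L2_reprP f) (L2_reprP g) => x.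
by rewrite !raddfD /= !fctE => -> ->.
Qed.

Let oppE f : L2opp (\pi_L2 f) = \pi_L2 (- f).
Proof.
apply/L2_eqP; apply: filterS (L2_reprP f) => x.
by rewrite !raddfN /= !fctE => ->.
Qed.

Let scaleE a f : L2scale a (\pi_L2 f) = \pi_L2 (a *: f).
Proof.
apply/L2_eqP; apply: filterS (L2_reprP f) => x.
by rewrite !linearZ /= !fctE => ->.
Qed.

Let addA : associative L2add.
Proof.
by move=> u v w; elim/quotW: u => f; elim/quotW: v => g; elim/quotW: w => h;
  rewrite (addE g h) (addE f g) !addE addrA.
Qed.

Let addC : commutative L2add.
Proof. by move=> u v; elim/quotW: u => f; elim/quotW: v => g; rewrite !addE addrC. Qed.

Let add0 : left_id (\pi_L2 0) L2add.
Proof. by move=> u; elim/quotW: u => f; rewrite addE add0r. Qed.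

Let addN : left_inverse (\pi_L2 0) L2opp L2add.
Proof. by move=> u; elim/quotW: u => f; rewrite oppE addE addNr. Qed.

HB.instance Definition _ := GRing.isZmodule.Build L2 addA addC add0 addN.

Let scaleA a b u : L2scale a (L2scale b u) = L2scale (a * b) u.
Proof. by elim/quotW: u => f; rewrite (scaleE b) !scaleE scalerA. Qed.

Let scale1 : left_id 1 L2scale.
Proof. by move=> u; elim/quotW: u => f; rewrite scaleE scale1r. Qed.

Let scaleDr : right_distributive L2scale +%R.
Proof.
move=> a u v; elim/quotW: u => f; elim/quotW: v => g.
rewrite (addE f g : _ + _ = _) !scaleE scalerDr.
exact: esym (addE (a *: f) (a *: g)).
Qed.

Let scaleDl v : {morph L2scale^~ v : a b / a + b}.
Proof.
elim/quotW: v => f a b /=; rewrite !scaleE scalerDl.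
exact: esym (addE (a *: f) (b *: f)).
Qed.

HB.instance Definition _ := GRing.Zmodule_isLmodule.Build R[i] L2
  scaleA scale1 scaleDr scaleDl.

Definition L2norm (u : L2) : R[i] :=
  (fine 'N[mu]_2%:E[EFin \o cabs (val (repr u))])%:C.

Let normE f : L2norm (\pi_L2 f) = (fine 'N[mu]_2%:E[EFin \o cabs (val f)])%:C.
Proof.
congr (fine _)%:C; rewrite unlock /Lnorm; congr (_ `^ _)%E.
have mabs (g : L2fun) : measurable_fun setT (cabs (val g)).
  by apply: measurable_cabs; have /cL2P[] := valP g.
apply: ge0_ae_eq_integral => //.
- exact: measurable_abspow.
- exact: measurable_abspow.
- by move=> x _; exact: poweR_ge0.
- by move=> x _; exact: poweR_ge0.
- by apply: filterS (L2_reprP f) => x /= fx _; rewrite /cabs fx.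
Qed.

Local Notation N f := ('N[mu]_2%:E[EFin \o cabs f])%E.

Let NE (f : L2fun) : N (val f) \is a fin_num.
Proof.
by rewrite ge0_fin_numE ?Lnorm_cabs_ge0//; have /cL2P[] := valP f.
Qed.

Let normD u v : L2norm (u + v) <= L2norm u + L2norm v.
Proof.
elim/quotW: u => f; elim/quotW: v => g.
rewrite (addE f g : _ + _ = _) !normE.
have /cL2P[mf _] := valP f; have /cL2P[mg _] := valP g.
have : (N (val (f + g)%R) <= N (val f) + N (val g))%E by rewrite raddfD; exact: Lnorm_cabsD.
rewrite -(fineK (NE f)) -(fineK (NE g)) -(fineK (NE (f + g))) -EFinD lee_fin.
by rewrite -lecR rmorphD.
Qed.

Let normZ a u : L2norm (a *: u) = `|a| * L2norm u.
Proof.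
elim/quotW: u => f; rewrite (scaleE a f : _ *: _ = _) !normE.
rewrite -[in RHS]cmodC -rmorphM; congr (_%:C).
by apply: EFin_inj; rewrite EFinM !fineK// Lnorm_cabsZ// (valP f).
Qed.

Let norm0 u : L2norm u = 0 -> u = 0.
Proof.
elim/quotW: u => f; rewrite normE => uE0.
have fE0 : fine (N (val f)) = 0 by case: uE0.
have N0 : N (val f) = 0%E by rewrite -(fineK (NE f)) fE0.
have /cL2P[mf _] := valP f.
have mabs : measurable_fun setT (EFin \o cabs (val f)).
  by apply/measurable_EFinP; exact: measurable_cabs.
have p0 : (0 < 2%:E :> \bar R)%E by rewrite lte_fin.
have f0 := Lnorm_eq0_eq0 mabs p0 N0; apply/L2_eqP.
apply: filterS f0 => x /(_ Logic.I)/= [/eqP]; rewrite cabs_eq0 => /eqP ->.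
done.
Qed.

HB.instance Definition _ := Lmodule_isNormed.Build R[i] L2 normD normZ norm0.

(* Functions that are not square-integrable are sent to the class of 0. *)
Definition L2class (f : T -> R[i]) : L2 := \pi_L2 (insubd (0 : L2fun) f).

End L2.

Section operators.
Context (R : realType) (V : normedModType R[i]).
Implicit Types T : V -> V.

Definition bounded_operator T :=
  linear T /\ exists M : R[i], forall v, `|T v| <= M * `|v|.

Definition op_norm T : \bar R :=
  ereal_sup [set (complex.Re `|T v|)%:E | v in [set v : V | `|v| <= 1]].

(* Invertibility in the algebra of bounded operators on V. *)
Definition op_invertible T :=
  exists S : V -> V, [/\ bounded_operator S, cancel T S & cancel S T].

End operators.

(* Not necessarily unital. *)
Record banach_star_algebra (R : realType) := BanachStarAlgebra {
  bsa_sort :> completeNormedModType R[i];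
  bsa_mul : bsa_sort -> bsa_sort -> bsa_sort;
  bsa_star : bsa_sort -> bsa_sort;
  bsa_mulA : associative bsa_mul;
  bsa_mul_linearl : forall b, linear (bsa_mul^~ b);
  bsa_mul_linearr : forall a, linear (bsa_mul a);
  bsa_normM : forall a b, `|bsa_mul a b| <= `|a| * `|b|;
  bsa_starD : {morph bsa_star : a b / a + b};
  bsa_starZ : forall (c : R[i]) a, bsa_star (c *: a) = (c^*)%C *: bsa_star a;
  bsa_starM : forall a b, bsa_star (bsa_mul a b) = bsa_mul (bsa_star b) (bsa_star a);
  bsa_starK : involutive bsa_star;
  bsa_norm_star : forall a, `|bsa_star a| = `|a|
}.

Section unitization.
Context (R : realType) (A : banach_star_algebra R).

(* The pair (a, z) stands for a + z1. *)
Definition unitization := (A * R[i])%type.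

Definition unitization1 : unitization := (0, 1).

Definition unitizationM (u v : unitization) : unitization :=
  (bsa_mul u.1 v.1 + u.2 *: v.1 + v.2 *: u.1, u.2 * v.2).

Definition unitization_invertible (u : unitization) :=
  exists v, unitizationM u v = unitization1 /\ unitizationM v u = unitization1.

End unitization.

Notation borel G := (g_sigma_algebraType (@open G)).

Section measures.
Context (R : realType) (G : ptopologicalType).
Implicit Types m : {measure set (borel G) -> \bar R}.

Record radon_measure m : Prop := {
  radon_compact : forall K : set G, compact K -> (m K < +oo)%E;
  radon_outer : forall A : set (borel G), measurable A ->
    m A = ereal_inf [set m U | U in [set U : set G | open U /\ A `<=` U]];
  radon_inner : forall U : set G, open U ->
    m U = ereal_sup [set m K | K in [set K : set G | compact K /\ K `<=` U]]
}.

Definition measure_support m : set G :=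
  [set g | forall U : set G, open U -> U g -> (0 < m U)%E].

(* Total variation norm of a signed measure, given as a set function. *)
Definition variation_norm (nu : set (borel G) -> \bar R) : \bar R :=
  ereal_sup [set v | exists n (P : 'I_n -> set (borel G)),
    [/\ forall i, measurable (P i), trivIset setT P,
        \bigcup_i P i = setT & v = (\sum_(i < n) `|nu (P i)|)%E]].

Definition sigma_compact :=
  exists K : nat -> set G, (forall n, compact (K n)) /\ \bigcup_n K n = setT.

End measures.

Definition Cc (R : realType) (G : topologicalType) : set (G -> R[i]) :=
  [set f | continuous f /\ compact (closure [set g | f g != 0])].

(* [gmul g h] is only meaningful when [gsrc g = grng h]; units are identified
   with the corresponding elements of G. *)
Record groupoid (G : Type) := Groupoid {
  gsrc : G -> G;
  grng : G -> G;
  ginv : G -> G;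
  gmul : G -> G -> G;
  gsrc_src : forall g, gsrc (gsrc g) = gsrc g;
  grng_src : forall g, grng (gsrc g) = gsrc g;
  gsrc_rng : forall g, gsrc (grng g) = grng g;
  grng_rng : forall g, grng (grng g) = grng g;
  gsrc_mul : forall g h, gsrc g = grng h -> gsrc (gmul g h) = gsrc h;
  grng_mul : forall g h, gsrc g = grng h -> grng (gmul g h) = grng g;
  gmulA : forall g h k, gsrc g = grng h -> gsrc h = grng k ->
    gmul g (gmul h k) = gmul (gmul g h) k;
  gmul_src : forall g, gmul g (gsrc g) = g;
  gmul_rng : forall g, gmul (grng g) g = g;
  gsrc_inv : forall g, gsrc (ginv g) = grng g;
  grng_inv : forall g, grng (ginv g) = gsrc g;
  gmulVg : forall g, gmul (ginv g) g = gsrc g;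
  gmulgV : forall g, gmul g (ginv g) = grng g
}.

Definition gunits (G : Type) (Gam : groupoid G) : set G := [set x | gsrc Gam x = x].

Definition gfiber (G : Type) (Gam : groupoid G) (x : G) : set G :=
  [set g | gsrc Gam g = x].

Definition gcomposable (G : Type) (Gam : groupoid G) : set (G * G) :=
  [set p | gsrc Gam p.1 = grng Gam p.2].

Record locally_compact_groupoid (G : topologicalType) (Gam : groupoid G) : Prop := {
  lcg_locally_compact : locally_compact [set: G];
  lcg_hausdorff : hausdorff_space G;
  lcg_mul_continuous :
    {within gcomposable Gam, continuous (fun p => gmul Gam p.1 p.2)};
  lcg_inv_continuous : continuous (ginv Gam);
  (* the range map is open onto the unit space *)
  lcg_rng_open : forall U, open U ->
    exists2 V, open V & grng Gam @` U = V `&` gunits Gam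
}.

Section haar.
Context (R : realType) (G : ptopologicalType) (Gam : groupoid G).

(* Measure families are indexed by G; only the members at units matter. *)
Implicit Types mu : G -> {measure set (borel G) -> \bar R}.

Record haar_system mu : Prop := {
  haar_radon : forall x, gunits Gam x -> radon_measure (mu x);
  haar_support : forall x, gunits Gam x -> measure_support (mu x) = gfiber Gam x;
  haar_continuous : forall f : G -> R[i], Cc f ->
    {within gunits Gam, continuous (fun x => cintegral (mu x) setT f)};
  haar_invariant : forall (g : G) (f : G -> R[i]), Cc f ->
    cintegral (mu (grng Gam g)) (gfiber Gam (grng Gam g)) (fun h => f (gmul Gam h g)) =
    cintegral (mu (gsrc Gam g)) (gfiber Gam (gsrc Gam g)) f
}.

(* Push-forward of m under right multiplication by g, from the fiber over the
   range of g to the fiber over its source. *)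
Definition gpush (g : G) (m : {measure set (borel G) -> \bar R})
    (A : set (borel G)) : \bar R :=
  m ((gfiber Gam (grng Gam g) : set (borel G)) `&` [set h | A (gmul Gam h g)]).

Definition topologically_amenable : Prop :=
  exists m : nat -> G -> {measure set (borel G) -> \bar R},
  [/\ forall n x, gunits Gam x ->
        [/\ radon_measure (m n x), (m n x setT <= 1)%E
          & m n x (~` gfiber Gam x) = 0%E],
      forall n (f : G -> R[i]), Cc f ->
        {within gunits Gam, continuous (fun x => cintegral (m n x) setT f)},
      forall (K : set G) (e : R), compact K -> K `<=` gunits Gam -> 0 < e ->
        \forall n \near \oo, forall x, K x -> (`|m n x setT - 1| < e%:E)%E
    & forall (K : set G) (e : R), compact K -> 0 < e ->
        \forall n \near \oo, forall g, K g ->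
          (variation_norm
             (fun A => m n (gsrc Gam g) A - gpush g (m n (grng Gam g)) A) < e%:E)%E].

Definition convolution mu (f f' : G -> R[i]) : G -> R[i] := fun g =>
  cintegral (mu (gsrc Gam g)) (gfiber Gam (gsrc Gam g))
    (fun h => f (gmul Gam g (ginv Gam h)) * f' h).

Definition cinvolution (f : G -> R[i]) : G -> R[i] := fun g => ((f (ginv Gam g))^*)%C.

(* Since [mu x] is concentrated on the fiber over x, [L2 (mu x)] is the L^2
   space of that fiber; the defining formula is extended by 0 off the fiber,
   where the product is meaningless. *)
Definition regular_rep mu (x : G) (f : G -> R[i]) (xi : L2 (mu x)) : L2 (mu x) :=
  L2class (mu x)
    ((fun g => cintegral (mu x) (gfiber Gam x)
       (fun h => f (gmul Gam g (ginv Gam h)) * val (repr xi) h)) \_ (gfiber Gam x)).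

Definition reduced_norm mu (f : G -> R[i]) : \bar R :=
  ereal_sup [set op_norm (@regular_rep mu x f) | x in gunits Gam].

(* A completion of the convolution algebra C_c(G) in the reduced norm, with the
   continuous extensions of the regular representations. The map [rcs_emb] is
   only meaningful on C_c(G). This data is unique up to a unique isometric
   *-isomorphism. *)
Record reduced_cstar mu := ReducedCstar {
  rcs_alg :> banach_star_algebra R;
  rcs_emb : (G -> R[i]) -> rcs_alg;
  rcs_embD : forall f f', Cc f -> Cc f' ->
    rcs_emb (f + f') = rcs_emb f + rcs_emb f';
  rcs_embZ : forall (c : R[i]) f, Cc f -> rcs_emb (c *: f) = c *: rcs_emb f;
  rcs_embM : forall f f', Cc f -> Cc f' ->
    rcs_emb (convolution mu f f') = bsa_mul (rcs_emb f) (rcs_emb f');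
  rcs_emb_star : forall f, Cc f ->
    rcs_emb (cinvolution f) = bsa_star (rcs_emb f);
  rcs_emb_norm : forall f, Cc f ->
    (complex.Re `|rcs_emb f|)%:E = reduced_norm mu f;
  rcs_emb_dense : dense (rcs_emb @` @Cc R G);
  rcs_lambda : forall x : G, rcs_alg -> L2 (mu x) -> L2 (mu x);
  rcs_lambda_emb : forall x f, gunits Gam x -> Cc f ->
    @rcs_lambda x (rcs_emb f) = @regular_rep mu x f;
  rcs_lambda_bounded : forall x a, gunits Gam x ->
    bounded_operator (@rcs_lambda x a);
  rcs_lambda_linear : forall x xi, gunits Gam x ->
    linear (fun a => @rcs_lambda x a xi);
  rcs_lambda_norm : forall x a xi, gunits Gam x ->
    `|@rcs_lambda x a xi| <= `|a| * `|xi|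
}.

End haar.

Arguments rcs_lambda {R G Gam mu} r x a xi.

(* Main.v *)
(** Write T_x = 1 + lambda_x(a).  The main point is that pointwise
    invertibility of the T_x forces a uniform bound c |g| <= |T_x g|.

    Suppose it fails.  Amenability yields, for each compact L, functions w_j on
    the fibers with \sum_j w_j^2 close to 1, with
    \sum_j (w_j(h) - w_j(k))^2 small when h k^-1 is in L, and such that h k^-1
    stays in a fixed compact set for h, k in the support of w_j.  Hence the w_j
    almost commute with convolution by f in C_c(G), and an almost-kernel vector
    g of T_x can be replaced by some w_j g.  Iterating this with decreasing
    errors and translating on the right by a point common to all the supports
    gives units y_n in a compact set and almost-kernel vectors h of T_{y_n}
    supported in compact sets independent of n.  Up to a small error
    h = - f * h = \sum_i c_i p_i with p_i in C_c(G) independent of n and c_i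
    bounded, so along an ultrafilter y_n --> y and the c_i converge; the limits
    are almost-kernel vectors of T_y, which is therefore not invertible.

    Given the uniform bound and f in C_c(G) close to a, the operators
    1 - t (1 + lambda_x(f))^* T_x are contractions uniformly in x for some
    t > 0, and a fixed point argument in the algebra gives a left inverse of
    1 + a.  It is a right inverse because every T_x is invertible and the
    lambda_x are jointly faithful. *)

Require Import Defs.
From HB Require Import structures.
From mathcomp Require Import all_boot all_order all_algebra.
From mathcomp Require Import finmap complex.
From mathcomp Require Import all_classical all_reals all_analysis.
From mathcomp Require Import measurable_realfun.
From mathcomp Require Import ring lra.
Set Implicit Arguments.
Unset Strict Implicit.
Unset Printing Implicit Defensive.
Import Order.TTheory GRing.Theory Num.Theory numFieldNormedType.Exports.
Local Open Scope classical_set_scope.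
Local Open Scope ring_scope.

(** * Complex-valued continuous functions with compact support *)

Section complex_numbers.
Context (R : realType).
Implicit Types z w : R[i].

(** Vectors over different units live in different Hilbert spaces, so an almost-kernel vector can
    reach a limit unit only after it is replaced by the restriction of one function on G. This is
    possible when its support lies in a compact set fixed in advance. Localization supplies such a
    set, but the set grows as the tolerated error shrinks, while contradicting invertibility at a
    single unit needs errors tending to 0. Hence the n-th vector is localized n times in succession:
    for a fixed level j the error and the compact set no longer depend on n, and all levels sit over
    the same unit. The unit space need not be metrizable, so one ultrafilter serves for the limits
    at all levels.

    In the second half the adjoint of a fiber operator is computed by Fubini for f in C_c(G) only,
    which explains the mixed product of an adjoint taken from f with an operator taken from a. The
    contraction is a step of gradient descent for the squared norm of T_x g, with step length t. *)

Definition cmod z : R := complex.Re `|z|.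

Lemma cmod_normE z : `|z| = (cmod z)%:C%C.
Proof. by rewrite /cmod cmodC. Qed.

Lemma cmod_nneg z : 0 <= cmod z. Proof. exact: cmod_ge0. Qed.

Lemma cmod0 : cmod 0 = 0. Proof. by rewrite /cmod normr0. Qed.

Lemma cmod_eq0 z : (cmod z == 0) = (z == 0).
Proof.
apply/eqP/eqP => [z0|->]; last exact: cmod0.
by apply: normr0_eq0; rewrite cmod_normE z0.
Qed.

Lemma cmodM z w : cmod (z * w) = cmod z * cmod w.
Proof. by apply: complexI; rewrite rmorphM /= -!cmod_normE normrM. Qed.

Lemma cmodD z w : cmod (z + w) <= cmod z + cmod w.
Proof. by rewrite -lecR rmorphD /= -!cmod_normE ler_normD. Qed.

Lemma cmodN z : cmod (- z) = cmod z.
Proof. by apply: complexI; rewrite -!cmod_normE normrN. Qed.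

Lemma cmodB z w : cmod (z - w) <= cmod z + cmod w.
Proof. by rewrite -(cmodN w); exact: cmodD. Qed.

Lemma cmod_distC z w : cmod (z - w) = cmod (w - z).
Proof. by rewrite -cmodN opprB. Qed.

Lemma cmod_conj z : cmod (z^*)%C = cmod z.
Proof. by apply: complexI; rewrite -!cmod_normE normcJ. Qed.

Lemma cmod_real (a : R) : cmod a%:C%C = `|a|.
Proof. by rewrite /cmod normc_def /= expr0n addr0 sqrtr_sqr. Qed.

Lemma cmod_sqr z : cmod z ^+ 2 = complex.Re z ^+ 2 + complex.Im z ^+ 2.
Proof. by rewrite /cmod normc_def /= sqr_sqrtr// addr_ge0// sqr_ge0. Qed.

Lemma Re_norm_le z : `|complex.Re z| <= cmod z.
Proof. by rewrite -lecR -cmod_normE; exact: normc_ge_Re. Qed.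

Lemma Im_norm_le z : `|complex.Im z| <= cmod z.
Proof.
rewrite /cmod normc_def -sqrtr_sqr ler_wsqrtr// lerDr.
exact: sqr_ge0.
Qed.

Lemma norm_le_ReIm z : cmod z <= `|complex.Re z| + `|complex.Im z|.
Proof.
rewrite /cmod normc_def /= -[leRHS]ger0_norm ?addr_ge0// -sqrtr_sqr ler_wsqrtr//.
rewrite sqrrD !real_normK ?num_real//.
by rewrite addrAC lerDl mulrn_wge0// mulr_ge0.
Qed.

Lemma cmod_sum n (f : nat -> R[i]) :
  cmod (\sum_(i < n) f i) <= \sum_(i < n) cmod (f i).
Proof.
elim: n => [|n IH]; first by rewrite !big_ord0 cmod0.
by rewrite !big_ord_recr /=; apply: le_trans (cmodD _ _) _; rewrite lerD2r.
Qed.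

Lemma ReM z w : complex.Re (z * w) =
  complex.Re z * complex.Re w - complex.Im z * complex.Im w.
Proof. by case: z w => [a b] [c d]. Qed.

Lemma ImM z w : complex.Im (z * w) =
  complex.Re z * complex.Im w + complex.Im z * complex.Re w.
Proof. by case: z w => [a b] [c d]. Qed.

Lemma ReD z w : complex.Re (z + w) = complex.Re z + complex.Re w.
Proof. by case: z w => [a b] [c d]. Qed.

Lemma ImD z w : complex.Im (z + w) = complex.Im z + complex.Im w.
Proof. by case: z w => [a b] [c d]. Qed.

Lemma Re_conj z : complex.Re (z^*)%C = complex.Re z.
Proof. by case: z. Qed.

Lemma Im_conj z : complex.Im (z^*)%C = - complex.Im z.
Proof. by case: z. Qed.

Lemma complexP z w : complex.Re z = complex.Re w ->
  complex.Im z = complex.Im w -> z = w.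
Proof. by case: z w => [a b] [c d] /= -> ->. Qed.

End complex_numbers.

(** * Convergence and relative continuity of complex-valued functions *)

Section complex_limits.
Context (R : realType) (T : Type) (F : set_system T) (FF : Filter F).
Implicit Types f g : T -> R[i].

Lemma cvgCP f (z : R[i]) : f @ F --> z <->
  (fun x => complex.Re (f x)) @ F --> complex.Re z /\
  (fun x => complex.Im (f x)) @ F --> complex.Im z.
Proof.
split.
  move=> /cvgrPdist_lt fz; split; apply/cvgrPdist_lt => e e0.
    have e0' : (0 : R[i]) < (e%:C)%C by rewrite ltcR.
    have := fz _ e0'; apply: filterS => x.
    rewrite cmod_normE ltcR => H; apply: le_lt_trans H.
    by rewrite -raddfB; exact: Re_norm_le.
  have e0' : (0 : R[i]) < (e%:C)%C by rewrite ltcR.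
  have := fz _ e0'; apply: filterS => x.
  rewrite cmod_normE ltcR => H; apply: le_lt_trans H.
  by rewrite -raddfB; exact: Im_norm_le.
move=> [/cvgrPdist_lt fr /cvgrPdist_lt fi].
(* A positive element of [R[i]] is real, so the second component of the radius is 0. *)
apply/cvgrPdist_lt => -[e e'] /[dup] /ltW/ger0_Im /= ->.
rewrite -[(e +i* 0)%C]/(e%:C)%C ltcR => e0.
have e2 : 0 < e / 2 by rewrite divr_gt0.
have := fr _ e2; have := fi _ e2; apply: filterS2 => x Hi Hr.
rewrite cmod_normE ltcR; apply: le_lt_trans (norm_le_ReIm _) _.
by rewrite !raddfB (splitr e) ltrD.
Qed.

Lemma cvgCdist f (z : R[i]) : f @ F --> z <->
  forall e : R, 0 < e -> \forall x \near F, cmod (f x - z) < e.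
Proof.
split.
  move=> /cvgrPdist_lt fz e e0.
  have e0' : (0 : R[i]) < (e%:C)%C by rewrite ltcR.
  by have := fz _ e0'; apply: filterS => x; rewrite cmod_normE ltcR cmod_distC.
move=> H; apply/cvgCP; split; apply/cvgrPdist_lt => e e0;
  have := H _ e0; apply: filterS => x; rewrite cmod_distC => K;
  apply: le_lt_trans K; rewrite -raddfB; [exact: Re_norm_le|exact: Im_norm_le].
Qed.

Lemma cvgCD f g (a b : R[i]) : f @ F --> a -> g @ F --> b ->
  (fun x => f x + g x) @ F --> a + b.
Proof.
move=> /cvgCP[fr fi] /cvgCP[gr gi]; apply/cvgCP; split.
  by rewrite ReD (_ : (fun x => _) = (fun x => complex.Re (f x) + complex.Re (g x)));
    [exact: cvgD|apply/funext => x; rewrite ReD].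
by rewrite ImD (_ : (fun x => _) = (fun x => complex.Im (f x) + complex.Im (g x)));
    [exact: cvgD|apply/funext => x; rewrite ImD].
Qed.

Lemma cvgCM f g (a b : R[i]) : f @ F --> a -> g @ F --> b ->
  (fun x => f x * g x) @ F --> a * b.
Proof.
move=> /cvgCP[fr fi] /cvgCP[gr gi]; apply/cvgCP; split.
  rewrite ReM (_ : (fun x => _) = (fun x => complex.Re (f x) * complex.Re (g x)
    - complex.Im (f x) * complex.Im (g x))); last by apply/funext => x; rewrite ReM.
  by apply: cvgB; apply: cvgM.
rewrite ImM (_ : (fun x => _) = (fun x => complex.Re (f x) * complex.Im (g x)
    + complex.Im (f x) * complex.Re (g x))); last by apply/funext => x; rewrite ImM.
by apply: cvgD; apply: cvgM.
Qed.

Lemma cvgC_conj f (a : R[i]) : f @ F --> a ->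
  (fun x => ((f x)^*)%C) @ F --> (a^*)%C.
Proof.
move=> /cvgCP[fr fi]; apply/cvgCP; split.
  rewrite Re_conj (_ : (fun x => _) = (fun x => complex.Re (f x)))//.
  by apply/funext => x; rewrite Re_conj.
rewrite Im_conj (_ : (fun x => _) = (fun x => - complex.Im (f x))); first exact: cvgN.
by apply/funext => x; rewrite Im_conj.
Qed.

Lemma cvgC_real (u : T -> R) (a : R) : u @ F --> a ->
  (fun x => (u x)%:C%C) @ F --> a%:C%C.
Proof. by move=> ua; apply/cvgCP; split => //=; exact: cvg_cst. Qed.

Lemma cvgC_cmod f (a : R[i]) : f @ F --> a -> (fun x => cmod (f x)) @ F --> cmod a.
Proof.
move=> /cvgCdist fa; apply/cvgrPdist_lt => e e0.
have := fa _ e0; apply: filterS => x xe; apply: le_lt_trans xe.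
rewrite distrC ler_norml; apply/andP; split.
  rewrite lerNl opprB lerBlDr cmod_distC; apply: le_trans (cmodD _ _).
  by rewrite subrK.
by rewrite lerBlDr; apply: le_trans (cmodD _ _); rewrite subrK.
Qed.

End complex_limits.

(** Stated with the [within] filter so that limit laws for filters apply pointwise; [cont_onP] gives
    the subspace form. Most functions below are meaningful only on a fiber or on composable
    pairs. *)
Definition cont_on (T U : topologicalType) (D : set T) (f : T -> U) :=
  forall x, D x -> f @ within D (nbhs x) --> f x.

Section cont_on.
Context (T U : topologicalType).
Implicit Types (D E : set T) (f g : T -> U).

Lemma cont_onP D f : cont_on D f <-> {within D, continuous f}.
Proof. by split=> /subspace_continuousP. Qed.

Lemma continuous_cont_on D f : continuous f -> cont_on D f.
Proof. by move=> cf x _; apply: cvg_within_filter; exact: cf. Qed.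

Lemma cont_onT f : cont_on setT f -> continuous f.
Proof.
move=> cf x A fA; have H : nbhs x [set y | setT y -> A (f y)] := cf x Logic.I A fA.
by apply: filterS H => y; exact.
Qed.

Lemma cont_on_sub D E f : E `<=` D -> cont_on D f -> cont_on E f.
Proof.
move=> ED cf x Ex; apply: cvg_trans (cf x (ED x Ex)).
by apply: cvg_fmap2; exact: within_subset.
Qed.

Lemma cont_on_eq D f g : (forall x, D x -> f x = g x) -> cont_on D f -> cont_on D g.
Proof.
move=> fg cf x Dx; rewrite -(fg x Dx) => A fA.
have H : nbhs x [set y | D y -> A (f y)] := cf x Dx A fA.
suff : nbhs x [set y | D y -> A (g y)] by [].
by apply: filterS H => y yA Dy; rewrite -fg//; exact: yA.
Qed.

Lemma cont_on_comp (S : topologicalType) (D : set T) (E : set U) (f : T -> U)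
    (g : U -> S) : (forall x, D x -> E (f x)) -> cont_on D f -> cont_on E g ->
  cont_on D (g \o f).
Proof.
move=> DE cf cg x Dx A gA.
have H : nbhs x [set y | D y -> E (f y) -> A (g (f y))] := cf x Dx _ (cg _ (DE x Dx) A gA).
suff : nbhs x [set y | D y -> A (g (f y))] by [].
by apply: filterS H => y H Dy; apply: H => //; exact: DE.
Qed.

Lemma cont_on_pair (S : topologicalType) D (f : T -> U) (g : T -> S) :
  cont_on D f -> cont_on D g -> cont_on D (fun x => (f x, g x)).
Proof. by move=> cf cg x Dx; apply: cvg_pair; [exact: cf|exact: cg]. Qed.

End cont_on.

Section cont_on_numeric.
Context (R : realType) (T : topologicalType).
Implicit Types (D : set T) (f g : T -> R[i]) (u v : T -> R).

Lemma cont_on_cst (U : topologicalType) D (c : U) : cont_on D (fun _ => c).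
Proof. by move=> x _; exact: cvg_cst. Qed.

Lemma cont_onCD D f g : cont_on D f -> cont_on D g -> cont_on D (fun x => f x + g x).
Proof. by move=> cf cg x Dx; apply: cvgCD; [exact: cf|exact: cg]. Qed.

Lemma cont_onCM D f g : cont_on D f -> cont_on D g -> cont_on D (fun x => f x * g x).
Proof. by move=> cf cg x Dx; apply: cvgCM; [exact: cf|exact: cg]. Qed.

Lemma cont_onC_conj D f : cont_on D f -> cont_on D (fun x => ((f x)^*)%C).
Proof. by move=> cf x Dx; apply: cvgC_conj; exact: cf. Qed.

Lemma cont_onC_cmod D f : cont_on D f -> cont_on D (fun x => cmod (f x)).
Proof. by move=> cf x Dx; apply: cvgC_cmod; exact: cf. Qed.

Lemma cont_onC_real D u : cont_on D u -> cont_on D (fun x => (u x)%:C%C).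
Proof. by move=> cf x Dx; apply: cvgC_real; exact: cf. Qed.

Lemma cont_onC_Re D f : cont_on D f -> cont_on D (fun x => complex.Re (f x)).
Proof. by move=> cf x Dx; have /cvgCP[] := cf x Dx. Qed.

Lemma cont_onC_Im D f : cont_on D f -> cont_on D (fun x => complex.Im (f x)).
Proof. by move=> cf x Dx; have /cvgCP[] := cf x Dx. Qed.

Lemma cont_onD D u v : cont_on D u -> cont_on D v -> cont_on D (fun x => u x + v x).
Proof. by move=> cf cg x Dx; apply: cvgD; [exact: cf|exact: cg]. Qed.

Lemma cont_onB D u v : cont_on D u -> cont_on D v -> cont_on D (fun x => u x - v x).
Proof. by move=> cf cg x Dx; apply: cvgB; [exact: cf|exact: cg]. Qed.

Lemma cont_onM D u v : cont_on D u -> cont_on D v -> cont_on D (fun x => u x * v x).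
Proof. by move=> cf cg x Dx; apply: cvgM; [exact: cf|exact: cg]. Qed.

Lemma cont_on_sqr D u : cont_on D u -> cont_on D (fun x => u x ^+ 2).
Proof. by move=> cu; exact: cont_onM. Qed.

Lemma cont_on_sqrt D u : cont_on D u -> cont_on D (fun x => Num.sqrt (u x)).
Proof. by move=> cu x Dx; apply: continuous_cvg; [exact: sqrt_continuous|exact: cu]. Qed.

Lemma cont_on_prod D (n : nat) (u : nat -> T -> R) : (forall i, (i < n)%N -> cont_on D (u i)) ->
  cont_on D (fun x => \prod_(i < n) u i x).
Proof.
elim: n => [_|n IH H].
  apply: (@cont_on_eq _ _ D (fun=> 1 : R)); last exact: cont_on_cst.
  by move=> x _; rewrite big_ord0.
apply: (@cont_on_eq _ _ _ (fun x => (\prod_(i < n) u i x) * u n x)).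
  by move=> x _; rewrite big_ord_recr.
by apply: cont_onM; [apply: IH => i ni; apply: H; exact: ltnW|exact: H].
Qed.

Lemma cont_on_sum D (n : nat) (u : nat -> T -> R) : (forall i, (i < n)%N -> cont_on D (u i)) ->
  cont_on D (fun x => \sum_(i < n) u i x).
Proof.
elim: n => [_|n IH H].
  apply: (@cont_on_eq _ _ D (fun=> 0 : R)); last exact: cont_on_cst.
  by move=> x _; rewrite big_ord0.
apply: (@cont_on_eq _ _ _ (fun x => (\sum_(i < n) u i x) + u n x)).
  by move=> x _; rewrite big_ord_recr.
by apply: cont_onD; [apply: IH => i ni; apply: H; exact: ltnW|exact: H].
Qed.

Lemma cont_onC_sum D (n : nat) (f : nat -> T -> R[i]) : (forall i, (i < n)%N -> cont_on D (f i)) ->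
  cont_on D (fun x => \sum_(i < n) f i x).
Proof.
elim: n => [_|n IH H].
  apply: (@cont_on_eq _ _ D (fun=> 0 : R[i])); last exact: cont_on_cst.
  by move=> x _; rewrite big_ord0.
apply: (@cont_on_eq _ _ _ (fun x => (\sum_(i < n) f i x) + f n x)).
  by move=> x _; rewrite big_ord_recr.
by apply: cont_onCD; [apply: IH => i ni; apply: H; exact: ltnW|exact: H].
Qed.

(** A three-epsilon argument in which the approximant may depend on the point and on [e], and need
    be close only near that point. *)
Lemma cont_on_uniform_limit D f : (forall x, D x -> forall e : R, 0 < e ->
    exists2 g, cont_on D g & \forall y \near x, D y -> cmod (f y - g y) <= e) ->
  cont_on D f.
Proof.
move=> H x Dx; apply/cvgCdist => e e0.
have e3 : 0 < e / 3 by rewrite divr_gt0.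
have [g cg fg] := H x Dx _ e3.
have gx : \forall y \near within D (nbhs x), cmod (g y - g x) < e / 3.
  by have /cvgCdist := cg x Dx; exact.
have fx := nbhs_singleton fg Dx.
have {}fg : \forall y \near within D (nbhs x), cmod (f y - g y) <= e / 3 by [].
apply: filterS2 gx fg => y gxy fgy.
have -> : f y - f x = (f y - g y) + ((g y - g x) - (f x - g x)) by ring.
apply: le_lt_trans (cmodD _ _) _; apply: le_lt_trans (lerD (lexx _) (cmodB _ _)) _.
by lra.
Qed.

End cont_on_numeric.

Section compactness.
Context (T : topologicalType).
Implicit Types (K : set T).

(** The near-covering form of compactness is applied to the filter of finite lists ordered by
    inclusion. Points are indexed by naturals so that sums over the cover are [\sum_(i < n)]; [x0]
    is the default value of [nth]. *)
Lemma compact_finite_nbhs_cover (x0 : T) K (f : T -> set T) : compact K ->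
  (forall x, K x -> nbhs x (f x)) ->
  exists n (s : nat -> T), (forall i, (i < n)%N -> K (s i)) /\
    forall y, K y -> exists2 i, (i < n)%N & f (s i) y.
Proof.
move=> /compact_near_coveringP cK Kf.
pose F : set_system (seq T) :=
  filter_from setT (fun s0 : seq T => [set s : seq T | {subset s0 <= s}]).
have FF : Filter F.
  apply: filter_from_filter; first by exists [::].
  move=> s1 s2 _ _; exists (s1 ++ s2) => // s ss.
  by split=> x xs; apply: ss; rewrite mem_cat xs ?orbT.
have [s0 _ Hs] : F [set s : seq T | K `<=` [set y | exists2 x, x \in s & K x /\ f x y]].
  apply: (cK _ F (fun (s : seq T) y => exists2 x, x \in s & K x /\ f x y) FF) => x Kx.
  exists (f x, [set s : seq T | x \in s]); first split => /=.
  - exact: Kf.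
  - by exists [:: x] => // s; apply; rewrite inE.
  - by move=> [y s] [/= fy xs]; exists x.
exists (size [seq x <- s0 | `[< K x >]]), (nth x0 [seq x <- s0 | `[< K x >]]); split.
  by move=> i /(mem_nth x0); rewrite mem_filter => /andP[/asboolP].
move=> y Ky; have [x xs [Kx fx]] := Hs s0 (fun _ => id) y Ky.
have xs' : x \in [seq x <- s0 | `[< K x >]] by rewrite mem_filter xs andbT; apply/asboolP.
by exists (index x [seq x <- s0 | `[< K x >]]); [rewrite index_mem|rewrite nth_index].
Qed.

End compactness.

Section compactly_supported.
Context (R : realType) (T : ptopologicalType).
Implicit Types (D : set T) (f g : T -> R[i]) (u v : T -> R).

(* Only the restriction of f to D matters. For D the fiber over x these
   functions represent a dense subspace of the L^2 space of the fiber. *)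
Definition ccs D f := cont_on D f /\
  exists2 K : set T, compact K & forall h, D h -> f h != 0 -> K h.

Definition ccr D u := cont_on D u /\
  exists2 K : set T, compact K & forall h, D h -> u h != 0 -> K h.

Lemma ccs_supp D f g : ccs D f -> cont_on D g ->
  (forall h, D h -> f h = 0 -> g h = 0) -> ccs D g.
Proof.
move=> [_ [K cK fK]] cg fg; split => //; exists K => // h Dh gh.
by apply: fK => //; apply: contra gh => /eqP/(fg h Dh)/eqP.
Qed.

Lemma ccs_ccr D f u : ccs D f -> cont_on D u ->
  (forall h, D h -> f h = 0 -> u h = 0) -> ccr D u.
Proof.
move=> [_ [K cK fK]] cg fg; split => //; exists K => // h Dh gh.
by apply: fK => //; apply: contra gh => /eqP/(fg h Dh)/eqP.
Qed.

Lemma ccr_supp D u v : ccr D u -> cont_on D v ->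
  (forall h, D h -> u h = 0 -> v h = 0) -> ccr D v.
Proof.
move=> [_ [K cK fK]] cg fg; split => //; exists K => // h Dh gh.
by apply: fK => //; apply: contra gh => /eqP/(fg h Dh)/eqP.
Qed.

Lemma ccs_sub D E f : E `<=` D -> ccs D f -> ccs E f.
Proof.
move=> ED [cf [K cK fK]]; split; first exact: cont_on_sub cf.
by exists K => // h /ED; exact: fK.
Qed.

Lemma ccr_sub D E u : E `<=` D -> ccr D u -> ccr E u.
Proof.
move=> ED [cf [K cK fK]]; split; first exact: cont_on_sub cf.
by exists K => // h /ED; exact: fK.
Qed.

Lemma ccsM_l D f g : ccs D f -> cont_on D g -> ccs D (fun x => f x * g x).
Proof.
move=> cf cg; apply: (ccs_supp cf); first exact: cont_onCM (proj1 cf) cg.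
by move=> h _ ->; rewrite mul0r.
Qed.

Lemma ccsM_r D f g : cont_on D f -> ccs D g -> ccs D (fun x => f x * g x).
Proof.
move=> cf cg; apply: (ccs_supp cg); first exact: cont_onCM cf (proj1 cg).
by move=> h _ ->; rewrite mulr0.
Qed.

Lemma ccsZ D (c : R[i]) f : ccs D f -> ccs D (fun x => c * f x).
Proof. by apply: ccsM_r; exact: cont_on_cst. Qed.

Lemma ccs0 D : ccs D (fun=> 0).
Proof.
split; first exact: cont_on_cst.
by exists set0 => [|h _]; [exact: compact0|rewrite eqxx].
Qed.

Lemma ccr0 D : ccr D (fun=> 0).
Proof.
split; first exact: cont_on_cst.
by exists set0 => [|h _]; [exact: compact0|rewrite eqxx].
Qed.

Lemma ccsD D f g : ccs D f -> ccs D g -> ccs D (fun x => f x + g x).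
Proof.
move=> [cf [K cK fK]] [cg [L cL gL]]; split; first exact: cont_onCD.
exists (K `|` L); first exact: compactU.
move=> h Dh; have [f0|f0 _] := eqVneq (f h) 0; last by left; exact: fK.
by rewrite f0 add0r => g0; right; exact: gL.
Qed.

Lemma ccrD D u v : ccr D u -> ccr D v -> ccr D (fun x => u x + v x).
Proof.
move=> [cf [K cK fK]] [cg [L cL gL]]; split; first exact: cont_onD.
exists (K `|` L); first exact: compactU.
move=> h Dh; have [f0|f0 _] := eqVneq (u h) 0; last by left; exact: fK.
by rewrite f0 add0r => g0; right; exact: gL.
Qed.

Lemma ccrM_l D u v : ccr D u -> cont_on D v -> ccr D (fun x => u x * v x).
Proof.
move=> cf cg; apply: (ccr_supp cf); first exact: cont_onM (proj1 cf) cg.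
by move=> h _ ->; rewrite mul0r.
Qed.

Lemma ccrM_r D u v : cont_on D u -> ccr D v -> ccr D (fun x => u x * v x).
Proof.
move=> cf cg; apply: (ccr_supp cg); first exact: cont_onM cf (proj1 cg).
by move=> h _ ->; rewrite mulr0.
Qed.

Lemma ccrZ D (c : R) u : ccr D u -> ccr D (fun x => c * u x).
Proof. by apply: ccrM_r; exact: cont_on_cst. Qed.

Lemma ccrN D u : ccr D u -> ccr D (fun x => - u x).
Proof.
move=> cu; apply: (ccr_supp cu); last by move=> h _ ->; rewrite oppr0.
by move=> x Dx; apply: cvgN; exact: (proj1 cu).
Qed.

Lemma ccs_conj D f : ccs D f -> ccs D (fun x => ((f x)^*)%C).
Proof.
move=> cf; apply: (ccs_supp cf); first exact: cont_onC_conj (proj1 cf).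
by move=> h _ ->; rewrite conjc0.
Qed.

Lemma ccs_real D u : ccr D u -> ccs D (fun x => (u x)%:C%C).
Proof.
move=> [cu [K cK uK]]; split; first exact: cont_onC_real.
by exists K => // h Dh; rewrite -cmod_eq0 cmod_real normr_eq0; exact: uK.
Qed.

Lemma ccs_Re D f : ccs D f -> ccr D (fun x => complex.Re (f x)).
Proof.
move=> cf; apply: (ccs_ccr cf); first exact: cont_onC_Re (proj1 cf).
by move=> h _ ->.
Qed.

Lemma ccs_Im D f : ccs D f -> ccr D (fun x => complex.Im (f x)).
Proof.
move=> cf; apply: (ccs_ccr cf); first exact: cont_onC_Im (proj1 cf).
by move=> h _ ->.
Qed.

Lemma ccs_cmod D f : ccs D f -> ccr D (fun x => cmod (f x)).
Proof.
move=> cf; apply: (ccs_ccr cf); first exact: cont_onC_cmod (proj1 cf).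
by move=> h _ ->; rewrite cmod0.
Qed.

Lemma ccs_cmod2 D f : ccs D f -> ccr D (fun x => cmod (f x) ^+ 2).
Proof.
move=> cf; apply: (ccs_ccr cf).
  by apply: cont_on_sqr; exact: cont_onC_cmod (proj1 cf).
by move=> h _ ->; rewrite cmod0 expr0n.
Qed.

Lemma ccs_sum D n (f : nat -> T -> R[i]) : (forall i, (i < n)%N -> ccs D (f i)) ->
  ccs D (fun x => \sum_(i < n) f i x).
Proof.
elim: n => [_|n IH H].
  apply: (ccs_supp (ccs0 D)) => [|h _ _]; last by rewrite big_ord0.
  by apply: cont_onC_sum.
have H1 := ccsD (IH (fun i ni => H i (ltnW ni))) (H n (ltnSn n)).
apply: (ccs_supp H1) => [|h _]; last by rewrite big_ord_recr.
by apply: cont_onC_sum => i /H[].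
Qed.

Lemma ccr_sum D n (f : nat -> T -> R) : (forall i, (i < n)%N -> ccr D (f i)) ->
  ccr D (fun x => \sum_(i < n) f i x).
Proof.
elim: n => [_|n IH H].
  apply: (ccr_supp (ccr0 D)) => [|h _ _]; last by rewrite big_ord0.
  by apply: cont_on_sum.
have H1 := ccrD (IH (fun i ni => H i (ltnW ni))) (H n (ltnSn n)).
apply: (ccr_supp H1) => [|h _]; last by rewrite big_ord_recr.
by apply: cont_on_sum => i /H[].
Qed.

Lemma Cc_ccs f : Cc f -> ccs setT f.
Proof.
move=> [cf cK]; split; first exact: continuous_cont_on.
exists (closure [set g | f g != 0]) => // h _ fh.
by apply: (@subset_closure _ [set g | f g != 0]).
Qed.

Lemma ccs_Cc f : hausdorff_space T -> ccs setT f -> Cc f.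
Proof.
move=> hT [cf [K cK fK]]; split; first exact: cont_onT.
apply: (subclosed_compact _ cK); first exact: closed_closure.
have /closure_id -> : closed K := compact_closed hT cK.
by apply: closureS => h; exact: fK.
Qed.

Lemma ccr_bounded D u : closed D -> ccr D u -> exists2 B : R, 0 <= B & forall h, D h -> `|u h| <= B.
Proof.
move=> clD [cu [K cK uK]].
have [n [s [sK Ks]]] : exists n (s : nat -> T), (forall i, (i < n)%N -> (K `&` D) (s i)) /\
    forall y, (K `&` D) y -> exists2 i, (i < n)%N & D y -> `|u y| <= `|u (s i)| + 1.
  have cKD : compact (K `&` D) by exact: compact_closedI.
  have [[x0 _]|nD] := pselect ((K `&` D) !=set0); last first.
    by exists 0, (fun=> point); split => // y KDy; exfalso; apply: nD; exists y.
  have HN x : (K `&` D) x -> nbhs x [set y | D y -> `|u y| <= `|u x| + 1].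
    move=> [Kx Dx]; have /cvgrPdist_lt/(_ 1 ltr01) H := cu x Dx.
    have H' : nbhs x [set y | D y -> `|u x - u y| < 1] by exact: H.
    apply: filterS H' => y H1 Dy; have /ltW H2 := H1 Dy.
    have -> : u y = u x - (u x - u y) by ring.
    by apply: le_trans (ler_normB _ _) _; rewrite lerD2l.
  have [n [s [sK Ks]]] := compact_finite_nbhs_cover point cKD HN.
  by exists n, s.
exists (\sum_(i < n) (`|u (s i)| + 1)); first by apply: sumr_ge0 => i _; exact: addr_ge0.
move=> h Dh; have [u0|/(uK h Dh) Kh] := eqVneq (u h) 0.
  by rewrite u0 normr0; apply: sumr_ge0 => i _; exact: addr_ge0.
have [i ni H] := Ks h (conj Kh Dh).
apply: le_trans (H Dh) _; rewrite (bigD1 (Ordinal ni))//= lerDl.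
by apply: sumr_ge0 => j _; exact: addr_ge0.
Qed.

End compactly_supported.

(** * Partitions of unity and finite-rank approximation *)

Section partition_of_unity.
Context (R : realType) (X : Type).
Implicit Types (b : nat -> X -> R).

(** Telescoping weights: bump [i] receives what the bumps before it have left over. The total is 1
    wherever some bump equals 1, without any normalization. *)
Definition pu_weight b i x := b i x * \prod_(j < i) (1 - b j x).

Lemma pu_weight_sum b n x :
  \sum_(i < n) pu_weight b i x = 1 - \prod_(j < n) (1 - b j x).
Proof.
elim: n => [|n IH]; first by rewrite !big_ord0 subrr.
by rewrite big_ord_recr /= IH [in RHS]big_ord_recr /= /pu_weight; ring.
Qed.

Lemma pu_weight_ge0 b n x : (forall i, (i < n)%N -> 0 <= b i x <= 1) ->
  forall i, (i < n)%N -> 0 <= pu_weight b i x.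
Proof.
move=> H i ni; have /andP[bi _] := H i ni.
apply: mulr_ge0 => //; apply: prodr_ge0 => j _.
by rewrite subr_ge0; have /andP[] := H j (ltn_trans (ltn_ord j) ni).
Qed.

Lemma pu_weight_sum_le1 b n x : (forall i, (i < n)%N -> 0 <= b i x <= 1) ->
  \sum_(i < n) pu_weight b i x <= 1.
Proof.
move=> H; rewrite pu_weight_sum gerBl; apply: prodr_ge0 => j _.
by rewrite subr_ge0; have /andP[] := H j (ltn_ord j).
Qed.

Lemma pu_weight_sum1 b n x i : (i < n)%N -> b i x = 1 ->
  \sum_(i < n) pu_weight b i x = 1.
Proof.
move=> ni bi; rewrite pu_weight_sum (bigD1 (Ordinal ni))//= bi subrr mul0r.
by rewrite subr0.
Qed.

End partition_of_unity.

Section bumps.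
Context (R : realType) (G : ptopologicalType).
Hypothesis lcG : locally_compact [set: G].
Hypothesis hG : hausdorff_space G.

Lemma bump_at (x : G) (U : set G) : nbhs x U ->
  exists phi : G -> R, [/\ ccr setT phi, (forall y, 0 <= phi y <= 1),
    (forall y, phi y != 0 -> U y) & \forall y \near x, phi y = 1].
Proof.
move=> Ux; have [V] := @lcG x Logic.I; rewrite withinET => Vx [cV clV].
have Bx : ~ (~` (U `&` V)°) x.
  by apply; have : nbhs x (U `&` V) by exact: filterI.
have clB : closed (~` (U `&` V)°) by apply: open_closedC; exact: open_interior.
have := locally_compact_completely_regular lcG hG clB Bx (R := R).
move=> /(uniform_separatorP (R := R))[f [cf f01 f0 f1]].
(* Since [f x = 0] and [f = 1] off the interior of [U] and [V], this truncation is 1 where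
   [f <= 1/3], hence near [x], and it is nonzero only inside the compact [V]. *)
pose phi y := Num.min 1 (Num.max 0 (2 - 3 * f y)).
have phiB y : phi y != 0 -> (U `&` V)° y.
  apply: contraPP => nB; have fy : f y = 1 by apply: f1; exists y.
  rewrite /phi fy => /eqP; apply.
  by rewrite max_l ?min_r//; lra.
exists phi; split.
- split.
    apply: continuous_cont_on.
    have c1 : continuous (fun y => 2 - 3 * f y).
      move=> y; apply: cvgB; first exact: cvg_cst.
      by apply: cvgM; [exact: cvg_cst|exact: cf].
    have c2 : continuous ((fun=> 0) \max (fun y => 2 - 3 * f y)).
      by apply: max_fun_continuous => // y; exact: cvg_cst.
    have c3 : continuous ((fun=> 1) \min ((fun=> 0) \max (fun y => 2 - 3 * f y))).
      by apply: min_fun_continuous => // y; exact: cvg_cst.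
    exact: c3.
  by exists V => // y _ /phiB /interior_subset[].
- by move=> y; rewrite /phi le_min ler01 le_max lexx/= ge_min lexx.
- by move=> y /phiB /interior_subset[].
- have fx : f x = 0 by apply: f0; exists x.
  have /cvgrPdist_lt/(_ 3^-1) H := cf x.
  have : \forall y \near x, `|f x - f y| < 3^-1 by apply: H; rewrite invr_gt0.
  apply: filterS => y; rewrite fx sub0r normrN => /(le_lt_trans (ler_norm _)) fy.
  by rewrite /phi min_l// le_max; apply/orP; right; lra.
Qed.

Lemma exists_bumps (E : set G) (U : G -> set G) : compact E ->
  (forall x, E x -> nbhs x (U x)) ->
  exists n (s : nat -> G) (phi : nat -> G -> R),
    (forall i, (i < n)%N -> [/\ E (s i), ccr setT (phi i),
      (forall y, 0 <= phi i y <= 1) & forall y, phi i y != 0 -> U (s i) y]) /\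
    forall y, E y -> exists2 i, (i < n)%N & phi i y = 1.
Proof.
move=> cE EU.
have H x : exists phi : G -> R, E x -> [/\ ccr setT phi, (forall y, 0 <= phi y <= 1),
    (forall y, phi y != 0 -> U x y) & \forall y \near x, phi y = 1].
  have [Ex|] := pselect (E x); last by move=> nE; exists (fun=> 0).
  by have [phi Hphi] := bump_at (EU x Ex); exists phi.
have [phi Hphi] := choice H.
have EN x : E x -> nbhs x [set y | phi x y = 1] by move=> /Hphi[].
have [n [s [sE Es]]] := compact_finite_nbhs_cover point cE EN.
exists n, s, (fun i => phi (s i)); split => [i ni|y /Es[i ni yi]]; last by exists i.
by have [? ? ? ?] := Hphi _ (sE i ni); split => //; exact: sE.
Qed.

Lemma exists_cutoff_in (K U : set G) : compact K -> open U -> K `<=` U ->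
  exists chi : G -> R, [/\ ccr setT chi, (forall y, 0 <= chi y <= 1),
    (forall y, K y -> chi y = 1) & forall y, chi y != 0 -> U y].
Proof.
move=> cK oU KU.
have KN x : K x -> nbhs x U by move=> /KU Ux; apply: open_nbhs_nbhs.
have [n [s [phi [H Ks]]]] := exists_bumps cK KN.
exists (fun x => \sum_(i < n) pu_weight phi i x); split.
- apply: ccr_sum => i ni; apply: ccrM_l; first by have [] := H i ni.
  apply: (@cont_on_prod R G setT i (fun j x => 1 - phi j x)) => j ji.
  apply: cont_onB; first exact: cont_on_cst.
  by have [_ []] := H j (ltn_trans ji ni).
- move=> y; apply/andP; split; last by apply: pu_weight_sum_le1 => i /H[].
  by apply: sumr_ge0 => i _; apply: (@pu_weight_ge0 _ _ _ n) => // j /H[].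
- by move=> y /Ks[i ni phi1]; exact: pu_weight_sum1 phi1.
move=> y; apply: contraPP => nU; rewrite big1 ?eqxx// => i _.
have [_ _ _ HU] := H i (ltn_ord i).
by rewrite /pu_weight (_ : phi i y = 0) ?mul0r//; apply/eqP; apply: contra_notT nU; exact: HU.
Qed.

Lemma exists_cutoff (K : set G) : compact K -> exists chi : G -> R,
  [/\ ccr setT chi, (forall y, 0 <= chi y <= 1) & forall y, K y -> chi y = 1].
Proof.
move=> cK; have [chi [? ? ? _]] := exists_cutoff_in cK openT (@subsetT _ K).
by exists chi.
Qed.

Definition finite_rank (H : G * G -> R[i]) := exists n (p q : nat -> G -> R[i]),
  (forall i, ccs setT (p i) /\ ccs setT (q i)) /\
  forall z, H z = \sum_(i < n) p i z.1 * q i z.2.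

Lemma finite_rank_eq H1 H2 : H1 =1 H2 -> finite_rank H1 -> finite_rank H2.
Proof. by move=> H12 [n [p [q [pq E]]]]; exists n, p, q; split => // z; rewrite -H12. Qed.

Lemma finite_rank0 : finite_rank (fun=> 0).
Proof.
exists 0%N, (fun _ _ => 0), (fun _ _ => 0); split; last by move=> z; rewrite big_ord0.
by move=> _; split; exact: ccs0.
Qed.

Lemma finite_rankD H1 H2 : finite_rank H1 -> finite_rank H2 ->
  finite_rank (fun z => H1 z + H2 z).
Proof.
move=> [n1 [p1 [q1 [pq1 E1]]]] [n2 [p2 [q2 [pq2 E2]]]].
exists (n1 + n2)%N, (fun i => if (i < n1)%N then p1 i else p2 (i - n1)%N),
  (fun i => if (i < n1)%N then q1 i else q2 (i - n1)%N); split.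
  by move=> i; case: ifP.
move=> z; rewrite big_split_ord /= E1 E2; congr (_ + _); apply: eq_bigr => i _.
  by rewrite ltn_ord.
by rewrite ltnNge leq_addr /= addKn.
Qed.

Lemma finite_rank1 (f g : G -> R[i]) : ccs setT f -> ccs setT g ->
  finite_rank (fun z => f z.1 * g z.2).
Proof.
move=> cf cg; exists 1%N, (fun=> f), (fun=> g); split => // z.
by rewrite big_ord1.
Qed.

Lemma finite_rankM (f g : G -> R[i]) H : cont_on setT f -> cont_on setT g -> finite_rank H ->
  finite_rank (fun z => f z.1 * g z.2 * H z).
Proof.
move=> cf cg [n [p [q [pq E]]]].
exists n, (fun i x => f x * p i x), (fun i x => g x * q i x); split.
  by move=> i; have [cp cq] := pq i; split; [exact: (ccsM_r cf cp)|exact: (ccsM_r cg cq)].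
by move=> z; rewrite E mulr_sumr; apply: eq_bigr => i _; rewrite /=; ring.
Qed.

Lemma finite_rankZ (c : R[i]) H : finite_rank H -> finite_rank (fun z => c * H z).
Proof.
move=> fH.
have cc (a : R[i]) : cont_on setT (fun _ : G => a) by exact: cont_on_cst.
by apply: finite_rank_eq (finite_rankM (cc c) (cc 1) fH) => z; rewrite mulr1.
Qed.

Lemma finite_rank_sum n (H : nat -> G * G -> R[i]) :
  (forall i, (i < n)%N -> finite_rank (H i)) -> finite_rank (fun z => \sum_(i < n) H i z).
Proof.
elim: n => [_|n IH HH].
  by apply: (@finite_rank_eq (fun=> 0)); [move=> z; rewrite big_ord0|exact: finite_rank0].
apply: (@finite_rank_eq (fun z => \sum_(i < n) H i z + H n z)).
  by move=> z; rewrite big_ord_recr.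
by apply: finite_rankD; [apply: IH => i ni; apply: HH; exact: ltnW|exact: HH].
Qed.

(** Near each point of [E] the kernel is within [e] of a constant on a box. Telescoping weights made
    of products of bumps glue these constants, and their products expand into finitely many terms of
    rank one. *)
Lemma finite_rank_approx (D E : set (G * G)) (k : G * G -> R[i]) (e : R) :
  cont_on D k -> compact E -> E `<=` D -> 0 < e ->
  exists H, finite_rank H /\ forall z, E z -> cmod (k z - H z) <= e.
Proof.
move=> ck cE ED e0.
have HH z : exists b : (G -> R) * (G -> R), E z ->
   [/\ ccr setT b.1, ccr setT b.2,
     (forall x, 0 <= b.1 x <= 1) /\ (forall x, 0 <= b.2 x <= 1),
     \forall w \near z, b.1 w.1 * b.2 w.2 = 1
     & forall w, b.1 w.1 * b.2 w.2 != 0 -> D w -> cmod (k w - k z) <= e].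
  have [Ez|] := pselect (E z); last by move=> nE; exists (fun=> 0, fun=> 0).
  have /cvgCdist/(_ e e0) kz := ck z (ED z Ez).
  have [[A B] [/= Az Bz] AB] : nbhs z [set w | D w -> cmod (k w - k z) < e] by exact: kz.
  have [phi [c1 b1 s1 n1]] := bump_at Az.
  have [psi [c2 b2 s2 n2]] := bump_at Bz.
  exists (phi, psi) => _; split => //=.
    exists ([set x | phi x = 1], [set x | psi x = 1]) => // -[x y] [/= -> ->].
    by rewrite mulr1.
  move=> [x y] /=; rewrite mulf_eq0 negb_or => /andP[/s1 Ax /s2 By] Dw.
  by apply/ltW; apply: (AB (x, y)).
have [b Hb] := choice HH.
have EN z : E z -> nbhs z [set w | (b z).1 w.1 * (b z).2 w.2 = 1] by move=> /Hb[].
have [n [s [sE Es]]] := compact_finite_nbhs_cover (point, point) cE EN.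
pose w i (z : G * G) : R := (b (s i)).1 z.1 * (b (s i)).2 z.2.
have w01 z i : (i < n)%N -> 0 <= w i z <= 1.
  move=> ni; have [_ _ [b1 b2] _ _] := Hb _ (sE i ni).
  have /andP[l1 u1] := b1 z.1; have /andP[l2 u2] := b2 z.2.
  by rewrite mulr_ge0//= mulr_ile1.
exists (fun z => \sum_(i < n) k (s i) * (pu_weight w i z)%:C%C); split.
  apply: (@finite_rank_sum n (fun i z => k (s i) * (pu_weight w i z)%:C%C)) => i ni.
  apply: (@finite_rankZ (k (s i)) (fun z => (pu_weight w i z)%:C%C)).
  (* Multiplication by one factor [1 - w l z] preserves finite rank, hence so does the whole
     product. *)
  suff HP j H : (j <= i)%N -> finite_rank H ->
      finite_rank (fun z => H z * (\prod_(l < j) (1 - w l z))%:C%C).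
    have [c1 c2 _ _ _] := Hb _ (sE i ni).
    have := @HP i _ (leqnn i) (finite_rank1 (ccs_real c1) (ccs_real c2)).
    apply: finite_rank_eq => z /=.
    by rewrite /pu_weight /w !rmorphM.
  elim: j H => [|j IH] H ji fH.
    by apply: finite_rank_eq fH => z; rewrite big_ord0 mulr1.
  have [c1 c2 _ _ _] := Hb _ (sE j (ltn_trans ji ni)).
  have cc (u : G -> R) : ccr setT u -> cont_on setT (fun x => (u x)%:C%C).
    by move=> [cu _]; exact: cont_onC_real.
  have := IH (fun z => H z + (-1) * (((b (s j)).1 z.1)%:C%C * ((b (s j)).2 z.2)%:C%C * H z)) (ltnW ji).
  have H2 := finite_rankD fH (finite_rankZ (-1) (finite_rankM (cc _ c1) (cc _ c2) fH)).
  move=> /(_ H2); apply: finite_rank_eq => z.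
  by rewrite big_ord_recr /= rmorphM /= rmorphB /= rmorph1 /w rmorphM /=; ring.
move=> z Ez; have [i0 n0 wz] := Es z Ez.
have W1 := pu_weight_sum1 (b := w) n0 wz.
have -> : k z - \sum_(i < n) k (s i) * (pu_weight w i z)%:C%C =
    \sum_(i < n) (k z - k (s i)) * (pu_weight w i z)%:C%C.
  have {1}-> : k z = \sum_(i < n) k z * (pu_weight w i z)%:C%C.
    by rewrite -mulr_sumr -rmorph_sum W1 mulr1.
  by rewrite -sumrB; apply: eq_bigr => i _; rewrite mulrBl.
apply: le_trans (cmod_sum n (fun i => (k z - k (s i)) * (pu_weight w i z)%:C%C)) _.
have -> : e = \sum_(i < n) e * pu_weight w i z by rewrite -mulr_sumr W1 mulr1.
apply: ler_sum => i _; have P0 := pu_weight_ge0 (w01 z) (ltn_ord i).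
rewrite cmodM cmod_real ger0_norm//.
(* A bump that does not vanish puts [z] in the box where [k] is within [e] of [k (s i)]. *)
have [w0|w0] := eqVneq (w i z) 0.
  by rewrite /pu_weight w0 mul0r !mulr0.
apply: ler_wpM2r => //.
by have [_ _ _ _] := Hb _ (sE i (ltn_ord i)); apply => //; exact: ED.
Qed.

End bumps.

(** * Integration of compactly supported functions *)

Section integration.
Context (R : realType) (G : ptopologicalType).
Hypothesis hG : hausdorff_space G.

Lemma open_borel (U : set G) : open U -> measurable (U : set (borel G)).
Proof. by move=> oU; exact: sub_sigma_algebra. Qed.

Lemma closed_borel (D : set G) : closed D -> measurable (D : set (borel G)).
Proof.
by move=> cD; rewrite -(setCK D); apply: measurableC; apply: open_borel; exact: closed_openC.
Qed.

Lemma cont_on_measurable (D : set G) (u : G -> R) : closed D -> cont_on D u ->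
  measurable_fun (D : set (borel G)) u.
Proof.
move=> clD cu; apply: (measurability _ (RGenOInfty.measurableE R)).
move=> _ [_ [a ->] <-].
have oA : open `]a, +oo[%classic by exact: interval_open.
rewrite (_ : D `&` _ = D `&` [set y | D y -> `]a, +oo[%classic (u y)]°).
  by apply: measurableI; [exact: closed_borel|apply: open_borel; exact: open_interior].
apply/seteqP; split=> y [Dy H]; split => //; last by have /(_ Dy) := interior_subset H.
have nA : nbhs (u y) `]a, +oo[%classic by apply: open_nbhs_nbhs; split.
exact: (cu y Dy _ nA).
Qed.

Context (m : {measure set (borel G) -> \bar R}) (D : set G).
Hypothesis clD : closed D.
Hypothesis fm : forall K : set G, compact K -> (m K < +oo)%E.
Implicit Types (u v w : G -> R) (f g : G -> R[i]).

Let mD : measurable (D : set (borel G)). Proof. exact: closed_borel. Qed.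

Lemma ccr_integrable u : ccr D u -> m.-integrable D (EFin \o u).
Proof.
move=> cu; have [B B0 uB] := ccr_bounded clD cu.
have [cu' [K cK uK]] := cu.
have mK : measurable (K : set (borel G)).
  exact: (closed_borel (compact_closed hG cK)).
have mu := cont_on_measurable clD cu'.
apply/integrableP; split; first exact/measurable_EFinP.
apply: (@le_lt_trans _ _ (\int[m]_(x in D) (B * \1_K x)%:E)%E).
  apply: ge0_le_integral => //=.
  - by apply/measurable_EFinP; exact: measurableT_comp.
  - by apply/measurable_EFinP; apply: measurable_funM => //; exact: measurable_indic.
  move=> x Dx; rewrite lee_fin; have [u0|u0] := eqVneq (u x) 0.
    by rewrite u0 normr0 mulr_ge0.
  by rewrite indicE mem_set ?mulr1 ?uB//; exact: uK.
rewrite (eq_integral (fun x : borel G => B%:E * (\1_(K : set (borel G)) x)%:E)%E); last by move=> x _; rewrite EFinM.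
rewrite ge0_integralZl_EFin//; last by apply/measurable_EFinP; exact: measurable_indic.
rewrite integral_indic// lte_mul_pinfty//; apply: le_lt_trans (fm cK).
by apply: le_measure; rewrite ?inE//; exact: measurableI.
Qed.

Definition rI u : R := (\int[m]_(x in (D : set (borel G))) u x)%R.

Lemma rI_eq u v : (forall x, D x -> u x = v x) -> rI u = rI v.
Proof. by move=> uv; apply: eq_Rintegral => x; rewrite inE; exact: uv. Qed.

Lemma rI0 : rI (fun=> 0) = 0.
Proof. by rewrite /rI /Rintegral integral0. Qed.

Lemma rID u v : ccr D u -> ccr D v -> rI (fun x => u x + v x) = rI u + rI v.
Proof. by move=> cu cv; apply: RintegralD => //; exact: ccr_integrable. Qed.

Lemma rIZ (c : R) u : ccr D u -> rI (fun x => c * u x) = c * rI u.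
Proof. by move=> cu; apply: RintegralZl => //; exact: ccr_integrable. Qed.

Lemma rIN u : ccr D u -> rI (fun x => - u x) = - rI u.
Proof.
move=> cu; rewrite -mulN1r -rIZ//; apply: rI_eq => x _.
by rewrite mulN1r.
Qed.

Lemma rIB u v : ccr D u -> ccr D v -> rI (fun x => u x - v x) = rI u - rI v.
Proof. by move=> cu cv; rewrite rID ?rIN//; exact: ccrN. Qed.

Lemma rI_ge0 u : (forall x, D x -> 0 <= u x) -> 0 <= rI u.
Proof. by move=> u0; apply: Rintegral_ge0 => x; exact: u0. Qed.

Lemma rI_le u v : ccr D u -> ccr D v -> (forall x, D x -> u x <= v x) -> rI u <= rI v.
Proof. by move=> cu cv uv; apply: le_Rintegral => //; exact: ccr_integrable. Qed.

Lemma rI_sum n (u : nat -> G -> R) : (forall i, (i < n)%N -> ccr D (u i)) ->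
  rI (fun x => \sum_(i < n) u i x) = \sum_(i < n) rI (u i).
Proof.
elim: n => [_|n IH H].
  by rewrite big_ord0 -[RHS]rI0; apply: rI_eq => x _; rewrite big_ord0.
rewrite big_ord_recr /= -IH => [|i ni]; last by apply: H; exact: ltnW.
rewrite -rID; [|by apply: ccr_sum => i ni; apply: H; exact: ltnW|exact: H].
by apply: rI_eq => x _; rewrite big_ord_recr.
Qed.

(** The quadratic form $s^2\int u-2st\int w+t^2\int v$ is nonnegative because its integrand is, by
    the pointwise bound. If $\int u\neq 0$, the values $s=\int w$ and $t=\int u$ give the
    inequality. *)
Lemma rI_cauchy_schwarz u v w : ccr D u -> ccr D v -> ccr D w ->
  (forall x, D x -> 0 <= u x) -> (forall x, D x -> 0 <= v x) ->
  (forall x, D x -> w x ^+ 2 <= u x * v x) -> rI w ^+ 2 <= rI u * rI v.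
Proof.
move=> cu cv cw u0 v0 wuv.
have U0 := rI_ge0 u0; have V0 := rI_ge0 v0.
have H s t : 0 <= s ^+ 2 * rI u - 2 * s * t * rI w + t ^+ 2 * rI v.
  have c1 := ccrZ (s ^+ 2) cu; have c2 := ccrZ (2 * s * t) cw; have c3 := ccrZ (t ^+ 2) cv.
  rewrite -!rIZ// -rIB// -rID//; last by apply: ccrD => //; exact: ccrN.
  apply: rI_ge0 => x Dx; have := wuv x Dx; have := u0 x Dx; have := v0 x Dx.
  move: (u x) (v x) (w x) => a b c b0 a0 cab.
  have := ler_wsqrtr cab; rewrite sqrtr_sqr sqrtrM//.
  move: (sqr_sqrtr a0) (sqr_sqrtr b0) (sqrtr_ge0 a) (sqrtr_ge0 b).
  move: (Num.sqrt a) (Num.sqrt b) => p q <- <- p0 q0 cpq.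
  have : `|s * t * c| <= `|s * p| * `|t * q|.
    rewrite !normrM (ger0_norm p0) (ger0_norm q0).
    have -> : `|s| * p * (`|t| * q) = `|s| * `|t| * (p * q) by ring.
    by rewrite ler_wpM2l// mulr_ge0.
  move=> /(le_trans (ler_norm _)).
  rewrite -normrM => H.
  have := sqr_ge0 (`|s * p| - `|t * q|).
  rewrite sqrrB !real_normK ?num_real// -mulr_natl -normrM.
  have -> : s ^+ 2 * p ^+ 2 = (s * p) ^+ 2 by ring.
  have -> : t ^+ 2 * q ^+ 2 = (t * q) ^+ 2 by ring.
  by lra.
have [U00|Un] := eqVneq (rI u) 0.
  have [W0|Wn] := eqVneq (rI w) 0; first by rewrite W0 expr0n mulr_ge0.
  (* With [rI u = 0] this choice makes the form equal to -1, a contradiction. *)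
  have := H ((rI v + 1) / (2 * rI w)) 1.
  rewrite U00 mulr0 add0r expr1n mul1r mulr1.
  have -> : 2 * ((rI v + 1) / (2 * rI w)) * rI w = rI v + 1 by field.
  by lra.
have := H (rI w) (rI u).
have Up : 0 < rI u by rewrite lt_def Un.
have -> : rI w ^+ 2 * rI u - 2 * rI w * rI u * rI w + rI u ^+ 2 * rI v =
  rI u * (rI u * rI v - rI w ^+ 2) by ring.
by rewrite pmulr_rge0// subr_ge0.
Qed.

Definition cI f : R[i] := cintegral m D f.

Lemma cI_Re f : complex.Re (cI f) = rI (fun x => complex.Re (f x)). Proof. by []. Qed.
Lemma cI_Im f : complex.Im (cI f) = rI (fun x => complex.Im (f x)). Proof. by []. Qed.

Lemma cI_eq f g : (forall x, D x -> f x = g x) -> cI f = cI g.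
Proof. by move=> fg; apply: complexP; rewrite ?cI_Re ?cI_Im; apply: rI_eq => x /fg ->. Qed.

Lemma cID f g : ccs D f -> ccs D g -> cI (fun x => f x + g x) = cI f + cI g.
Proof.
move=> cf cg; apply: complexP.
  rewrite ReD !cI_Re -rID; [|exact: ccs_Re..].
  by apply: rI_eq => x _; rewrite ReD.
rewrite ImD !cI_Im -rID; [|exact: ccs_Im..].
by apply: rI_eq => x _; rewrite ImD.
Qed.

Lemma cIZ (c : R[i]) f : ccs D f -> cI (fun x => c * f x) = c * cI f.
Proof.
move=> cf; have cr := ccs_Re cf; have ci := ccs_Im cf.
apply: complexP; rewrite ?ReM ?ImM ?cI_Re ?cI_Im -!rIZ//.
  by rewrite -rIB; [|exact: ccrZ..]; apply: rI_eq => x _; rewrite ReM.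
by rewrite -rID; [|exact: ccrZ..]; apply: rI_eq => x _; rewrite ImM.
Qed.

Lemma cIN f : ccs D f -> cI (fun x => - f x) = - cI f.
Proof. by move=> cf; rewrite -mulN1r -cIZ//; apply: cI_eq => x _; rewrite mulN1r. Qed.

Lemma ccsN f : ccs D f -> ccs D (fun x => - f x).
Proof.
move=> cf; have := ccsZ (-1) cf; rewrite (_ : (fun x => -1 * f x) = (fun x => - f x))//.
by apply/funext => x; rewrite mulN1r.
Qed.

Lemma ccsB f g : ccs D f -> ccs D g -> ccs D (fun x => f x - g x).
Proof. by move=> cf cg; apply: ccsD => //; exact: ccsN. Qed.

Lemma cIB f g : ccs D f -> ccs D g -> cI (fun x => f x - g x) = cI f - cI g.
Proof. by move=> cf cg; rewrite cID ?cIN//; exact: ccsN. Qed.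

Lemma cI_conj f : ccs D f -> cI (fun x => ((f x)^*)%C) = ((cI f)^*)%C.
Proof.
move=> cf; apply: complexP.
  by rewrite Re_conj !cI_Re; apply: rI_eq => x _; rewrite Re_conj.
by rewrite Im_conj !cI_Im -rIN; [|exact: ccs_Im]; apply: rI_eq => x _; rewrite Im_conj.
Qed.

Lemma cI_real u : cI (fun x => (u x)%:C%C) = (rI u)%:C%C.
Proof. by apply: complexP; rewrite ?cI_Re ?cI_Im//= rI0. Qed.

Lemma cI_sum n (f : nat -> G -> R[i]) : (forall i, (i < n)%N -> ccs D (f i)) ->
  cI (fun x => \sum_(i < n) f i x) = \sum_(i < n) cI (f i).
Proof.
elim: n => [_|n IH H].
  rewrite big_ord0 -[RHS](_ : cI (fun=> (0 : R)%:C%C) = 0); last by rewrite cI_real rI0.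
  by apply: cI_eq => x _; rewrite big_ord0.
rewrite big_ord_recr /= -IH => [|i ni]; last by apply: H; exact: ltnW.
rewrite -cID; [|by apply: ccs_sum => i ni; apply: H; exact: ltnW|exact: H].
by apply: cI_eq => x _; rewrite big_ord_recr.
Qed.

(** With $z=\int f$, integrate $\mathrm{Re}(\bar z f)\le|z||f|$ and divide by $|z|$. *)
Lemma cmod_cI_le f : ccs D f -> cmod (cI f) <= rI (fun x => cmod (f x)).
Proof.
move=> cf; have I0 : 0 <= rI (fun x => cmod (f x)) by apply: rI_ge0 => x _; exact: cmod_nneg.
have [->|z0] := eqVneq (cmod (cI f)) 0; first by [].
have zp : 0 < cmod (cI f) by rewrite lt_def z0 cmod_nneg.
rewrite -(ler_pM2l zp) -expr2 cmod_sqr.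
have cr := ccs_Re cf; have ci := ccs_Im cf; have ca := ccs_cmod cf.
have -> : complex.Re (cI f) ^+ 2 + complex.Im (cI f) ^+ 2 =
    rI (fun x => complex.Re (cI f) * complex.Re (f x) + complex.Im (cI f) * complex.Im (f x)).
  by rewrite rID; [rewrite !rIZ|exact: ccrZ..].
rewrite -rIZ//.
apply: rI_le; [by apply: ccrD; exact: ccrZ|exact: ccrZ|move=> x _].
rewrite -(cmod_conj (cI f)) -cmodM.
apply: le_trans (le_trans (ler_norm _) (Re_norm_le _)).
by rewrite ReM Re_conj Im_conj mulNr opprK.
Qed.

End integration.

Lemma closed_coincidence (T U : topologicalType) (f g : T -> U) :
  hausdorff_space U -> continuous f -> continuous g -> closed [set x | f x = g x].
Proof.
move=> hU cf cg x clx; apply: hU => A B Ax Bx.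
have nA : nbhs x (f @^-1` A) by exact: cf.
have nB : nbhs x (g @^-1` B) by exact: cg.
have [y [/= fg [Ay By]]] := clx _ (filterI nA nB).
by exists (f y); split => //; rewrite fg.
Qed.

(** * Groupoids *)

Section groupoid_algebra.
Context (G : Type) (Gam : groupoid G).
Local Notation s := (gsrc Gam).
Local Notation r := (grng Gam).
Local Notation inv := (ginv Gam).
Local Notation mul := (gmul Gam).

Lemma gunits_src g : gunits Gam (s g). Proof. exact: gsrc_src. Qed.
Lemma gunits_rng g : gunits Gam (r g). Proof. exact: gsrc_rng. Qed.

Lemma ginvK g : inv (inv g) = g.
Proof.
rewrite -{1}(gmul_src Gam (inv (inv g))) gsrc_inv grng_inv -gmulVg.
by rewrite gmulA ?gsrc_inv ?grng_inv// gmulVg gsrc_inv gmul_rng.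
Qed.

Lemma gmulgK h a : s h = r a -> mul (mul h a) (inv a) = h.
Proof. by move=> ha; rewrite -gmulA// ?grng_inv// gmulgV -ha gmul_src. Qed.

Lemma gmulgVK h a : s h = s a -> mul (mul h (inv a)) a = h.
Proof. by move=> ha; rewrite -gmulA ?gsrc_inv ?grng_inv// gmulVg -ha gmul_src. Qed.

Lemma gsrc_mulV h a : s h = s a -> s (mul h (inv a)) = r a.
Proof. by move=> ha; rewrite gsrc_mul ?gsrc_inv ?grng_inv. Qed.

Lemma grng_mulV h a : s h = s a -> r (mul h (inv a)) = r h.
Proof. by move=> ha; rewrite grng_mul ?gsrc_inv ?grng_inv. Qed.

Lemma ginvM g h : s g = r h -> inv (mul g h) = mul (inv h) (inv g).
Proof.
move=> gh; have E : mul (mul g h) (mul (inv h) (inv g)) = r (mul g h).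
  rewrite gmulA ?gsrc_mul ?grng_mul ?gsrc_inv ?grng_inv// gmulgK// ?gmulgV//.
rewrite -{1}(gmul_src Gam (inv (mul g h))) gsrc_inv -E.
rewrite gmulA ?gsrc_inv ?gsrc_mul ?grng_mul ?grng_inv ?gsrc_inv//.
by rewrite gmulVg gsrc_mul// -(grng_inv Gam h) -(grng_mul (g:=inv h) (h:=inv g)) ?gsrc_inv ?grng_inv// gmul_rng.
Qed.

Lemma ginv_mulV h a : s h = s a -> inv (mul h (inv a)) = mul a (inv h).
Proof. by move=> ha; rewrite ginvM ?grng_inv// ginvK. Qed.

Lemma gmul_mulV g a b : s g = r b -> s a = r b ->
  mul (mul g b) (inv (mul a b)) = mul g (inv a).
Proof.
move=> gb ab; rewrite ginvM// gmulA ?gsrc_mul ?grng_inv//.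
  by rewrite gmulgK.
by rewrite gsrc_inv.
Qed.

End groupoid_algebra.

Section groupoid_topology.
Context (R : realType) (G : ptopologicalType) (Gam : groupoid G).
Hypothesis lcG : locally_compact_groupoid Gam.
Local Notation s := (gsrc Gam).
Local Notation r := (grng Gam).
Local Notation inv := (ginv Gam).
Local Notation mul := (gmul Gam).
Local Notation D := (gfiber Gam).
Let hG := lcg_hausdorff lcG.
Let lG := lcg_locally_compact lcG.

Lemma cont_on_mul (T : topologicalType) (E : set T) (f g : T -> G) :
  cont_on E f -> cont_on E g -> (forall x, E x -> s (f x) = r (g x)) ->
  cont_on E (fun x => mul (f x) (g x)).
Proof.
move=> cf cg fg; have cm : cont_on (gcomposable Gam) (fun p => mul p.1 p.2).
  by apply/cont_onP; exact: lcg_mul_continuous.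
by apply: (cont_on_comp _ (cont_on_pair cf cg) cm) => x Ex; exact: fg.
Qed.

Lemma cont_on_inv (T : topologicalType) (E : set T) (f : T -> G) :
  cont_on E f -> cont_on E (fun x => inv (f x)).
Proof.
move=> cf x Ex; apply: continuous_cvg; last exact: cf.
exact: (lcg_inv_continuous lcG).
Qed.

Lemma cont_on_id (T : topologicalType) (E : set T) : cont_on E (fun x => x).
Proof. by move=> x _; exact: cvg_within. Qed.

Lemma gsrc_continuous : continuous s.
Proof.
apply: cont_onT; apply: (@cont_on_eq _ _ _ (fun g => mul (inv g) g)).
  by move=> g _; exact: gmulVg.
apply: cont_on_mul; [by apply: cont_on_inv; exact: cont_on_id|exact: cont_on_id|].
by move=> g _; exact: gsrc_inv.
Qed.

Lemma grng_continuous : continuous r.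
Proof.
apply: cont_onT; apply: (@cont_on_eq _ _ _ (fun g => mul g (inv g))).
  by move=> g _; exact: gmulgV.
apply: cont_on_mul; [exact: cont_on_id|by apply: cont_on_inv; exact: cont_on_id|].
by move=> g _; rewrite grng_inv.
Qed.

Lemma closed_gunits : closed (gunits Gam).
Proof. by apply: closed_coincidence => //; [exact: gsrc_continuous|move=> x; exact: cvg_id]. Qed.

Lemma closed_gfiber x : closed (D x).
Proof.
by apply: closed_coincidence => //; [exact: gsrc_continuous|move=> y; exact: cvg_cst].
Qed.

(** The pairs (h, a) for which h a^-1 is defined: the domain of a convolution kernel. *)
Definition cosource : set (G * G) := [set z | s z.1 = s z.2].

Lemma src_pair_continuous (T : topologicalType) (f : T -> G) : continuous f -> continuous (s \o f).
Proof. by move=> cf x; apply: continuous_comp; [exact: cf|exact: gsrc_continuous]. Qed.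

Lemma closed_cosource : closed cosource.
Proof.
apply: closed_coincidence => //; apply: src_pair_continuous => z.
  exact: cvg_fst.
exact: cvg_snd.
Qed.

Lemma closed_composable : closed (gcomposable Gam).
Proof.
apply: closed_coincidence => //.
  by apply: src_pair_continuous => z; exact: cvg_fst.
by move=> z; apply: continuous_comp; [exact: cvg_snd|exact: grng_continuous].
Qed.

Definition gmulset (A B : set G) : set G :=
  [set g | exists a b, [/\ A a, B b, s a = r b & g = mul a b]].

Lemma compact_gmulset A B : compact A -> compact B -> compact (gmulset A B).
Proof.
move=> cA cB; have cAB := compact_closedI (compact_setX cA cB) closed_composable.
have -> : gmulset A B = (fun p => mul p.1 p.2) @` ((A `*` B) `&` gcomposable Gam).
  apply/seteqP; split=> [g [a [b [Aa Bb ab ->]]]|g [[a b] [[/= Aa Bb] ab] <-]].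
    by exists (a, b).
  by exists a, b.
apply: continuous_compact cAB; apply/cont_onP.
apply: (@cont_on_sub _ _ (gcomposable Gam)); first by move=> p [].
by apply/cont_onP; exact: lcg_mul_continuous.
Qed.

Lemma compact_ginv A : compact A -> compact (inv @` A).
Proof.
move=> cA; apply: continuous_compact cA; apply/cont_onP; apply: continuous_cont_on.
exact: (lcg_inv_continuous lcG).
Qed.

Lemma compact_gsrc A : compact A -> compact (s @` A).
Proof.
move=> cA; apply: continuous_compact cA; apply/cont_onP; apply: continuous_cont_on.
exact: gsrc_continuous.
Qed.

Lemma compact_grng A : compact A -> compact (r @` A).
Proof.
move=> cA; apply: continuous_compact cA; apply/cont_onP; apply: continuous_cont_on.
exact: grng_continuous.
Qed.

Lemma cont_on_kernel (f : G -> R[i]) : cont_on setT f ->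
  cont_on cosource (fun z => f (mul z.1 (inv z.2))).
Proof.
move=> cf; have cm : cont_on cosource (fun z => mul z.1 (inv z.2)).
  apply: cont_on_mul.
  - by apply: continuous_cont_on => z; exact: cvg_fst.
  - by apply: cont_on_inv; apply: continuous_cont_on => z; exact: cvg_snd.
  - by move=> z Ez; rewrite grng_inv.
by apply: (@cont_on_comp _ _ _ _ setT _ f).
Qed.

Lemma cont_on_kernel_r (f : G -> R[i]) x g : cont_on setT f -> s g = x ->
  cont_on (D x) (fun a => f (mul g (inv a))).
Proof.
move=> cf gx; apply: (@cont_on_comp _ _ _ (D x) cosource (fun a => (g, a)) _ _ _ (cont_on_kernel cf)).
  by move=> a Da; rewrite /cosource /= gx.
by apply: cont_on_pair; [exact: cont_on_cst|exact: cont_on_id].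
Qed.

Lemma cont_on_kernel_l (f : G -> R[i]) x a : cont_on setT f -> s a = x ->
  cont_on (D x) (fun g => f (mul g (inv a))).
Proof.
move=> cf gx; apply: (@cont_on_comp _ _ _ (D x) cosource (fun g => (g, a)) _ _ _ (cont_on_kernel cf)).
  by move=> g Dg; rewrite /cosource /= gx.
by apply: cont_on_pair; [exact: cont_on_id|exact: cont_on_cst].
Qed.

(* The exact kernel vanishes off L, so multiplying the finite-rank
   approximants by a cutoff only improves the approximation. *)
Lemma kernel_approx (f : G -> R[i]) (K : set G) : ccs setT f -> compact K ->
  exists L : set G, [/\ compact L,
    forall g a, s g = s a -> K a -> f (mul g (inv a)) != 0 -> L g
    & forall e : R, 0 < e -> exists n (p q : nat -> G -> R[i]),
      [/\ forall i, ccs setT (p i) /\ ccs setT (q i),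
        forall i g, p i g != 0 -> L g &
        forall g a, s g = s a -> K a ->
          cmod (f (mul g (inv a)) - \sum_(i < n) p i g * q i a) <= e]].
Proof.
move=> [cf [S cS fS]] cK.
have [chi [[cchi [L cL chiL]] chi01 chi1]] := exists_cutoff R lG hG (compact_gmulset cS cK).
have sup g a : s g = s a -> K a -> f (mul g (inv a)) != 0 -> chi g = 1.
  move=> ga Ka /(fS _ Logic.I) Sf; apply: chi1.
  by exists (mul g (inv a)), a; split; rewrite ?gsrc_mulV ?gmulgVK.
exists L; split => // [g a ga Ka /(sup g a ga Ka) chig|e e0].
  by apply: chiL => //; rewrite chig oner_neq0.
have cE := compact_closedI (compact_setX cL cK) closed_cosource.
have [H [[n [p [q [pq HE]]]] kH]] :=
  finite_rank_approx lG hG (cont_on_kernel cf) cE (@subIsetr _ _ _) e0.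
exists n, (fun i g => (chi g)%:C%C * p i g), q; split.
- move=> i; have [cp cq] := pq i; split; last exact: cq.
  exact: (ccsM_r (cont_onC_real cchi) cp).
- move=> i g; rewrite mulf_eq0 negb_or => /andP[+ _].
  by rewrite -cmod_eq0 cmod_real normr_eq0 => /(chiL _ Logic.I).
move=> g a ga Ka.
have -> : \sum_(i < n) (chi g)%:C%C * p i g * q i a = (chi g)%:C%C * H (g, a).
  by rewrite HE mulr_sumr; apply: eq_bigr => i _; rewrite mulrA.
have -> : f (mul g (inv a)) = (chi g)%:C%C * f (mul g (inv a)).
  have [->|/(sup _ _ ga Ka) ->] := eqVneq (f (mul g (inv a))) 0; first by rewrite mulr0.
  by rewrite mul1r.
rewrite -mulrBr cmodM cmod_real.
have [Lg|nL] := pselect (L g); last first.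
  have -> : chi g = 0 by apply/eqP; apply: contra_notT nL => /(chiL _ Logic.I).
  by rewrite normr0 mul0r ltW.
have /andP[c0 c1] := chi01 g.
rewrite ger0_norm//; apply: le_trans (ler_piMl (cmod_nneg _) c1) _.
by apply: (kH (g, a)).
Qed.

(** Plays the part of Tietze extension: a function continuous only on [E], such as a fiber, is
    approximated there by functions on all of G. It is [finite_rank_approx] with the second variable
    frozen at [point]. The set [L] is chosen before [e]. *)
Lemma ccs_approx (E : set G) (f : G -> R[i]) : closed E -> ccs E f ->
  exists2 L : set G, compact L & forall e : R, 0 < e -> exists f' : G -> R[i],
    [/\ ccs setT f', forall g, f' g != 0 -> L g,
      (forall g, E g -> f g != 0 -> L g) & forall g, E g -> cmod (f g - f' g) <= e].
Proof.
move=> clE [cf [K cK fK]].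
have [chi [[cchi [L cL chiL]] chi01 chi1]] := exists_cutoff R lG hG cK.
have sup g : E g -> f g != 0 -> chi g = 1 by move=> Eg /(fK g Eg) Kg; exact: chi1.
exists L => // e e0.
have cLE := compact_setX (compact_closedI cL clE) (@compact_set1 _ (point : G)).
have ck : cont_on [set z : G * G | E z.1] (fun z => f z.1).
  apply: (@cont_on_comp _ _ _ _ E (fun z : G * G => z.1) f) => //.
  by apply: continuous_cont_on => z; exact: cvg_fst.
have sub : (L `&` E) `*` [set (point : G)] `<=` [set z : G * G | E z.1].
  by move=> z [[]].
have [H [[n [p [q [pq HE]]]] kH]] := finite_rank_approx lG hG ck cLE sub e0.
exists (fun g => (chi g)%:C%C * H (g, point)); split.
- apply: (@ccs_supp _ _ _ (fun g => (chi g)%:C%C)).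
  + by apply: ccs_real; split => //; exists L.
  + apply: cont_onCM; first exact: cont_onC_real.
    apply: (@cont_on_eq _ _ _ (fun g => \sum_(i < n) p i g * q i point)).
      by move=> g _; rewrite HE.
    apply: (@cont_onC_sum _ _ _ n (fun i g => p i g * q i point)) => i _.
    by apply: cont_onCM; [exact: (pq i).1.1|exact: cont_on_cst].
  + by move=> h _ ->; rewrite mul0r.
- move=> g; rewrite mulf_eq0 negb_or => /andP[+ _].
  by rewrite -cmod_eq0 cmod_real normr_eq0 => /(chiL _ Logic.I).
- by move=> g Eg /(sup g Eg) chig; apply: chiL => //; rewrite chig oner_neq0.
move=> g Eg.
have -> : f g = (chi g)%:C%C * f g.
  have [->|/(sup _ Eg) ->] := eqVneq (f g) 0; first by rewrite mulr0.
  by rewrite mul1r.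
rewrite -mulrBr cmodM cmod_real.
have [Lg|nL] := pselect (L g); last first.
  have -> : chi g = 0 by apply/eqP; apply: contra_notT nL => /(chiL _ Logic.I).
  by rewrite normr0 mul0r ltW.
have /andP[c0 c1] := chi01 g.
rewrite ger0_norm//; apply: le_trans (ler_piMl (cmod_nneg _) c1) _.
by apply: (kH (g, point)).
Qed.

End groupoid_topology.

(** * Continuous families of measures and convolution *)

Section continuous_families.
Context (R : realType) (G : ptopologicalType) (Gam : groupoid G).
Hypothesis lcG : locally_compact_groupoid Gam.
Local Notation s := (gsrc Gam).
Local Notation inv := (ginv Gam).
Local Notation mul := (gmul Gam).
Local Notation D := (gfiber Gam).
Let hG := lcg_hausdorff lcG.
Let clD x : closed (D x). Proof. exact: closed_gfiber. Qed.
Let mD x : measurable (D x : set (borel G)). Proof. exact: closed_borel. Qed.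

(** What Haar systems and the measures of amenability have in common. By [cf_null], integrals over
    G, where continuity in the unit is stated, agree with integrals over the fiber, where
    convolution lives. *)
Record continuous_family (nu : G -> {measure set (borel G) -> \bar R}) : Prop := {
  cf_fin : forall x, gunits Gam x -> forall K : set G, compact K -> (nu x K < +oo)%E;
  cf_null : forall x, gunits Gam x -> nu x (~` D x) = 0%E;
  cf_cont : forall f : G -> R[i], Cc f ->
    {within gunits Gam, continuous (fun x => cintegral (nu x) setT f)}
}.

Lemma rI_setT (m : {measure set (borel G) -> \bar R}) x (u : G -> R) :
  (forall K : set G, compact K -> (m K < +oo)%E) ->
  m (~` D x) = 0%E -> ccr setT u -> rI m setT u = rI m (D x) u.
Proof.
move=> fm m0 cu; congr fine.
rewrite (@negligible_integral _ _ _ m setT (~` D x))//.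
- by rewrite setTD setCK.
- by apply: measurableC; exact: mD.
- by apply: (ccr_integrable hG _ fm cu); exact: closedT.
Qed.

(** For the null complement: a point off the support has a null open neighbourhood, so every compact
    subset of the open complement of the fiber is null, and inner regularity concludes. *)
Lemma haar_family mu : haar_system Gam mu -> continuous_family mu.
Proof.
move=> H; split; [|move=> x ux|exact: haar_continuous H].
  by move=> x ux; exact: radon_compact (haar_radon H ux).
have oC : open (~` D x) by exact: closed_openC.
rewrite (radon_inner (haar_radon H ux) oC); apply/eqP; rewrite eq_le; apply/andP; split; last first.
  by apply: ereal_sup_ubound; exists set0; [split; [exact: compact0|exact: sub0set]|exact: measure0].
apply: ge_ereal_sup => _ [K [cK KD] <-].
have HN y : exists U : set G, K y -> [/\ open U, U y & mu x U = 0%E].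
  have [Ky|nK] := pselect (K y); last by exists set0.
  have : ~ measure_support (mu x) y by rewrite (haar_support H ux) => /(KD _ Ky).
  move=> /existsNP[U /not_implyP[oU /not_implyP[Uy /negP]]].
  rewrite -leNgt => U0; exists U => _; split => //.
  by apply/eqP; rewrite eq_le U0/=.
have [U HU] := choice HN.
have UK y : K y -> nbhs y (U y) by move=> /HU[oU Uy _]; apply: open_nbhs_nbhs.
have [n [t [tK Kt]]] := compact_finite_nbhs_cover point cK UK.
have mU (i : 'I_n) : measurable (U (t i) : set (borel G)).
  by apply: open_borel; have [] := HU _ (tK i (ltn_ord i)).
apply: (@le_trans _ _ (mu x (\big[setU/set0]_(i < n) U (t i)))).
  apply: le_measure; rewrite ?inE.
  - exact: (closed_borel (compact_closed hG cK)).
  - by apply: bigsetU_measurable.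
  - by move=> y /Kt[i ni Uy]; rewrite -(bigcup_mkord n (fun i => U (t i))); exists i.
have mU' i : (i < n)%N -> measurable (U (t i) : set (borel G)) by move=> ni; exact: (mU (Ordinal ni)).
apply: (le_trans (Boole_inequality (mu x) (A := fun i => U (t i)) mU')).
by rewrite big1// => i _; have [] := HU _ (tK i (ltn_ord i)).
Qed.

Context (nu : G -> {measure set (borel G) -> \bar R}).
Hypothesis cnu : continuous_family nu.

Lemma cI_setT x (f : G -> R[i]) : gunits Gam x -> ccs setT f ->
  cI (nu x) setT f = cI (nu x) (D x) f.
Proof.
move=> ux cf; apply: complexP.
  by apply: (rI_setT (cf_fin cnu ux) (cf_null cnu ux)); exact: ccs_Re.
by apply: (rI_setT (cf_fin cnu ux) (cf_null cnu ux)); exact: ccs_Im.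
Qed.

Lemma cont_on_family (f : G -> R[i]) : ccs setT f ->
  cont_on (gunits Gam) (fun x => cI (nu x) (D x) f).
Proof.
move=> cf; apply: (@cont_on_eq _ _ _ (fun x => cintegral (nu x) setT f)).
  by move=> x ux; exact: cI_setT.
by apply/cont_onP; apply: (cf_cont cnu); exact: ccs_Cc.
Qed.

Lemma ccs_family (f : G -> R[i]) : ccs setT f ->
  ccs (gunits Gam) (fun x => cI (nu x) (D x) f).
Proof.
move=> cf; split; first exact: cont_on_family.
have [_ [K cK fK]] := cf; exists (s @` K); first exact: compact_gsrc.
move=> x ux; apply: contraPP => nK.
have -> : cI (nu x) (D x) f = cI (nu x) (D x) (fun=> (0 : R)%:C%C).
  apply: cI_eq => h Dh; apply/eqP; apply: contra_notT nK => fh.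
  by exists h => //; exact: fK.
by rewrite cI_real rI0 eqxx.
Qed.

(** As a function of the unit the integral is continuous with compact support, hence bounded over
    all units. *)
Lemma family_bound (u : G -> R) : ccr setT u ->
  exists2 B, 0 <= B & forall x, gunits Gam x -> `|rI (nu x) (D x) u| <= B.
Proof.
move=> cu; have := ccs_Re (ccs_family (ccs_real cu)).
move=> /(ccr_bounded (closed_gunits lcG))[B B0 HB].
by exists B.
Qed.

Lemma ccs_kernel (f g : G -> R[i]) x h : ccs setT f -> ccs (D x) g -> s h = x ->
  ccs (D x) (fun a => f (mul h (inv a)) * g a).
Proof.
by move=> [cf _] cg hx; apply: ccsM_r cg; apply: cont_on_kernel_r.
Qed.

(** A degenerate kernel turns convolution into a combination of the functions [p i] with numerical
    coefficients. This estimate is behind the continuity of convolutions, the exchange of integrals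
    and the finite-rank approximation of fiber operators. *)
Lemma kernel_integral_approx (m : {measure set (borel G) -> \bar R}) x (f g : G -> R[i])
    (K : set G) (e : R) n (p q : nat -> G -> R[i]) h :
  (forall K : set G, compact K -> (m K < +oo)%E) ->
  ccs setT f -> ccs (D x) g -> (forall a, D x a -> g a != 0 -> K a) ->
  (forall i, ccs setT (p i) /\ ccs setT (q i)) -> s h = x ->
  (forall g a, s g = s a -> K a -> cmod (f (mul g (inv a)) - \sum_(i < n) p i g * q i a) <= e) ->
  cmod (cI m (D x) (fun a => f (mul h (inv a)) * g a) -
    \sum_(i < n) p i h * cI m (D x) (fun a => q i a * g a)) <=
  e * rI m (D x) (fun a => cmod (g a)).
Proof.
move=> fm cf cg gK pq hx He.
have cq i : ccs (D x) (fun a => q i a * g a).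
  by apply: ccsM_r cg; exact: cont_on_sub (pq i).2.1.
have cpq i : ccs (D x) (fun a => p i h * (q i a * g a)) by exact: ccsZ.
have -> : \sum_(i < n) p i h * cI m (D x) (fun a => q i a * g a) =
    cI m (D x) (fun a => \sum_(i < n) p i h * (q i a * g a)).
  rewrite (cI_sum hG (@clD x) fm (f := fun i a => p i h * (q i a * g a)))//.
  by apply: eq_bigr => i _; rewrite cIZ.
have cs := @ccs_sum _ _ (D x) n (fun i a => p i h * (q i a * g a)) (fun i _ => cpq i).
have ck := ccs_kernel cf cg hx.
rewrite -(cIB hG (@clD x) fm)//.
apply: le_trans (cmod_cI_le hG (@clD x) fm _) _; first exact: ccsB.
rewrite -(rIZ hG (@clD x) fm); last exact: ccs_cmod.
apply: (rI_le hG (@clD x) fm).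
- by apply: ccs_cmod; exact: ccsB.
- by apply: ccrZ; exact: ccs_cmod.
move=> a Da.
have -> : f (mul h (inv a)) * g a - \sum_(i < n) p i h * (q i a * g a) =
    (f (mul h (inv a)) - \sum_(i < n) p i h * q i a) * g a.
  by rewrite mulrBl mulr_suml; congr (_ - _); apply: eq_bigr => i _; rewrite mulrA.
rewrite cmodM; have [->|ga] := eqVneq (g a) 0; first by rewrite cmod0 !mulr0.
apply: ler_wpM2r; first exact: cmod_nneg.
by apply: He; [rewrite hx|exact: gK].
Qed.

Lemma ccs_fiber_convolution (m : {measure set (borel G) -> \bar R}) x (f g : G -> R[i]) :
  (forall K : set G, compact K -> (m K < +oo)%E) ->
  ccs setT f -> ccs (D x) g ->
  ccs (D x) (fun h => cI m (D x) (fun a => f (mul h (inv a)) * g a)).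
Proof.
move=> fm cf cg; have [_ [K cK gK]] := cg.
have [L [cL fL HL]] := kernel_approx lcG cf cK.
split; last first.
  exists L => // h Dh; apply: contraPP => nL.
  have -> : cI m (D x) (fun a => f (mul h (inv a)) * g a) = cI m (D x) (fun=> (0 : R)%:C%C);
    last by rewrite cI_real rI0 eqxx.
  apply: cI_eq => a Da; have [->|ga] := eqVneq (g a) 0; first by rewrite mulr0.
  rewrite [f _](_ : _ = 0) ?mul0r//; apply/eqP; apply: contra_notT nL.
  by apply: fL; [rewrite Dh Da|exact: gK].
set B := rI m (D x) (fun a => cmod (g a)).
have B0 : 0 <= B by apply: rI_ge0 => a _; exact: cmod_nneg.
apply: cont_on_uniform_limit => h Dh e e0.
have e1 : 0 < e / (B + 1) by rewrite divr_gt0// ltr_wpDl.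
have [n [p [q [pq pL He]]]] := HL _ e1.
exists (fun h => \sum_(i < n) p i h * cI m (D x) (fun a => q i a * g a)).
  apply: (@cont_onC_sum _ _ _ n (fun i h => p i h * cI m (D x) (fun a => q i a * g a))) => i _.
  apply: cont_onCM; last exact: cont_on_cst.
  by apply: cont_on_sub (pq i).1.1.
near=> h' => Dh'.
apply: le_trans (kernel_integral_approx fm cf cg gK pq Dh' He) _.
rewrite -/B mulrAC ler_pdivrMr ?ltr_wpDl//.
by rewrite ler_wpM2l ?ltW// ltrDl.
Unshelve. all: by end_near. Qed.

Definition family_convolution (f g : G -> R[i]) h : R[i] :=
  cI (nu (s h)) (D (s h)) (fun a => f (mul h (inv a)) * g a).

(** Here the fiber of integration moves with [h]. The coefficients $\int q_i g$ depend continuously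
    on the unit, and [family_bound] makes the error uniform over all fibers. *)
Lemma ccs_family_convolution (f g : G -> R[i]) : ccs setT f -> ccs setT g ->
  ccs setT (family_convolution f g).
Proof.
move=> cf cg; have [_ [K cK gK]] := cg.
have gD x : ccs (D x) g by exact: ccs_sub cg.
have gKD x a : D x a -> g a != 0 -> K a by move=> _; exact: gK.
have [L [cL fL HL]] := kernel_approx lcG cf cK.
split; last first.
  exists L => // h Dh; apply: contraPP => nL; rewrite /family_convolution.
  have -> : cI (nu (s h)) (D (s h)) (fun a => f (mul h (inv a)) * g a) =
      cI (nu (s h)) (D (s h)) (fun=> (0 : R)%:C%C); last by rewrite cI_real rI0 eqxx.
  apply: cI_eq => a Da; have [->|ga] := eqVneq (g a) 0; first by rewrite mulr0.
  rewrite [f _](_ : _ = 0) ?mul0r//; apply/eqP; apply: contra_notT nL.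
  by apply: fL; [rewrite Da|exact: gK].
have [B B0 HB] := family_bound (ccs_cmod cg).
apply: cont_on_uniform_limit => h Dh e e0.
have e1 : 0 < e / (B + 1) by rewrite divr_gt0// ltr_wpDl.
have [n [p [q [pq pL He]]]] := HL _ e1.
exists (fun h => \sum_(i < n) p i h * cI (nu (s h)) (D (s h)) (fun a => q i a * g a)).
  apply: (@cont_onC_sum _ _ _ n (fun i h => p i h * cI (nu (s h)) (D (s h)) (fun a => q i a * g a))) => i _.
  apply: cont_onCM; first exact: (pq i).1.1.
  apply: (@cont_on_comp _ _ _ setT (gunits Gam) s (fun x => cI (nu x) (D x) (fun a => q i a * g a))).
  - by move=> x _; exact: gunits_src.
  - by apply: continuous_cont_on; exact: gsrc_continuous.
  - by apply: cont_on_family; apply: ccsM_r cg; exact: (pq i).2.1.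
near=> h' => _.
have us := gunits_src Gam h'.
apply: le_trans (kernel_integral_approx (cf_fin cnu us) cf (gD _) (gKD _) pq erefl He) _.
rewrite mulrAC ler_pdivrMr ?ltr_wpDl//.
apply: ler_wpM2l; first exact: ltW.
by apply: le_trans (ler_norm _) (le_trans (HB _ us) _); rewrite lerDl.
Unshelve. all: by end_near. Qed.

End continuous_families.

Lemma eq_of_cmod_le (R : realType) (z w : R[i]) (C : R) :
  (forall e : R, 0 < e -> cmod (z - w) <= e * C) -> z = w.
Proof.
move=> H; apply/eqP; rewrite -subr_eq0 -cmod_eq0 eq_le cmod_nneg andbT.
apply/ler_addgt0Pr => e e0; rewrite add0r.
have C0 : 0 <= C by have := H 1 ltr01; rewrite mul1r; apply: le_trans; exact: cmod_nneg.
have C1 : 0 < C + 1 by rewrite ltr_wpDl.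
apply: le_trans (H (e / (C + 1)) _) _; first by rewrite divr_gt0.
by rewrite mulrAC ler_pdivrMr// ler_wpM2l ?ltW// ltrDl.
Qed.

Lemma cmod_triangle (R : realType) (v z w : R[i]) :
  cmod (z - w) <= cmod (z - v) + cmod (w - v).
Proof.
rewrite (cmod_distC w v); apply: le_trans (cmodD _ _).
by rewrite addrA subrK.
Qed.

Section integral_estimates.
Context (R : realType) (G : ptopologicalType).
Hypothesis hG : hausdorff_space G.
Context (m : {measure set (borel G) -> \bar R}) (D : set G).
Hypothesis clD : closed D.
Hypothesis fm : forall K : set G, compact K -> (m K < +oo)%E.

Lemma cI_close (u v : G -> R[i]) (w : G -> R) (e : R) : ccs D u -> ccs D v -> ccr D w ->
  (forall x, D x -> cmod (u x - v x) <= e * w x) -> cmod (cI m D u - cI m D v) <= e * rI m D w.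
Proof.
move=> cu cv cw uvw; rewrite -(cIB hG clD fm)//.
apply: le_trans (cmod_cI_le hG clD fm _) _; first exact: ccsB.
rewrite -(rIZ hG clD fm)//; apply: (rI_le hG clD fm) => //; last exact: ccrZ.
by apply: ccs_cmod; exact: ccsB.
Qed.

End integral_estimates.

(** * Convolution with respect to a Haar system *)

Section haar_convolution.
Context (R : realType) (G : ptopologicalType) (Gam : groupoid G).
Hypothesis lcG : locally_compact_groupoid Gam.
Context (mu : G -> {measure set (borel G) -> \bar R}).
Hypothesis haar_mu : haar_system Gam mu.
Local Notation s := (gsrc Gam).
Local Notation r := (grng Gam).
Local Notation inv := (ginv Gam).
Local Notation mul := (gmul Gam).
Local Notation D := (gfiber Gam).
Local Notation conv := (convolution Gam mu).
Let hG := lcg_hausdorff lcG.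
Let lG := lcg_locally_compact lcG.
Let clD x : closed (D x). Proof. exact: closed_gfiber. Qed.

Lemma haar_fin x : gunits Gam x -> forall K : set G, compact K -> (mu x K < +oo)%E.
Proof. by move=> ux; exact: radon_compact (haar_radon haar_mu ux). Qed.

Lemma conv_fiberE x f g h : s h = x ->
  conv f g h = cI (mu x) (D x) (fun a => f (mul h (inv a)) * g a).
Proof. by move=> <-. Qed.

Lemma ccs_conv x (f g : G -> R[i]) : gunits Gam x -> ccs setT f -> ccs (D x) g ->
  ccs (D x) (conv f g).
Proof.
move=> ux cf cg; have := ccs_fiber_convolution lcG (haar_fin ux) cf cg.
move=> [c1 [K cK HK]]; split.
  by apply: cont_on_eq c1 => h Dh; rewrite (conv_fiberE _ _ Dh).
by exists K => // h Dh; rewrite (conv_fiberE _ _ Dh); exact: HK.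
Qed.

Lemma ccs_convT (f g : G -> R[i]) : ccs setT f -> ccs setT g -> ccs setT (conv f g).
Proof. exact: ccs_family_convolution (haar_family lcG haar_mu) _ _. Qed.

Lemma ccs_cinvolution (f : G -> R[i]) : ccs setT f -> ccs setT (cinvolution Gam f).
Proof.
move=> [cf [K cK fK]]; split.
  apply: cont_onC_conj; apply: (@cont_on_comp _ _ _ setT setT inv f) => //.
  by apply: continuous_cont_on; exact: (lcg_inv_continuous lcG).
exists (inv @` K); first exact: compact_ginv.
move=> g _; rewrite /cinvolution conjc_eq0 => /(fK _ Logic.I) Kg.
by exists (inv g) => //; rewrite ginvK.
Qed.

Lemma ccs_translate (V : G -> R[i]) g : ccs (D (s g)) V -> ccs (D (r g)) (fun h => V (mul h g)).
Proof.
move=> [cV [K cK VK]]; split.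
  apply: (@cont_on_comp _ _ _ (D (r g)) (D (s g)) (fun h => mul h g) V _ _ cV).
    by move=> h Dh; rewrite /gfiber /= gsrc_mul.
  by apply: cont_on_mul => //; [exact: cont_on_id|exact: cont_on_cst].
exists (gmulset Gam K [set inv g]).
  by apply: compact_gmulset => //; exact: compact_set1.
move=> h Dh Vh; exists (mul h g), (inv g); split => //.
- by apply: VK => //; rewrite /gfiber /= gsrc_mul.
- by rewrite gsrc_mul// grng_inv.
- by rewrite gmulgK.
Qed.

(** The axiom of invariance concerns [Cc], while [V] is continuous merely on one fiber. It is
    approximated by some [V'] in [Cc]; the error is at most [e] times a cutoff, and invariance of
    the cutoff controls that error on both fibers. *)
Lemma haar_translate (V : G -> R[i]) g : ccs (D (s g)) V ->
  cI (mu (r g)) (D (r g)) (fun h => V (mul h g)) = cI (mu (s g)) (D (s g)) V.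
Proof.
move=> cV; have [L cL HL] := ccs_approx lcG (@clD (s g)) cV.
have [chi [cchi chi01 chi1]] := exists_cutoff R lG hG cL.
have ur := gunits_rng Gam g; have us := gunits_src Gam g.
have chiT : ccs (D (s g)) (fun h => (chi h)%:C%C) by apply: ccs_sub (ccs_real cchi).
have I1 : cI (mu (r g)) (D (r g)) (fun h => (chi (mul h g))%:C%C) =
    cI (mu (s g)) (D (s g)) (fun h => (chi h)%:C%C).
  by apply: (haar_invariant haar_mu g (f := fun h => (chi h)%:C%C)); apply: ccs_Cc => //; exact: ccs_real.
move: I1; rewrite !cI_real => /complexI I1.
apply: (@eq_of_cmod_le _ _ _ (2 * rI (mu (s g)) (D (s g)) chi)) => e e0.
have [V' [cV' V'L VL VV']] := HL e e0.
have bound h : D (s g) h -> cmod (V h - V' h) <= e * chi h.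
  move=> Dh; have [Lh|nL] := pselect (L h); first by rewrite chi1// mulr1 VV'.
  have V0 : V h = 0 by apply/eqP; apply: contra_notT nL; exact: VL.
  have V'0 : V' h = 0 by apply/eqP; apply: contra_notT nL; exact: V'L.
  rewrite V0 V'0 subr0 cmod0; apply: mulr_ge0; first exact: ltW.
  by have /andP[] := chi01 h.
have cV's : ccs (D (s g)) V' by exact: ccs_sub cV'.
have H1 := cI_close hG (@clD (s g)) (haar_fin us) cV cV's (ccr_sub (@subsetT _ _) cchi) bound.
have H2 : cmod (cI (mu (r g)) (D (r g)) (fun h => V (mul h g)) -
    cI (mu (r g)) (D (r g)) (fun h => V' (mul h g))) <= e * rI (mu (r g)) (D (r g)) (fun h => chi (mul h g)).
  apply: (cI_close hG (@clD (r g)) (haar_fin ur)).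
  - exact: ccs_translate.
  - exact: ccs_translate.
  - exact: ccs_Re (ccs_translate chiT).
  - by move=> h Dh; apply: bound; rewrite /gfiber /= gsrc_mul.
rewrite I1 in H2.
have I2 := haar_invariant haar_mu g (ccs_Cc hG cV').
apply: le_trans (cmod_triangle (cI (mu (s g)) (D (s g)) V') _ _) _.
rewrite mulrCA mulr_natl mulr2n; apply: lerD H1.
by rewrite -[X in _ - X](I2 : cI _ _ _ = cI _ _ _).
Qed.

(** For a degenerate kernel the exchange is immediate. Both iterated integrals are within
    [e * (A * B)] of the same sum of the [c i * d i], so no product measure enters. *)
Lemma kernel_fubini x (f g1 g2 : G -> R[i]) : gunits Gam x ->
  ccs setT f -> ccs (D x) g1 -> ccs (D x) g2 ->
  cI (mu x) (D x) (fun h => g1 h * cI (mu x) (D x) (fun a => f (mul h (inv a)) * g2 a)) =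
  cI (mu x) (D x) (fun a => g2 a * cI (mu x) (D x) (fun h => f (mul h (inv a)) * g1 h)).
Proof.
move=> ux cf cg1 cg2; have [_ [K cK g2K]] := cg2.
have fm := haar_fin ux.
have [L [cL fL HL]] := kernel_approx lcG cf cK.
set A := rI (mu x) (D x) (fun h => cmod (g1 h)).
set B := rI (mu x) (D x) (fun h => cmod (g2 h)).
apply: (@eq_of_cmod_le _ _ _ (2 * (A * B))) => e e0.
have [n [p [q [pq pL He]]]] := HL e e0.
have cp i : ccs (D x) (p i) by exact: ccs_sub (pq i).1.
have cq i : ccs (D x) (q i) by exact: ccs_sub (pq i).2.
pose c i := cI (mu x) (D x) (fun a => q i a * g2 a).
pose d i := cI (mu x) (D x) (fun a => p i a * g1 a).
have dE i : d i = cI (mu x) (D x) (fun a => g1 a * p i a).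
  by apply: cI_eq => a _; rewrite mulrC.
have cE i : c i = cI (mu x) (D x) (fun a => g2 a * q i a).
  by apply: cI_eq => a _; rewrite mulrC.
have ck a : D x a -> ccs (D x) (fun h => f (mul h (inv a)) * g1 h).
  by move=> Da; apply: ccsM_r cg1; apply: cont_on_kernel_l => //; exact: cf.1.
have csum (b : nat -> R[i]) (u : nat -> G -> R[i]) : (forall i, ccs (D x) (u i)) ->
    ccs (D x) (fun h => \sum_(i < n) u i h * b i).
  move=> cu; apply: (@ccs_sum _ _ _ n (fun i h => u i h * b i)) => i _.
  by apply: ccsM_l (cu i) _; exact: cont_on_cst.
have Isum (b : nat -> R[i]) (u : nat -> G -> R[i]) : (forall i, ccs (D x) (u i)) ->
    cI (mu x) (D x) (fun h => \sum_(i < n) u i h * b i) = \sum_(i < n) b i * cI (mu x) (D x) (u i).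
  move=> cu; rewrite (cI_sum hG (@clD x) fm (f := fun i h => u i h * b i)).
    by apply: eq_bigr => i _; rewrite -(cIZ hG (@clD x) fm)//; apply: cI_eq => h _; rewrite mulrC.
  by move=> i _; apply: ccsM_l (cu i) _; exact: cont_on_cst.
have cpg i : ccs (D x) (fun h => g1 h * p i h) by apply: ccsM_l cg1 _; exact: (cp i).1.
have cqg i : ccs (D x) (fun h => g2 h * q i h) by apply: ccsM_l cg2 _; exact: (cq i).1.
have E1 : cmod (cI (mu x) (D x) (fun h => g1 h * cI (mu x) (D x) (fun a => f (mul h (inv a)) * g2 a)) -
    \sum_(i < n) c i * d i) <= e * (A * B).
  have -> : \sum_(i < n) c i * d i = \sum_(i < n) c i * cI (mu x) (D x) (fun h => g1 h * p i h).
    by apply: eq_bigr => i _; rewrite dE.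
  rewrite -(Isum c (fun i h => g1 h * p i h))// [A * B]mulrC mulrA.
  apply: (cI_close hG (@clD x) fm) => //.
  - by apply: ccsM_l cg1 _; apply: (ccs_fiber_convolution lcG fm cf cg2).1.
  - exact: (csum c (fun i h => g1 h * p i h)).
  - exact: ccs_cmod.
  move=> h Dh.
  have -> : \sum_(i < n) g1 h * p i h * c i = g1 h * \sum_(i < n) p i h * c i.
    by rewrite mulr_sumr; apply: eq_bigr => i _; rewrite mulrA.
  rewrite -mulrBr cmodM mulrC; apply: ler_wpM2r; first exact: cmod_nneg.
  exact: (kernel_integral_approx lcG fm cf cg2 g2K pq Dh He).
have E2 : cmod (cI (mu x) (D x) (fun a => g2 a * cI (mu x) (D x) (fun h => f (mul h (inv a)) * g1 h)) -
    \sum_(i < n) c i * d i) <= e * (A * B).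
  have -> : \sum_(i < n) c i * d i = \sum_(i < n) d i * cI (mu x) (D x) (fun h => g2 h * q i h).
    by apply: eq_bigr => i _; rewrite -cE mulrC.
  rewrite -(Isum d (fun i h => g2 h * q i h))// mulrA.
  apply: (cI_close hG (@clD x) fm) => //.
  - apply: ccsM_l cg2 _.
    (* Up to conjugation the inner integral is a convolution by [cinvolution f], hence continuous in
       [a]. *)
    have := (ccs_fiber_convolution lcG fm (ccs_cinvolution cf) (ccs_conj cg1)).1.
    move=> /cont_onC_conj; apply: cont_on_eq => a Da.
    rewrite -(cI_conj hG (@clD x) fm).
      apply: cI_eq => h Dh; rewrite /cinvolution rmorphM /= !conjcK ginv_mulV//.
      by rewrite Da Dh.
    by apply: (ccs_kernel lcG (ccs_cinvolution cf) (ccs_conj cg1)).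
  - exact: (csum d (fun i h => g2 h * q i h)).
  - exact: ccs_cmod.
  move=> a Da.
  have -> : \sum_(i < n) g2 a * q i a * d i = g2 a * \sum_(i < n) q i a * d i.
    by rewrite mulr_sumr; apply: eq_bigr => i _; rewrite mulrA.
  rewrite -mulrBr cmodM.
  have [->|ga] := eqVneq (g2 a) 0; first by rewrite cmod0 mul0r mulr0.
  rewrite mulrC; apply: ler_wpM2r; first exact: cmod_nneg.
  have -> : \sum_(i < n) q i a * d i = cI (mu x) (D x) (fun h => \sum_(i < n) p i h * g1 h * q i a).
    rewrite (Isum (fun i => q i a) (fun i h => p i h * g1 h))//.
    by move=> i; apply: ccsM_r cg1; exact: (cp i).1.
  apply: (cI_close hG (@clD x) fm); [exact: ck| |exact: ccs_cmod|].
    by apply: (csum (fun i => q i a) (fun i h => p i h * g1 h)) => i; apply: ccsM_r cg1; exact: (cp i).1.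
  move=> h Dh.
  have -> : \sum_(i < n) p i h * g1 h * q i a = (\sum_(i < n) p i h * q i a) * g1 h.
    by rewrite mulr_suml; apply: eq_bigr => i _; ring.
  rewrite -mulrBl cmodM; apply: ler_wpM2r; first exact: cmod_nneg.
  by apply: He; [rewrite Da Dh|exact: g2K].
rewrite mulrCA mulr_natl mulr2n.
exact: le_trans (cmod_triangle _ _ _) (lerD E1 E2).
Qed.

Lemma ccs_kernel_r (f : G -> R[i]) x h : ccs setT f -> s h = x ->
  ccs (D x) (fun a => f (mul h (inv a))).
Proof.
move=> [cf [K cK fK]] hx; split; first exact: cont_on_kernel_r.
exists (gmulset Gam (inv @` K) [set h]).
  by apply: compact_gmulset => //; [exact: compact_ginv|exact: compact_set1].
move=> a Da /(fK _ Logic.I) Kha; have ha : s h = s a by rewrite hx Da.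
exists (inv (mul h (inv a))), h; split => //.
- by rewrite gsrc_inv grng_mulV.
- by rewrite ginv_mulV// gmulgVK.
Qed.

(** After the exchange of integrals, the substitution a = c b turns the inner integral into
    $(f*g)(hb^{-1})$. *)
Lemma convA x (f g k : G -> R[i]) h : gunits Gam x -> ccs setT f -> ccs setT g ->
  ccs (D x) k -> D x h -> conv f (conv g k) h = conv (conv f g) k h.
Proof.
move=> ux cf cg ck Dh; have fm := haar_fin ux.
rewrite !(conv_fiberE _ _ Dh).
transitivity (cI (mu x) (D x) (fun a => f (mul h (inv a)) *
    cI (mu x) (D x) (fun b => g (mul a (inv b)) * k b))).
  by apply: cI_eq => a Da; rewrite (conv_fiberE _ _ Da).
rewrite (kernel_fubini ux cg (ccs_kernel_r cf Dh) ck).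
apply: cI_eq => b Db; rewrite mulrC; congr (_ * _).
have hb : s h = s b by rewrite Dh Db.
rewrite (conv_fiberE (x := r b)) ?gsrc_mulV//.
pose V a := g (mul a (inv b)) * f (mul h (inv a)).
have cV : ccs (D (s b)) V.
  rewrite Db; apply: ccsM_r (ccs_kernel_r cf Dh).
  by apply: cont_on_kernel_l => //; exact: cg.1.
rewrite -Db -[LHS](haar_translate cV); apply: cI_eq => c Dc.
rewrite /V gmulgK// mulrC; congr (f _ * _).
by rewrite ginvM// gmulA ?gsrc_inv ?grng_inv.
Qed.

(** On compactly supported vectors convolution by [cinvolution f] is the adjoint of $\lambda_x(f)$:
    the kernel f(h a^-1) is transposed by [kernel_fubini] and conjugated. *)
Lemma conv_adjoint x (f g k : G -> R[i]) : gunits Gam x -> ccs setT f ->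
  ccs (D x) g -> ccs (D x) k ->
  cI (mu x) (D x) (fun h => conv f g h * ((k h)^*)%C) =
  cI (mu x) (D x) (fun h => g h * ((conv (cinvolution Gam f) k h)^*)%C).
Proof.
move=> ux cf cg ck; have fm := haar_fin ux.
transitivity (cI (mu x) (D x) (fun h => ((k h)^*)%C *
    cI (mu x) (D x) (fun a => f (mul h (inv a)) * g a))).
  by apply: cI_eq => h Dh; rewrite (conv_fiberE _ _ Dh) mulrC.
rewrite (kernel_fubini ux cf (ccs_conj ck) cg).
apply: cI_eq => a Da; congr (_ * _).
rewrite (conv_fiberE _ _ Da) -(cI_conj hG (@clD x) fm).
  apply: cI_eq => h Dh; rewrite /cinvolution rmorphM /= conjcK ginv_mulV//.
  by rewrite Da Dh.
exact: (ccs_kernel lcG (ccs_cinvolution cf) ck).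
Qed.

End haar_convolution.

(** * The Hilbert spaces of the fibers *)

Section real_norm.
Context (R : realType) (V : normedModType R[i]).
Implicit Types v w : V.

(** Norms here are valued in [R[i]]; the estimates are carried out in R. *)
Definition nm v : R := complex.Re `|v|.

Lemma nmE v : `|v| = (nm v)%:C%C.
Proof.
have := normr_ge0 v; rewrite /nm; case: `|v| => a b.
by move=> /ger0_Im /= ->.
Qed.

Lemma nm_ge0 v : 0 <= nm v.
Proof. by rewrite -ler0c -nmE. Qed.

Lemma nm_le v (c : R) : (`|v| <= c%:C%C) = (nm v <= c).
Proof. by rewrite nmE lecR. Qed.

Lemma nm0 : nm 0 = 0. Proof. by rewrite /nm normr0. Qed.

Lemma nm_eq0 v : nm v = 0 -> v = 0.
Proof. by move=> v0; apply: normr0_eq0; rewrite nmE v0. Qed.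

Lemma nmD v w : nm (v + w) <= nm v + nm w.
Proof. by rewrite -lecR rmorphD /= -!nmE ler_normD. Qed.

Lemma nmZ (c : R[i]) v : nm (c *: v) = cmod c * nm v.
Proof. by apply: complexI; rewrite rmorphM /= -!nmE -cmod_normE normrZ. Qed.

Lemma nmN v : nm (- v) = nm v. Proof. by rewrite /nm normrN. Qed.

Lemma nmB v w : nm (v - w) <= nm v + nm w.
Proof. by rewrite -(nmN w); exact: nmD. Qed.

Lemma nm_distC v w : nm (v - w) = nm (w - v).
Proof. by rewrite -nmN opprB. Qed.

End real_norm.

Section fiber_norm.
Context (R : realType) (G : ptopologicalType) (Gam : groupoid G).
Hypothesis lcG : locally_compact_groupoid Gam.
Context (mu : G -> {measure set (borel G) -> \bar R}).
Hypothesis haar_mu : haar_system Gam mu.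
Local Notation D := (gfiber Gam).
Local Notation conv := (convolution Gam mu).
Let hG := lcg_hausdorff lcG.
Let clD x : closed (D x). Proof. exact: closed_gfiber. Qed.

Definition N2 x (g : G -> R[i]) : R := rI (mu x) (D x) (fun h => cmod (g h) ^+ 2).

Lemma N2_ge0 x g : 0 <= N2 x g.
Proof. by apply: rI_ge0 => h _; exact: sqr_ge0. Qed.

Lemma N2_eq x (g k : G -> R[i]) : (forall h, D x h -> g h = k h) -> N2 x g = N2 x k.
Proof. by move=> gk; apply: rI_eq => h /gk ->. Qed.

Lemma N2_cI x g : (N2 x g)%:C%C = cI (mu x) (D x) (fun h => g h * ((g h)^*)%C).
Proof.
rewrite -cI_real; apply: cI_eq => h _.
by rewrite -sqr_normc cmod_normE rmorphXn.
Qed.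

(** With $T=1+\lambda_x(f)$, [u] is $Tg$ and [w] is the adjoint of $T$ applied to $Tg$; hence the
    cross term is $\langle g,w\rangle=\|Tg\|^2$. *)
Lemma N2_gradient_step x (f g : G -> R[i]) (t : R) (u : G -> R[i] := fun h => g h + conv f g h)
    (w : G -> R[i] := fun h => u h + conv (cinvolution Gam f) u h) :
  gunits Gam x -> ccs setT f -> ccs (D x) g ->
  N2 x (fun h => g h - t%:C%C * w h) = N2 x g - 2 * t * N2 x u + t ^+ 2 * N2 x w.
Proof.
move=> ux cf cg; have fm := haar_fin haar_mu ux.
have cu : ccs (D x) u by apply: ccsD => //; exact: ccs_conv.
have cw : ccs (D x) w by apply: ccsD => //; apply: ccs_conv => //; exact: ccs_cinvolution.
have cfs := ccs_conv lcG haar_mu ux (ccs_cinvolution lcG cf) cu.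
have cfg := ccs_conv lcG haar_mu ux cf cg.
have bar (k : G -> R[i]) : ccs (D x) k -> cont_on (D x) (fun h => ((k h)^*)%C).
  by move=> ck; exact: (ccs_conj ck).1.
have E : rI (mu x) (D x) (fun h => complex.Re (g h * ((w h)^*)%C)) = N2 x u.
  rewrite -cI_Re; apply: complexI; rewrite N2_cI.
  transitivity (complex.Re (cI (mu x) (D x) (fun h => u h * ((u h)^*)%C)))%:C%C; last first.
    by rewrite -N2_cI.
  congr (complex.Re _)%:C%C.
  transitivity (cI (mu x) (D x) (fun h => g h * ((u h)^*)%C + g h * ((conv (cinvolution Gam f) u h)^*)%C)).
    by apply: cI_eq => h _; rewrite /w rmorphD mulrDr.
  rewrite (cID hG (@clD x) fm); [|exact: (ccsM_l cg (bar _ cu))|exact: (ccsM_l cg (bar _ cfs))].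
  rewrite -(conv_adjoint lcG haar_mu ux cf cg cu) -(cID hG (@clD x) fm).
  - by apply: cI_eq => h _; rewrite /u mulrDl.
  - exact: (ccsM_l cg (bar _ cu)).
  - exact: (ccsM_l cfg (bar _ cu)).
rewrite -E.
have cgw : ccr (D x) (fun h => complex.Re (g h * ((w h)^*)%C)).
  by apply: ccs_Re; exact: (ccsM_l cg (bar _ cw)).
rewrite /N2 -(rIZ hG (@clD x) fm (2 * t) cgw) -(rIZ hG (@clD x) fm (t ^+ 2) (ccs_cmod2 cw)).
rewrite -(rIB hG (@clD x) fm); [|exact: ccs_cmod2|exact: ccrZ].
rewrite -(rID hG (@clD x) fm).
- apply: rI_eq => h _; rewrite !cmod_sqr ReM Re_conj Im_conj.
  case: (g h) => a b; case: (w h) => a' b' /=; ring.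
- by apply: ccrD; [exact: ccs_cmod2|apply: ccrN; exact: ccrZ].
- by apply: ccrZ; exact: ccs_cmod2.
Qed.

Lemma ccs_cmeasurable x g : ccs (D x) g -> cmeasurable (g \_ (D x) : borel G -> R[i]).
Proof.
move=> [cg _].
have mD : measurable (D x : set (borel G)) by exact: closed_borel.
split.
  rewrite (_ : (fun h => _) = (fun h : borel G => complex.Re (g h)) \_ (D x)).
    have M := cont_on_measurable (@clD x) (cont_onC_Re cg).
    exact: ((measurable_restrictT (fun h : borel G => complex.Re (g h)) mD).1 M).
  by apply/funext => h; rewrite /= !patchE; case: ifP.
rewrite (_ : (fun h => _) = (fun h : borel G => complex.Im (g h)) \_ (D x)).
  have M := cont_on_measurable (@clD x) (cont_onC_Im cg).
  exact: ((measurable_restrictT (fun h : borel G => complex.Im (g h)) mD).1 M).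
by apply/funext => h; rewrite /= !patchE; case: ifP.
Qed.

Lemma LnormE x g : gunits Gam x -> ccs (D x) g ->
  ('N[mu x]_2%:E[EFin \o cabs (g \_ (D x) : borel G -> R[i])] = (Num.sqrt (N2 x g))%:E)%E.
Proof.
move=> ux cg; have fm := haar_fin haar_mu ux.
have mD : measurable (D x : set (borel G)) by exact: closed_borel.
have int := ccr_integrable hG (@clD x) fm (ccs_cmod2 cg).
rewrite unlock /Lnorm.
have -> : (\int[mu x]_h (`|((EFin \o cabs (g \_ (D x) : borel G -> R[i])) h)| `^ 2) = (N2 x g)%:E)%E.
  rewrite /N2 /rI /Rintegral fineK; last exact: integrable_fin_num.
  rewrite [RHS]integral_mkcond; apply: eq_integral => h _.
  rewrite /= /cabs !patchE; case: ifP => [_|_]; last by rewrite normr0 /= normr0 powR0.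
  by rewrite ger0_norm ?cmod_nneg// powR_mulrn ?cmod_nneg.
by rewrite poweR_EFin powR12_sqrt// N2_ge0.
Qed.

Lemma ccs_cL2 x g : gunits Gam x -> ccs (D x) g -> (g \_ (D x) : borel G -> R[i]) \in cL2 (mu x).
Proof.
move=> ux cg; apply/cL2P; split; first exact: ccs_cmeasurable.
by rewrite LnormE// ltry.
Qed.

Definition cls x (g : G -> R[i]) : L2 (mu x) := L2class (mu x) (g \_ (D x) : borel G -> R[i]).

Lemma cls_eq x (g k : G -> R[i]) : (forall h, D x h -> g h = k h) -> cls x g = cls x k.
Proof.
move=> gk; congr (L2class _ _); apply/funext => h; rewrite !patchE.
by case: ifP => // /set_mem/gk.
Qed.

End fiber_norm.

Section L2_quotient.
Context d (T : measurableType d) (R : realType) (mu : {measure set T -> \bar R}).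

Lemma L2_addE (f g : L2fun mu) : \pi_(L2 mu)%qT f + \pi_(L2 mu)%qT g = \pi_(L2 mu)%qT (f + g).
Proof.
apply/L2_eqP; apply: filterS2 (L2_reprP f) (L2_reprP g) => x.
by rewrite !raddfD /= !fctE => -> ->.
Qed.

Lemma L2_scaleE a (f : L2fun mu) : a *: \pi_(L2 mu)%qT f = \pi_(L2 mu)%qT (a *: f).
Proof.
apply/L2_eqP; apply: filterS (L2_reprP f) => x.
by rewrite !linearZ /= !fctE => ->.
Qed.

Lemma L2_nmE (f : L2fun mu) :
  nm (\pi_(L2 mu)%qT f : L2 mu) = fine ('N[mu]_2%:E[EFin \o cabs (val f)])%E.
Proof.
transitivity (fine ('N[mu]_2%:E[EFin \o cabs (val (repr (\pi_(L2 mu)%qT f)))])%E); first by [].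
congr fine; rewrite unlock /Lnorm; congr (_ `^ _)%E.
have mabs (g : L2fun mu) : measurable_fun setT (cabs (val g)).
  by apply: measurable_cabs; have /cL2P[] := valP g.
apply: ge0_ae_eq_integral => //.
- exact: measurable_abspow.
- exact: measurable_abspow.
- by move=> x _; exact: poweR_ge0.
- by move=> x _; exact: poweR_ge0.
- by apply: filterS (L2_reprP f) => x /= fx _; rewrite /cabs fx.
Qed.

End L2_quotient.

Section L2class_theory.
Context d (T : measurableType d) (R : realType) (mu : {measure set T -> \bar R}).
Implicit Types (f g : T -> R[i]).

Lemma val_insubd_cL2 f : f \in cL2 mu -> val (insubd (0 : L2fun mu) f) = f.
Proof. by move=> fL; rewrite insubdK. Qed.

Lemma L2class_val (F : L2fun mu) : L2class mu (val F) = \pi_(L2 mu)%qT F.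
Proof. by rewrite /L2class valKd. Qed.

Lemma L2classD f g : f \in cL2 mu -> g \in cL2 mu ->
  L2class mu (f + g) = L2class mu f + L2class mu g.
Proof.
move=> fL gL; rewrite L2_addE /L2class; congr (\pi_(L2 mu)%qT _).
by apply: val_inj; rewrite raddfD /= !val_insubd_cL2// rpredD.
Qed.

Lemma L2classZ (a : R[i]) f : f \in cL2 mu ->
  L2class mu (a *: f) = a *: L2class mu f.
Proof.
move=> fL; rewrite L2_scaleE /L2class; congr (\pi_(L2 mu)%qT _).
by apply: val_inj; rewrite linearZ /= !val_insubd_cL2// rpredZ.
Qed.

Lemma nm_L2class f : f \in cL2 mu ->
  nm (L2class mu f) = fine ('N[mu]_2%:E[EFin \o cabs f])%E.
Proof. by move=> fL; rewrite L2_nmE val_insubd_cL2. Qed.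

Lemma nm_L2class_sqr f : f \in cL2 mu ->
  ((nm (L2class mu f) ^+ 2)%:E = \int[mu]_x (cabs f x ^+ 2)%:E)%E.
Proof.
move=> fL; rewrite nm_L2class//; have /cL2P[mf Nf] := fL.
have N0 : (0 <= 'N[mu]_2%:E[EFin \o cabs f])%E by exact: Lnorm_ge0.
have n2 : (2 : R) != 0 by [].
have := powR_Lnorm mu (EFin \o cabs f) n2.
have /fineK {1}<- : ('N[mu]_2%:E[EFin \o cabs f])%E \is a fin_num by rewrite ge0_fin_numE.
rewrite poweR_EFin powR_mulrn ?fine_ge0// => ->.
apply: eq_integral => x _ /=.
by rewrite ger0_norm ?cabs_ge0// powR_mulrn// cabs_ge0.
Qed.

Lemma cL2_sqr_integral f : cmeasurable f -> (\int[mu]_x (cabs f x ^+ 2)%:E < +oo)%E ->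
  f \in cL2 mu.
Proof.
move=> mf If; apply/cL2P; split => //.
rewrite unlock /Lnorm; apply: poweR_lty.
rewrite (eq_integral (fun x => (cabs f x ^+ 2)%:E))// => x _ /=.
by rewrite ger0_norm ?cabs_ge0// powR_mulrn// cabs_ge0.
Qed.

End L2class_theory.

Section class_map.
Context (R : realType) (G : ptopologicalType) (Gam : groupoid G).
Hypothesis lcG : locally_compact_groupoid Gam.
Context (mu : G -> {measure set (borel G) -> \bar R}).
Hypothesis haar_mu : haar_system Gam mu.
Local Notation D := (gfiber Gam).
Local Notation inv := (ginv Gam).
Local Notation mul := (gmul Gam).
Local Notation conv := (convolution Gam mu).
Local Notation cls := (cls Gam mu).
Let clD x : closed (D x). Proof. exact: closed_gfiber. Qed.
Implicit Types (f g k : G -> R[i]).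

Lemma clsD x g k : gunits Gam x -> ccs (D x) g -> ccs (D x) k ->
  cls x (fun h => g h + k h) = cls x g + cls x k.
Proof.
move=> ux cg ck.
rewrite -(L2classD (ccs_cL2 lcG haar_mu ux cg) (ccs_cL2 lcG haar_mu ux ck)).
congr (L2class _ _); apply/funext => h; rewrite !fctE !patchE.
by case: ifP => // _; rewrite addr0.
Qed.

Lemma clsZ x (a : R[i]) g : gunits Gam x -> ccs (D x) g ->
  cls x (fun h => a * g h) = a *: cls x g.
Proof.
move=> ux cg; rewrite -(L2classZ a (ccs_cL2 lcG haar_mu ux cg)).
congr (L2class _ _); apply/funext => h; rewrite !fctE !patchE.
by case: ifP => // _; rewrite scaler0.
Qed.

Lemma clsN x g : gunits Gam x -> ccs (D x) g -> cls x (fun h => - g h) = - cls x g.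
Proof.
move=> ux cg; rewrite -scaleN1r -clsZ//; congr (L2class _ (_ \_ _)).
by apply/funext => h; rewrite mulN1r.
Qed.

Lemma clsB x g k : gunits Gam x -> ccs (D x) g -> ccs (D x) k ->
  cls x (fun h => g h - k h) = cls x g - cls x k.
Proof. by move=> ux cg ck; rewrite clsD ?clsN//; exact: ccsN. Qed.

Lemma nm_cls x g : gunits Gam x -> ccs (D x) g -> nm (cls x g) = Num.sqrt (N2 Gam mu x g).
Proof.
by move=> ux cg; rewrite nm_L2class ?(LnormE lcG haar_mu ux cg)//; exact: ccs_cL2.
Qed.

Lemma nm_cls_sqr x g : gunits Gam x -> ccs (D x) g -> nm (cls x g) ^+ 2 = N2 Gam mu x g.
Proof. by move=> ux cg; rewrite nm_cls// sqr_sqrtr// N2_ge0. Qed.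

(** [regular_rep] integrates an arbitrary representative of the class; it agrees with [g] almost
    everywhere on the fiber, so the integrals do not change. *)
Lemma regular_rep_cls x f g : gunits Gam x -> ccs setT f -> ccs (D x) g ->
  regular_rep Gam f (cls x g) = cls x (conv f g).
Proof.
move=> ux cf cg; congr (L2class _ _); apply/funext => h; rewrite !patchE.
case: ifP => // /set_mem Dh; rewrite (conv_fiberE _ _ _ Dh).
have mD : measurable (D x : set (borel G)) by exact: closed_borel.
have ck : cont_on (D x) (fun a => f (mul h (inv a))) by apply: cont_on_kernel_r => //; exact: cf.1.
pose F : L2fun (mu x) := insubd 0 (g \_ (D x) : borel G -> R[i]).
have FE : val F = g \_ (D x) by apply: val_insubd_cL2; exact: ccs_cL2.
have HF : \forall a \ae mu x, D x a -> val (repr (\pi_(L2 (mu x))%qT F)) a = g a.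
  apply: filterS (L2_reprP F) => a -> Da; rewrite FE patchE mem_set//.
have [mF1 mF2] : cmeasurable (val (repr (cls x g))) by have /cL2P[] := valP (repr (cls x g)).
have mkr := cont_on_measurable (@clD x) (cont_onC_Re ck).
have mki := cont_on_measurable (@clD x) (cont_onC_Im ck).
have mgr := cont_on_measurable (@clD x) (cont_onC_Re cg.1).
have mgi := cont_on_measurable (@clD x) (cont_onC_Im cg.1).
have mF1' : measurable_fun (D x : set (borel G)) (fun a => complex.Re (val (repr (cls x g)) a)).
  exact: measurable_funTS.
have mF2' : measurable_fun (D x : set (borel G)) (fun a => complex.Im (val (repr (cls x g)) a)).
  exact: measurable_funTS.
apply: complexP.
  rewrite /cintegral /=; congr fine; apply: ae_eq_integral => //.
  - apply/measurable_EFinP.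
    under eq_fun do rewrite ReM.
    by apply: measurable_funB; apply: measurable_funM.
  - apply/measurable_EFinP.
    under eq_fun do rewrite ReM.
    by apply: measurable_funB; apply: measurable_funM.
  - by apply: (@filterS _ _ (ae_filter_ringOfSetsType (mu x)) _ _ _ HF) => a Ha Da /=; rewrite Ha.
rewrite /cintegral /=; congr fine; apply: ae_eq_integral => //.
- apply/measurable_EFinP.
  under eq_fun do rewrite ImM.
  by apply: measurable_funD; apply: measurable_funM.
- apply/measurable_EFinP.
  under eq_fun do rewrite ImM.
  by apply: measurable_funD; apply: measurable_funM.
- by apply: (@filterS _ _ (ae_filter_ringOfSetsType (mu x)) _ _ _ HF) => a Ha Da /=; rewrite Ha.
Qed.

End class_map.

Section real_L2_class.
Context d (T : measurableType d) (R : realType) (mu : {measure set T -> \bar R}).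
Implicit Types (u v : T -> R).

Definition cfun u : T -> R[i] := fun x => (u x)%:C%C.

Lemma cabs_cfun u x : cabs (cfun u) x ^+ 2 = u x ^+ 2.
Proof. by rewrite [cabs _ _]cmod_real real_normK ?num_real. Qed.

Lemma cfun_cL2 u : measurable_fun setT u -> (\int[mu]_x (u x ^+ 2)%:E < +oo)%E ->
  cfun u \in cL2 mu.
Proof.
move=> mf If; apply: cL2_sqr_integral.
  by split; [exact: mf|exact: measurable_cst].
by rewrite (eq_integral (fun x => (u x ^+ 2)%:E))// => x _; rewrite cabs_cfun.
Qed.

Lemma nm_cfun_sqr u : measurable_fun setT u -> (\int[mu]_x (u x ^+ 2)%:E < +oo)%E ->
  ((nm (L2class mu (cfun u)) ^+ 2)%:E = \int[mu]_x (u x ^+ 2)%:E)%E.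
Proof.
move=> mf If; rewrite nm_L2class_sqr; last exact: cfun_cL2.
by apply: eq_integral => x _; rewrite cabs_cfun.
Qed.

Lemma sqr_integral_indic (A : set T) : measurable A ->
  (\int[mu]_x (\1_A x ^+ 2)%:E = mu A :> \bar R)%E.
Proof.
move=> mA; transitivity (\int[mu]_x (\1_A x)%:E)%E; last by rewrite integral_indic// setIT.
apply: eq_integral => x _; rewrite indicE.
by case: (x \in A); rewrite /= ?expr1n ?expr0n.
Qed.

End real_L2_class.

(** * Density of compactly supported continuous functions in the L^2 space of a fiber *)

Section density.
Import HBNNSimple.
Context (R : realType) (G : ptopologicalType) (Gam : groupoid G).
Hypothesis lcG : locally_compact_groupoid Gam.
Context (mu : G -> {measure set (borel G) -> \bar R}).
Hypothesis haar_mu : haar_system Gam mu.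
Local Notation D := (gfiber Gam).
Local Notation cls := (cls Gam mu).
Let hG := lcg_hausdorff lcG.
Let lG := lcg_locally_compact lcG.
Let clD x : closed (D x). Proof. exact: closed_gfiber. Qed.
Context (x : G) (ux : gunits Gam x).

Definition Cc_limit (v : L2 (mu x)) :=
  forall e : R, 0 < e -> exists2 g, ccs setT g & nm (v - cls x g) < e.

Let ccsT_D (g : G -> R[i]) : ccs setT g -> ccs (D x) g.
Proof. exact: ccs_sub. Qed.

Lemma Cc_limitD v w : Cc_limit v -> Cc_limit w -> Cc_limit (v + w).
Proof.
move=> Hv Hw e e0; have e2 : 0 < e / 2 by rewrite divr_gt0.
have [g cg vg] := Hv _ e2; have [k ck wk] := Hw _ e2.
exists (fun h => g h + k h); first exact: ccsD.
rewrite (clsD lcG haar_mu ux (ccsT_D cg) (ccsT_D ck)) opprD addrACA (splitr e).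
by apply: le_lt_trans (nmD _ _) _; exact: ltrD.
Qed.

Lemma Cc_limitZ (c : R[i]) v : Cc_limit v -> Cc_limit (c *: v).
Proof.
move=> Hv e e0; have c0 := cmod_nneg c.
have e2 : 0 < e / (cmod c + 1) by rewrite divr_gt0// ltr_wpDl.
have [g cg vg] := Hv _ e2.
exists (fun h => c * g h); first exact: ccsZ.
rewrite (clsZ lcG haar_mu c ux (ccsT_D cg)) -scalerBr nmZ.
apply: le_lt_trans (_ : cmod c * (e / (cmod c + 1)) < e).
  by apply: ler_wpM2l => //; exact: ltW.
by rewrite mulrCA gtr_pMr// ltr_pdivrMr ?ltr_wpDl// mul1r ltrDl.
Qed.

Lemma Cc_limit_closed v : (forall e : R, 0 < e -> exists2 w, Cc_limit w & nm (v - w) < e) ->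
  Cc_limit v.
Proof.
move=> Hv e e0; have e2 : 0 < e / 2 by rewrite divr_gt0.
have [w Hw vw] := Hv _ e2; have [g cg wg] := Hw _ e2.
exists g => //; rewrite -(subrKA w) (splitr e).
by apply: le_lt_trans (nmD _ _) _; exact: ltrD.
Qed.

(** Regularity gives an open [U] around [A] and a compact [K] in [U], each of [A] and [K] within [d]
    of [U] in measure; [K] need not lie in [A]. A cutoff that is 1 on [K] and 0 off [U] differs from
    the indicator of [A] only on the two differences and, since [cls] cuts it to the fiber, on the
    null complement of the fiber. The squared error is at most $2d<e^2$. *)
Lemma Cc_limit_indic (A : set (borel G)) : measurable A -> (mu x A < +oo)%E ->
  Cc_limit (L2class (mu x) (cfun \1_A)).
Proof.
move=> mA fA e e0.
have mD : measurable (D x : set (borel G)) by exact: closed_borel.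
have rad := haar_radon haar_mu ux.
have fm := haar_fin haar_mu ux.
have d0 : 0 < e ^+ 2 / 3 by rewrite divr_gt0// exprn_gt0.
set d := e ^+ 2 / 3 in d0.
have fA' : mu x A \is a fin_num by rewrite ge0_fin_numE.
have [U [oU AU] muU] : exists2 U : set G, open U /\ A `<=` U & (mu x U < mu x A + d%:E)%E.
  have : (ereal_inf [set mu x U | U in [set U : set G | open U /\ A `<=` U]] < mu x A + d%:E)%E.
    by rewrite -(radon_outer rad mA) lteDl.
  by move=> /ereal_inf_lt[_ [U [oU AU] <-] HU]; exists U.
have mU : measurable (U : set (borel G)) by exact: open_borel.
have fU : mu x U \is a fin_num.
  by rewrite ge0_fin_numE//; apply: lt_trans muU _; rewrite -(fineK fA') -EFinD ltry.
have [K [cK KU] muK] : exists2 K : set G, compact K /\ K `<=` U & (mu x U - d%:E < mu x K)%E.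
  have : (mu x U - d%:E < ereal_sup [set mu x K | K in [set K : set G | compact K /\ K `<=` U]])%E.
    by rewrite -(radon_inner rad oU) lteBlDr// lteDl.
  by move=> /ereal_sup_gt[_ [K [cK KU] <-] HK]; exists K.
have mK : measurable (K : set (borel G)) by exact: (closed_borel (compact_closed hG cK)).
have [chi [cchi chi01 chi1 chiU]] := exists_cutoff_in R lG hG cK oU KU.
exists (fun h => (chi h)%:C%C); first exact: ccs_real.
pose u : borel G -> R := \1_A \- (chi \_ (D x)).
have mchi : measurable_fun setT (chi \_ (D x) : borel G -> R).
  apply: (measurable_restrictT _ mD).1.
  by apply: (cont_on_measurable (@clD x)); exact: cont_on_sub cchi.1.
have mu' : measurable_fun setT u by apply: measurable_funB => //; exact: measurable_indic.
have Iu : (\int[mu x]_h (u h ^+ 2)%:E <= (d + d)%:E)%E.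
  apply: (@le_trans _ _ (\int[mu x]_h ((\1_(U `\` A) h)%:E + ((\1_(U `\` K) h)%:E + (\1_(~` D x) h)%:E)))%E).
    apply: ge0_le_integral => //.
    - by move=> h _; rewrite lee_fin sqr_ge0.
    - by apply/measurable_EFinP; exact: measurable_funX.
    - apply: emeasurable_funD; [|apply: emeasurable_funD]; apply/measurable_EFinP;
        apply: measurable_indic; [exact: measurableD|exact: measurableD|exact: measurableC].
    move=> h _; rewrite -!EFinD lee_fin /u /= !patchE !indicE.
    have b0 (B : set (borel G)) : 0 <= ((h \in B)%:R : R) by [].
    have c01 := chi01 h.
    have [Dh|nD] := boolP (h \in D x); last first.
      have -> : (h \in ~` D x)%:R = 1 :> R by rewrite in_setC nD.
      by case: (h \in A); rewrite ?subr0 ?expr1n ?expr0n /=; have := b0 (U `\` A); have := b0 (U `\` K); lra.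
    have [Ah|nA] := boolP (h \in A).
      have [Kh|nK] := boolP (h \in K).
        rewrite chi1; last by rewrite inE in Kh.
        by rewrite subrr expr0n /= !addr_ge0.
      have -> : (h \in U `\` K)%:R = 1 :> R.
        by rewrite in_setD nK andbT mem_set//; apply: AU; rewrite inE in Ah.
      have : (1 - chi h) ^+ 2 <= 1 by rewrite expr_le1//; lra.
      by have := b0 (U `\` A); have := b0 (~` D x); rewrite /=; lra.
    have [->|/chiU Uh] := eqVneq (chi h) 0.
      by rewrite subrr expr0n /= !addr_ge0.
    have -> : (h \in U `\` A)%:R = 1 :> R by rewrite in_setD nA andbT mem_set.
    have : (0 - chi h) ^+ 2 <= 1 by rewrite sub0r sqrrN expr_le1//; lra.
    by have := b0 (U `\` K); have := b0 (~` D x); rewrite /=; lra.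
  have mI (B : set (borel G)) : measurable B -> measurable_fun setT (fun h => (\1_B h)%:E : \bar R).
    by move=> mB; apply/measurable_EFinP; exact: measurable_indic.
  have mUA : measurable (U `\` A : set (borel G)) by exact: measurableD.
  have mUK : measurable (U `\` K : set (borel G)) by exact: measurableD.
  have mDc : measurable (~` D x : set (borel G)) by exact: measurableC.
  rewrite ge0_integralD//; [|exact: mI|
    by move=> h _; rewrite -EFinD lee_fin addr_ge0|by apply: emeasurable_funD; exact: mI].
  rewrite ge0_integralD//; [|exact: mI|exact: mI].
  rewrite !integral_indic// !setIT (cf_null (haar_family lcG haar_mu) ux) adde0 EFinD.
  apply: leeD.
    rewrite measureD//; last by rewrite ltey_eq fU.
    by rewrite setIidr// leeBlDl// ltW.
  rewrite measureD//; last by rewrite ltey_eq fU.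
  rewrite setIidr// leeBlDl; last by rewrite ge0_fin_numE// fm.
  by rewrite addeC -leeBlDl// ?ltW//; exact: muK.
have fu : (\int[mu x]_h (u h ^+ 2)%:E < +oo)%E by apply: le_lt_trans Iu _; rewrite ltry.
have -> : L2class (mu x) (cfun \1_A) - cls x (fun h => (chi h)%:C%C) = L2class (mu x) (cfun u).
  have c1 : ccs (D x) (fun h => (chi h)%:C%C) by apply: ccsT_D; exact: ccs_real.
  have cA : cfun \1_A \in cL2 (mu x).
    by apply: cfun_cL2; [exact: measurable_indic|rewrite sqr_integral_indic].
  apply/eqP; rewrite subr_eq; apply/eqP.
  rewrite -(L2classD (cfun_cL2 mu' fu) (ccs_cL2 lcG haar_mu ux c1)); congr (L2class _ _).
  apply/funext => h; rewrite !fctE /cfun /u /= !patchE; case: ifP => _.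
    by rewrite rmorphB /= subrK.
  by rewrite subr0 addr0.
rewrite -ltr_sqr ?nnegrE ?nm_ge0 ?ltW// -lte_fin nm_cfun_sqr//.
apply: le_lt_trans Iu _; rewrite lte_fin /d.
have : 0 < e ^+ 2 by exact: exprn_gt0.
by lra.
Qed.

(** The level set of the value 0 may have infinite measure, so finiteness is required only where the
    coefficient is nonzero. *)
Lemma Cc_limit_simple n (c : nat -> R) (A : nat -> set (borel G)) :
  (forall i, (i < n)%N -> measurable (A i) /\ (c i != 0 -> (mu x (A i) < +oo)%E)) ->
  (cfun (fun h => \sum_(i < n) c i * \1_(A i) h) : borel G -> R[i]) \in cL2 (mu x) /\
  Cc_limit (L2class (mu x) (cfun (fun h => \sum_(i < n) c i * \1_(A i) h))).
Proof.
elim: n => [_|n IH HA].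
  have -> : cfun (fun h => \sum_(i < 0) c i * \1_(A i) h) = (0%:C%C : R[i]) *: cfun \1_(set0 : set (borel G)).
    by apply/funext => h; rewrite !fctE /cfun big_ord0 scale0r.
  have c0 : cfun (\1_(set0 : set (borel G)) : _ -> R) \in cL2 (mu x).
    by apply: cfun_cL2; [exact: measurable_indic|rewrite sqr_integral_indic// measure0].
  split; first exact: rpredZ.
  by rewrite L2classZ//; apply: Cc_limitZ; apply: Cc_limit_indic => //; rewrite measure0.
have [|cn Ln] := IH; first by move=> i ni; apply: HA; exact: ltnW.
have [mA fA] := HA n (ltnSn n).
have [cn0|cn0] := eqVneq (c n) 0.
  have -> // : cfun (fun h => \sum_(i < n.+1) c i * \1_(A i) h) =
    cfun (fun h => \sum_(i < n) c i * \1_(A i) h).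
  by apply/funext => h; rewrite /cfun big_ord_recr /= cn0 mul0r addr0.
have {}fA := fA cn0.
have cA : cfun (\1_(A n) : _ -> R) \in cL2 (mu x).
  by apply: cfun_cL2; [exact: measurable_indic|rewrite sqr_integral_indic].
have -> : cfun (fun h => \sum_(i < n.+1) c i * \1_(A i) h) =
    cfun (fun h => \sum_(i < n) c i * \1_(A i) h) + (c n)%:C%C *: cfun \1_(A n).
  apply/funext => h; rewrite !fctE /cfun big_ord_recr /= rmorphD rmorphM /=.
  by congr (_ + _).
have cZ := rpredZ (c n)%:C%C cA.
split; first exact: rpredD.
rewrite L2classD// L2classZ//; apply: Cc_limitD => //; apply: Cc_limitZ.
exact: Cc_limit_indic.
Qed.

(** Simple functions increasing to [u] converge to it in $L^2$ by dominated convergence, with $u^2$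
    as the bound. *)
Lemma Cc_limit_nneg (u : borel G -> R) : measurable_fun setT u -> (forall h, 0 <= u h) ->
  (\int[mu x]_h (u h ^+ 2)%:E < +oo)%E -> Cc_limit (L2class (mu x) (cfun u)).
Proof.
move=> mu' u0 fu; apply: Cc_limit_closed => e e0.
have mE : measurable_fun setT (EFin \o u) by exact/measurable_EFinP.
pose un n := nnsfun_approx measurableT mE n.
have un_le n h : un n h <= u h.
  rewrite -lee_fin /un nnsfun_approxE; apply: (@le_approx _ _ _ setT (EFin \o u)) => // y _.
  by rewrite lee_fin.
have un0 n h : 0 <= un n h by [].
have cvg_un h : (fun n => un n h) @ \oo --> u h.
  have /fine_cvgP[_] := @cvg_nnsfun_approx _ _ _ setT measurableT _ mE (fun h _ => u0 h) h Logic.I.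
  by [].
have mun n : measurable_fun setT (un n) by exact: measurable_funP.
have mu2 : measurable_fun setT (fun h => (u h ^+ 2)%:E).
  by apply/measurable_EFinP; exact: measurable_funX.
have iu : (mu x).-integrable setT (fun h => (u h ^+ 2)%:E).
  apply/integrableP; split => //.
  rewrite (eq_integral (fun h => (u h ^+ 2)%:E))// => h _.
  by rewrite gee0_abs// lee_fin sqr_ge0.
have [] // := @dominated_convergence _ _ R (mu x) setT measurableT
    (fun n h => ((u h - un n h) ^+ 2)%:E) (fun=> 0%E) (fun h => (u h ^+ 2)%:E).
- move=> n; apply/measurable_EFinP; apply: measurable_funX; exact: measurable_funB.
- apply: aeW => h _; apply/fine_cvgP; split; first by apply: nearW.
  rewrite -[X in _ --> X](_ : (u h - u h) ^+ 2 = 0); last by rewrite subrr expr0n.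
  by apply: cvgM; apply: cvgB => //; exact: cvg_cst.
- apply: aeW => h n _; rewrite gee0_abs ?lee_fin ?sqr_ge0//.
  by rewrite ler_sqr ?nnegrE ?subr_ge0// gerBl.
move=> _ _ cv.
have e2 : 0 < e ^+ 2 by exact: exprn_gt0.
have : \forall n \near \oo, (\int[mu x]_h ((u h - un n h) ^+ 2)%:E < (e ^+ 2)%:E)%E.
  move: cv; rewrite integral0 => /fine_cvgP[fin /cvgrPdist_lt/(_ _ e2) H].
  near=> n; have /fineK <- : (\int[mu x]_h ((u h - un n h) ^+ 2)%:E)%E \is a fin_num by near: n.
  rewrite lte_fin; apply: le_lt_trans (ler_norm _) _.
  by rewrite -normrN -[X in `|X|]add0r; near: n.
move=> [n0 _ /(_ n0 (leqnn _)) /= Hn].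
have mun0 := mun n0.
have [cs Ls] : cfun (un n0) \in cL2 (mu x) /\ Cc_limit (L2class (mu x) (cfun (un n0))).
  pose s := fset_set (range (un n0)).
  have -> : cfun (un n0) = cfun (fun h => \sum_(i < #|`s|) s`_i * \1_(un n0 @^-1` [set s`_i]) h).
    by apply/funext => h; rewrite /cfun fimfunEord.
  apply: (@Cc_limit_simple _ (fun i => s`_i) (fun i => un n0 @^-1` [set s`_i])) => i ni.
  have mA : measurable (un n0 @^-1` [set s`_i]) by exact: measurable_funPTI.
  split=> // s0; set y := s`_i in s0 mA *.
  have y2 : 0 < y ^+ 2 by rewrite exprn_even_gt0.
  (* Chebyshev: [u >= y] on this level set, so $y^2$ times its measure is at most $\int u^2$. *)
  have : ((y ^+ 2)%:E * mu x (un n0 @^-1` [set y]) < +oo)%E.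
    apply: le_lt_trans fu; rewrite -[X in (_ * mu x X)%E]setIT -integral_indic//.
    rewrite -ge0_integralZl_EFin ?sqr_ge0//; last by apply/measurable_EFinP; exact: measurable_indic.
    apply: ge0_le_integral => //.
    - by move=> h _; rewrite mule_ge0// lee_fin ?sqr_ge0.
    - by apply: measurable_funeM; apply/measurable_EFinP; exact: measurable_indic.
    move=> h _; rewrite -EFinM lee_fin indicE.
    have [/set_mem /= uy|_] := boolP (h \in _); last by rewrite mulr0 sqr_ge0.
    by rewrite mulr1 -uy ler_sqr ?nnegrE.
  have := measure_ge0 (mu x) (un n0 @^-1` [set y]).
  by case: (mu x _) => // [r _ _|_]; [rewrite ltry|rewrite gt0_muley ?lte_fin].
exists (L2class (mu x) (cfun (un n0))) => //.
have mB : measurable_fun setT (u \- un n0) by exact: measurable_funB.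
have fB : (\int[mu x]_h ((u \- un n0) h ^+ 2)%:E < +oo)%E by apply: lt_trans Hn _; rewrite ltry.
have -> : L2class (mu x) (cfun u) - L2class (mu x) (cfun (un n0)) = L2class (mu x) (cfun (u \- un n0)).
  apply/eqP; rewrite subr_eq; apply/eqP; rewrite -L2classD//; last exact: cfun_cL2.
  by congr (L2class _ _); apply/funext => h; rewrite !fctE /cfun /= rmorphB /= subrK.
by rewrite -ltr_sqr ?nnegrE ?nm_ge0 ?ltW// -lte_fin nm_cfun_sqr.
Unshelve. all: by end_near. Qed.

Lemma Cc_limit_real (u : borel G -> R) : measurable_fun setT u ->
  (\int[mu x]_h (u h ^+ 2)%:E < +oo)%E -> Cc_limit (L2class (mu x) (cfun u)).
Proof.
move=> mu' fu.
have H (v : borel G -> R) : measurable_fun setT v -> (forall h, 0 <= v h) -> (forall h, v h <= `|u h|) ->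
    cfun v \in cL2 (mu x) /\ Cc_limit (L2class (mu x) (cfun v)).
  move=> mv v0 vu.
  have fv : (\int[mu x]_h (v h ^+ 2)%:E < +oo)%E.
    apply: le_lt_trans fu; apply: ge0_le_integral => //.
    - by move=> h _; rewrite lee_fin sqr_ge0.
    - by apply/measurable_EFinP; exact: measurable_funX.
    - by apply/measurable_EFinP; exact: measurable_funX.
    move=> h _; rewrite lee_fin -[leRHS]real_normK ?num_real//.
    by rewrite ler_sqr ?nnegrE.
  by split; [exact: cfun_cL2|exact: Cc_limit_nneg].
have mp : measurable_fun setT (fun h => Num.max (u h) 0) by exact: measurable_maxr.
have mn : measurable_fun setT (fun h => Num.max (- u h) 0).
  by apply: measurable_maxr => //; exact: measurableT_comp.
have [||c1 L1] := H _ mp.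
- by move=> h; rewrite le_max lexx orbT.
- by move=> h; rewrite ge_max ler_norm/=.
have [||c2 L2] := H _ mn.
- by move=> h; rewrite le_max lexx orbT.
- by move=> h; rewrite ge_max -normrN ler_norm/=.
have -> : cfun u = cfun (fun h => Num.max (u h) 0) + (-1) *: cfun (fun h => Num.max (- u h) 0).
  apply/funext => h; rewrite !fctE /cfun scaleN1r -rmorphB /=; congr (_%:C)%C.
  have [u0|u0] := lerP 0 (u h).
    by rewrite (max_r (_ : - u h <= 0)) ?subr0// oppr_le0.
  by rewrite (max_l (_ : 0 <= - u h)) ?sub0r ?opprK// oppr_ge0 ltW.
by rewrite L2classD ?L2classZ ?rpredZ//; apply: Cc_limitD => //; exact: Cc_limitZ.
Qed.

Theorem Cc_dense (v : L2 (mu x)) : Cc_limit v.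
Proof.
have /cL2P[mF NF] := valP (repr v); set F := val (repr v) in mF NF.
have FL : F \in cL2 (mu x) by exact: valP.
have Fsq : (\int[mu x]_h (cabs F h ^+ 2)%:E < +oo)%E by rewrite -nm_L2class_sqr// ltry.
have mc := measurable_cabs mF.
have I (u : borel G -> R) : measurable_fun setT u -> (forall h, `|u h| <= cabs F h) ->
    cfun u \in cL2 (mu x) /\ Cc_limit (L2class (mu x) (cfun u)).
  move=> mv vu.
  have fv : (\int[mu x]_h (u h ^+ 2)%:E < +oo)%E.
    apply: le_lt_trans Fsq; apply: ge0_le_integral => //.
    - by move=> h _; rewrite lee_fin sqr_ge0.
    - by apply/measurable_EFinP; exact: measurable_funX.
    - by apply/measurable_EFinP; exact: measurable_funX.
    move=> h _; rewrite lee_fin -[leLHS]real_normK ?num_real//.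
    by rewrite ler_sqr ?nnegrE ?cabs_ge0.
  by split; [exact: cfun_cL2|exact: Cc_limit_real].
have [c1 L1] := I (fun h => complex.Re (F h)) mF.1 (fun h => Re_norm_le (F h)).
have [c2 L2] := I (fun h => complex.Im (F h)) mF.2 (fun h => Im_norm_le (F h)).
have -> : v = L2class (mu x) F by rewrite L2class_val reprK.
have -> : F = cfun (fun h => complex.Re (F h)) + 'i%C *: cfun (fun h => complex.Im (F h)).
  by apply/funext => h; rewrite !fctE /cfun {1}(complexE (F h)).
by rewrite L2classD ?L2classZ ?rpredZ//; apply: Cc_limitD => //; exact: Cc_limitZ.
Qed.

End density.

Lemma le_all_small (R : realType) (a C : R) : (forall e : R, 0 < e -> a <= C * e) -> a <= 0.
Proof.
move=> H; apply/ler_addgt0Pr => e e0; rewrite add0r.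
have C1 : 0 < `|C| + 1 by rewrite ltr_wpDl.
apply: le_trans (H (e / (`|C| + 1)) _) _; first by rewrite divr_gt0.
rewrite mulrA ler_pdivrMr// mulrC; apply: ler_wpM2l; first exact: ltW.
by apply: le_trans (ler_norm _) _; rewrite lerDl.
Qed.

Section linear_maps.
Context (R : realType) (U V : lmodType R[i]) (T : U -> V).
Hypothesis linT : linear T.

Lemma lin_add u v : T (u + v) = T u + T v.
Proof. by have := linT 1 u v; rewrite !scale1r. Qed.

Lemma lin_zero : T 0 = 0.
Proof. by apply: (@addrI _ (T 0)); rewrite -lin_add !addr0. Qed.

Lemma lin_scale (a : R[i]) u : T (a *: u) = a *: T u.
Proof. by have := linT a u 0; rewrite !addr0 lin_zero addr0. Qed.

Lemma lin_opp u : T (- u) = - T u.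
Proof. by rewrite -scaleN1r lin_scale scaleN1r. Qed.

Lemma lin_sub u v : T (u - v) = T u - T v.
Proof. by rewrite lin_add lin_opp. Qed.

End linear_maps.

(** * Regular representations of the reduced algebra *)

Section reduced_algebra.
Context (R : realType) (G : ptopologicalType) (Gam : groupoid G).
Hypothesis lcG : locally_compact_groupoid Gam.
Context (mu : G -> {measure set (borel G) -> \bar R}).
Hypothesis haar_mu : haar_system Gam mu.
Context (A : reduced_cstar Gam mu).
Local Notation D := (gfiber Gam).
Local Notation conv := (convolution Gam mu).
Local Notation cls := (cls Gam mu).
Local Notation lam := (rcs_lambda A).
Local Notation emb := (rcs_emb A).
Let hG := lcg_hausdorff lcG.
Implicit Types (a b : A) (f g : G -> R[i]).

Lemma lam_nm x a xi : gunits Gam x -> nm (lam x a xi) <= nm a * nm xi.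
Proof. by move=> ux; rewrite -lecR rmorphM /= -!nmE; exact: rcs_lambda_norm. Qed.

Lemma lam_lin x a : gunits Gam x -> linear (lam x a).
Proof. by move=> ux; exact: (rcs_lambda_bounded a ux).1. Qed.

Lemma lam_linl x xi : gunits Gam x -> linear (fun a => lam x a xi).
Proof. by move=> ux; exact: rcs_lambda_linear. Qed.

Lemma lam_cls x f g : gunits Gam x -> ccs setT f -> ccs (D x) g ->
  lam x (emb f) (cls x g) = cls x (conv f g).
Proof.
by move=> ux cf cg; rewrite rcs_lambda_emb// ?regular_rep_cls//; exact: ccs_Cc.
Qed.

Lemma emb_dense a (e : R) : 0 < e -> exists2 f, ccs setT f & nm (a - emb f) < e.
Proof.
move=> e0; have e0' : (0 : R[i]) < e%:C%C by rewrite ltcR.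
have [||b [/= ab [f cf fb]]] := @rcs_emb_dense _ _ _ _ A (ball a e%:C%C).
- by exists a; exact: ballxx.
- exact: ball_open.
exists f; first exact: Cc_ccs.
by move: ab; rewrite -ball_normE /= -fb nmE ltcR.
Qed.

Lemma bsa_mulBl a b c : bsa_mul (a - b) c = bsa_mul a c - bsa_mul b c.
Proof. exact: (lin_sub (@bsa_mul_linearl _ A c)). Qed.

Lemma bsa_mulBr a b c : bsa_mul a (b - c) = bsa_mul a b - bsa_mul a c.
Proof. exact: (lin_sub (@bsa_mul_linearr _ A a)). Qed.

Lemma bsa_nmM a b : nm (bsa_mul a b) <= nm a * nm b.
Proof. by rewrite -lecR rmorphM /= -!nmE; exact: bsa_normM. Qed.

Lemma cls_dense x (v : L2 (mu x)) (e : R) : gunits Gam x -> 0 < e ->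
  exists2 g, ccs (D x) g & nm (v - cls x g) < e.
Proof.
move=> ux e0; have [g cg vg] := Cc_dense lcG haar_mu ux v e0.
by exists g => //; exact: ccs_sub cg.
Qed.

(** On [Cc] this is associativity of convolution. The defect [Delta] is bounded in each of its three
    arguments, so density extends it first in the vector, then in [b], then in [a]. *)
Lemma lam_mul x a b xi : gunits Gam x ->
  lam x (bsa_mul a b) xi = lam x a (lam x b xi).
Proof.
move=> ux.
have lin := lam_lin _ ux; have linl := @lam_linl x _ ux.
pose Delta a b xi := lam x (bsa_mul a b) xi - lam x a (lam x b xi).
have bound a' b' xi' : nm (Delta a' b' xi') <= 2 * nm a' * nm b' * nm xi'.
  apply: le_trans (nmB _ _) _.
  have H1 : nm (lam x (bsa_mul a' b') xi') <= nm a' * nm b' * nm xi'.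
    apply: le_trans (lam_nm _ _ ux) _; apply: ler_wpM2r; [exact: nm_ge0|exact: bsa_nmM].
  have H2 : nm (lam x a' (lam x b' xi')) <= nm a' * nm b' * nm xi'.
    apply: le_trans (lam_nm _ _ ux) _; rewrite -mulrA; apply: ler_wpM2l; [exact: nm_ge0|exact: lam_nm].
  have -> : 2 * nm a' * nm b' * nm xi' = nm a' * nm b' * nm xi' + nm a' * nm b' * nm xi' by ring.
  exact: lerD H1 H2.
suff H : Delta a b xi = 0 by apply/eqP; rewrite -subr_eq0; apply/eqP.
have zero (v : L2 (mu x)) C : (forall e : R, 0 < e -> nm v <= C * e) -> v = 0.
  move=> H; apply: nm_eq0; apply/eqP; rewrite eq_le nm_ge0 andbT.
  exact: le_all_small H.
have S1 f1 f2 g : ccs setT f1 -> ccs setT f2 -> ccs (D x) g -> Delta (emb f1) (emb f2) (cls x g) = 0.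
  move=> c1 c2 cg; rewrite /Delta -rcs_embM; [|exact: ccs_Cc..].
  rewrite !lam_cls//; [|exact: ccs_conv|exact: ccs_convT].
  apply/eqP; rewrite subr_eq0; apply/eqP; apply: cls_eq => h Dh.
  by rewrite (convA lcG haar_mu ux c1 c2 cg Dh).
have S2 f1 f2 v : ccs setT f1 -> ccs setT f2 -> Delta (emb f1) (emb f2) v = 0.
  move=> c1 c2; apply: (zero _ (2 * nm (emb f1) * nm (emb f2))) => e e0.
  have [g cg vg] := cls_dense v ux e0.
  have -> : Delta (emb f1) (emb f2) v = Delta (emb f1) (emb f2) (v - cls x g).
    rewrite -[LHS]subr0 -(S1 f1 f2 g)// /Delta !(lin_sub (lin _)).
    by rewrite !opprD !opprK addrACA.
  apply: le_trans (bound _ _ _) _; apply: ler_wpM2l (ltW vg).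
  by rewrite !mulr_ge0// nm_ge0.
have S3 f1 b' v : ccs setT f1 -> Delta (emb f1) b' v = 0.
  move=> c1; apply: (zero _ (2 * nm (emb f1) * nm v)) => e e0.
  have [f2 c2 bf] := emb_dense b' e0.
  have -> : Delta (emb f1) b' v = Delta (emb f1) (b' - emb f2) v.
    rewrite -[LHS]subr0 -(S2 f1 f2 v)// /Delta bsa_mulBr.
    rewrite (lin_sub (linl v)) (lin_sub (linl v) b') (lin_sub (lin _)).
    by rewrite !opprD !opprK addrACA.
  apply: le_trans (bound _ _ _) _; rewrite -mulrA [nm (b' - _) * _]mulrC mulrA.
  apply: ler_wpM2l (ltW bf).
  by rewrite !mulr_ge0// nm_ge0.
apply: (zero _ (2 * nm b * nm xi)) => e e0.
have [f1 c1 bf] := emb_dense a e0.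
have -> : Delta a b xi = Delta (a - emb f1) b xi.
  rewrite -[LHS]subr0 -(S3 f1 b xi)// /Delta bsa_mulBl.
  rewrite (lin_sub (linl _)) (lin_sub (linl _) a).
  by rewrite !opprD !opprK addrACA.
apply: le_trans (bound _ _ _) _.
have -> : 2 * nm (a - emb f1) * nm b * nm xi = 2 * nm b * nm xi * nm (a - emb f1) by ring.
apply: ler_wpM2l (ltW bf).
by rewrite !mulr_ge0// nm_ge0.
Qed.

(** On the image of [Cc] the norm is by definition the supremum over the representations. The
    approximation error e/2 enters twice: in the operator bound for [emb f] and in the distance from
    [emb f] to [b]. *)
Lemma nm_le_lam b (B : R) : 0 <= B ->
  (forall x xi, gunits Gam x -> nm (lam x b xi) <= B * nm xi) -> nm b <= B.
Proof.
move=> B0 H; apply/ler_addgt0Pr => e e0.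
have e2 : 0 < e / 2 by rewrite divr_gt0.
have [f cf bf] := emb_dense b e2.
have Hf : nm (emb f) <= B + e / 2.
  rewrite -lee_fin; have := rcs_emb_norm A (ccs_Cc hG cf); rewrite /nm => ->.
  apply: ge_ereal_sup => _ [x ux <-]; apply: ge_ereal_sup => _ [v /= v1 <-].
  rewrite lee_fin -(rcs_lambda_emb A ux (ccs_Cc hG cf)).
  suff : nm (lam x (emb f) v) <= B + e / 2 by [].
  have {}v1 : nm v <= 1 by rewrite -nm_le; move: v1; rewrite [(1 : R)%:C%C](_ : _ = 1).
  have -> : emb f = b - (b - emb f) by rewrite opprB addrC subrK.
  rewrite (lin_sub (@lam_linl x v ux)); apply: le_trans (nmB _ _) _.
  apply: lerD.
    by apply: le_trans (H x v ux) _; rewrite ler_piMr.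
  apply: le_trans (lam_nm _ _ ux) _; apply: (le_trans (ler_wpM2l (nm_ge0 (b - emb f)) v1)).
  by rewrite mulr1 ltW.
have -> : b = (b - emb f) + emb f by rewrite subrK.
apply: le_trans (nmD _ _) _.
have -> : B + e = e / 2 + (B + e / 2) by lra.
by apply: lerD => //; exact: ltW.
Qed.

Lemma lam_eq0 b : (forall x xi, gunits Gam x -> lam x b xi = 0) -> b = 0.
Proof.
move=> H; apply: nm_eq0; apply/eqP; rewrite eq_le nm_ge0 andbT.
by apply: nm_le_lam => // x xi ux; rewrite H// nm0 mul0r.
Qed.

Lemma N2_conv x f g : gunits Gam x -> ccs setT f -> ccs (D x) g ->
  N2 Gam mu x (conv f g) <= nm (emb f) ^+ 2 * N2 Gam mu x g.
Proof.
move=> ux cf cg; have cfg := ccs_conv lcG haar_mu ux cf cg.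
rewrite -!(nm_cls_sqr lcG haar_mu ux)// -exprMn ler_sqr ?nnegrE ?mulr_ge0 ?nm_ge0//.
by rewrite -lam_cls//; exact: lam_nm.
Qed.

End reduced_algebra.

(** * From a uniform lower bound to invertibility *)

Section contraction_principle.
Context (R : realType) (V : completeNormedModType R[i]).

Lemma nm_cauchy_cvg (X : nat -> V) :
  (forall e : R, 0 < e -> exists N, forall n m, (N <= n)%N -> (N <= m)%N -> nm (X n - X m) < e) ->
  exists l, forall e : R, 0 < e -> exists N, forall n, (N <= n)%N -> nm (l - X n) < e.
Proof.
move=> H.
have /cauchy_cvgP/cvg_ex[l Xl] : cauchy (X @ \oo).
  apply/cauchy_ballP => -[e e'] /[dup] /ltW/ger0_Im /= ->.
  rewrite -[(e +i* 0)%C]/(e%:C)%C ltcR => e0.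
  have [N HN] := H e e0.
  near_simpl; exists ([set n | N <= n]%N, [set n | N <= n]%N); first by split; exists N.
  by move=> [n m] [/= Nn Nm]; rewrite -ball_normE /= nmE ltcR; exact: HN.
exists l => e e0; have e0' : (0 : R[i]) < e%:C%C by rewrite ltcR.
have /cvgrPdist_lt/(_ _ e0')[N _ HN] := Xl.
by exists N => n Nn; have := HN n Nn; rewrite nmE ltcR.
Qed.

Lemma contraction_fixpoint (Phi : V -> V) (q : R) : 0 <= q -> q < 1 ->
  (forall u v, nm (Phi u - Phi v) <= q * nm (u - v)) -> exists p, Phi p = p.
Proof.
move=> q0 q1 HPhi; pose X n := iter n Phi 0.
set K := nm (X 1%N - X 0%N).
have K0 : 0 <= K by exact: nm_ge0.
have q1' : 0 < 1 - q by rewrite subr_gt0.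
have step n : nm (X n.+1 - X n) <= q ^+ n * K.
  elim: n => [|n IH]; first by rewrite expr0 mul1r.
  by apply: le_trans (HPhi _ _) _; rewrite exprS -mulrA ler_wpM2l.
have far n k : nm (X (n + k)%N - X n) <= q ^+ n * K * ((1 - q ^+ k) / (1 - q)).
  elim: k => [|k IH]; first by rewrite addn0 subrr nm0 expr0 subrr mul0r mulr0.
  rewrite addnS -(subrKA (X (n + k)%N)); apply: le_trans (nmD _ _) _.
  apply: le_trans (lerD (step _) IH) _.
  rewrite le_eqVlt; apply/orP; left; apply/eqP; rewrite exprD exprS.
  by field; rewrite gt_eqF.
have far' n k : nm (X (n + k)%N - X n) <= q ^+ n * (K / (1 - q)).
  apply: le_trans (far n k) _; rewrite -mulrA; apply: ler_wpM2l; first exact: exprn_ge0.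
  apply: ler_wpM2l => //; rewrite -[leRHS]mul1r ler_pM2r ?invr_gt0// gerBl.
  exact: exprn_ge0.
have small (e : R) : 0 < e -> exists N, forall n, (N <= n)%N -> q ^+ n * (K / (1 - q)) < e.
  move=> e0; have C1 : 0 < K / (1 - q) + 1 by rewrite ltr_wpDl// divr_ge0// ltW.
  have d0 : 0 < e / (K / (1 - q) + 1) by rewrite divr_gt0.
  have qn : `|q| < 1 by rewrite ger0_norm.
  have /cvgrPdist_lt/(_ _ d0)[N _ HN] := cvg_expr qn.
  exists N => n Nn; have := HN n Nn; rewrite sub0r normrN ger0_norm ?exprn_ge0// => Hq.
  have qn0 : 0 <= q ^+ n by exact: exprn_ge0.
  apply: le_lt_trans (_ : q ^+ n * (K / (1 - q) + 1) < e).
    by rewrite ler_wpM2l// lerDl.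
  by rewrite -ltr_pdivlMr.
have [|l Hl] := @nm_cauchy_cvg X.
  move=> e e0; have [N HN] := small _ e0.
  exists N; suff H n m : (N <= n)%N -> (n <= m)%N -> nm (X n - X m) < e.
    move=> n m Nn Nm; have [nm'|/ltnW mn] := leqP n m; first exact: H.
    by rewrite nm_distC; exact: H.
  move=> Nn nm'; rewrite -(subnKC nm') nm_distC.
  exact: le_lt_trans (far' _ _) (HN _ Nn).
exists l; apply/eqP; rewrite -subr_eq0; apply/eqP; apply: nm_eq0; apply/eqP.
rewrite eq_le nm_ge0 andbT; apply/ler_addgt0Pr => e e0; rewrite add0r.
have e2 : 0 < e / 2 by rewrite divr_gt0.
have [N HN] := Hl _ e2.
rewrite -(subrKA (X N.+1)) (splitr e); apply: le_trans (nmD _ _) _.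
apply: lerD; last by rewrite nm_distC; apply/ltW; apply: HN.
apply: le_trans (HPhi _ _) _; apply: le_trans (ler_piMl (nm_ge0 _) (ltW q1)) _.
by apply/ltW; apply: HN.
Qed.

End contraction_principle.

Lemma id_plus_sub (R : realType) (V : lmodType R[i]) (T : V -> V) v w : linear T ->
  (v - w) + T (v - w) = (v + T v) - (w + T w).
Proof. by move=> lT; rewrite (lin_sub lT) opprD addrACA. Qed.

(** Here [p], [p'] and [w] are the norms of $g$, of $Tg$ and of the adjoint applied to $Tg$. With
    $t=C^{-2}$ the last term is at most $tp'^2$, which leaves $p^2-tp'^2\le(1-tc^2)p^2$; then
    $1-s\le(1-s/2)^2$. *)
Lemma gradient_step_bound (R : realType) (t C c p p' w : R) : 0 < t -> t * C ^+ 2 = 1 ->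
  0 < C -> 0 < c -> 0 <= p -> 0 <= p' -> 0 <= w -> w <= C * p' -> c * p <= p' ->
  p ^+ 2 - 2 * t * p' ^+ 2 + t ^+ 2 * w ^+ 2 <= ((1 - t * c ^+ 2 / 2) * p) ^+ 2.
Proof.
move=> t0 tC C0 c0 p0 p'0 w0 Hw Hp.
have tC2 : t ^+ 2 * C ^+ 2 = t by rewrite expr2 -mulrA tC mulr1.
have Hw2 : t ^+ 2 * w ^+ 2 <= t * p' ^+ 2.
  have -> : t * p' ^+ 2 = t ^+ 2 * (C * p') ^+ 2 by rewrite exprMn [RHS]mulrA tC2.
  by rewrite ler_wpM2l ?sqr_ge0// ler_sqr ?nnegrE// mulr_ge0// ltW.
have Hp2 : t * c ^+ 2 * p ^+ 2 <= t * p' ^+ 2.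
  have -> : t * c ^+ 2 * p ^+ 2 = t * (c * p) ^+ 2 by ring.
  apply: ler_wpM2l; first exact: ltW.
  by rewrite ler_sqr ?nnegrE// mulr_ge0// ltW.
have : p ^+ 2 - t * c ^+ 2 * p ^+ 2 <= ((1 - t * c ^+ 2 / 2) * p) ^+ 2.
  have -> : ((1 - t * c ^+ 2 / 2) * p) ^+ 2 = p ^+ 2 - t * c ^+ 2 * p ^+ 2 + (t * c ^+ 2 / 2 * p) ^+ 2.
    by field.
  by rewrite lerDl sqr_ge0.
by lra.
Qed.

Lemma half_le (R : realType) (c p x y : R) : c * p <= x + y -> y <= c / 2 * p -> c / 2 * p <= x.
Proof. by move=> H1 H2; lra. Qed.

Section invertibility.
Context (R : realType) (G : ptopologicalType) (Gam : groupoid G).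
Hypothesis lcG : locally_compact_groupoid Gam.
Context (mu : G -> {measure set (borel G) -> \bar R}).
Hypothesis haar_mu : haar_system Gam mu.
Context (A : reduced_cstar Gam mu).
Local Notation D := (gfiber Gam).
Local Notation conv := (convolution Gam mu).
Local Notation cls := (cls Gam mu).
Local Notation lam := (rcs_lambda A).
Local Notation emb := (rcs_emb A).
Let hG := lcg_hausdorff lcG.
Implicit Types (a b : A) (f g : G -> R[i]).

Definition bounded_below a (c : R) := forall x g, gunits Gam x -> ccs (D x) g ->
  c * nm (cls x g) <= nm (cls x g + lam x a (cls x g)).

(** The adjoint factor comes from [f], where [conv_adjoint] identifies it. With [f] in both factors
    the step contracts by [1 - u / 2]; returning to [a] in the inner factor costs at most
    [u / 4]. *)
Lemma gradient_step_contraction a (c : R) : 0 < c -> bounded_below a c ->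
  exists (t q : R) (f : G -> R[i]), [/\ 0 < t, 0 <= q /\ q < 1, ccs setT f &
   forall x xi, gunits Gam x -> nm (xi - t%:C%C *: (xi + lam x a xi +
     lam x (bsa_star (emb f)) (xi + lam x a xi))) <= q * nm xi].
Proof.
(* The first [c] names the generalized variable: the reduction is to $c\le 1$, by lowering [c]. *)
wlog c1 : c / c <= 1.
  move=> W c0 Hc; apply: (W (Num.min c 1)); first by rewrite ge_min lexx orbT.
    by rewrite lt_min c0 ltr01.
  move=> x g ux cg; apply: le_trans (Hc x g ux cg).
  by rewrite ler_wpM2r ?nm_ge0// ge_min lexx.
move=> c0 Hc.
set C := nm a + 2; have C2 : 2 <= C by rewrite lerDr nm_ge0.
have C0 : 0 < C by lra.
set t := (C ^+ 2)^-1; have t0 : 0 < t by rewrite invr_gt0 exprn_gt0.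
have tC : t * C ^+ 2 = 1 by rewrite mulVf// gt_eqF// exprn_gt0.
set u := t * (c / 2) ^+ 2.
have c2 : 0 < c / 2 by rewrite divr_gt0.
have u0 : 0 < u by rewrite mulr_gt0// exprn_gt0.
(* The entry [c / 2] keeps the lower bound [c / 2] for [f], [1] keeps the norm of $1+\lambda_x(f)$
   at most [C], and the last entry makes the replacement of [f] by [a] cost at most [u / 4]. *)
set eta := Num.min (Num.min (c / 2) 1) (u / (4 * t * C)).
have eta0 : 0 < eta.
  by rewrite !lt_min c2 ltr01/= divr_gt0// !mulr_gt0.
have eta1 : eta <= 1 by rewrite !ge_min lexx !orbT.
have etac : eta <= c / 2 by rewrite !ge_min lexx.
have etau : t * C * eta <= u / 4.
  have H : eta <= u / (4 * t * C) by rewrite !ge_min lexx !orbT.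
  apply: le_trans (ler_wpM2l (ltW (mulr_gt0 t0 C0)) H) _.
  rewrite le_eqVlt; apply/orP; left; apply/eqP; field.
  by rewrite !gt_eqF.
have [f cf af] := emb_dense a eta0.
set F := emb f in af *.
have FC : nm F + 1 <= C.
  have -> : F = a - (a - F) by rewrite opprB addrC subrK.
  by have := nmB a (a - F); rewrite /C; lra.
have sF : nm (bsa_star F) = nm F by rewrite /nm bsa_norm_star.
have sFC x (v : L2 (mu x)) : gunits Gam x -> nm (v + lam x (bsa_star F) v) <= C * nm v.
  move=> ux; apply: le_trans (nmD _ _) _.
  apply: le_trans (lerD (lexx _) (lam_nm _ _ ux)) _.
  rewrite sF -{1}[nm v]mul1r -mulrDl; apply: ler_wpM2r; first exact: nm_ge0.
  by rewrite addrC.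
have u1 : u <= 1.
  have t1 : t <= 1 by rewrite invf_le1 ?exprn_gt0// expr_ge1//; lra.
  have cc : (c / 2) ^+ 2 <= 1 by rewrite expr_le1//; lra.
  by apply: mulr_ile1 => //; [exact: ltW|exact: sqr_ge0].
exists t, (1 - u / 4), f; split => //; first by split; lra.
have core x g : gunits Gam x -> ccs (D x) g ->
   nm (cls x g - t%:C%C *: (cls x g + lam x F (cls x g) +
     lam x (bsa_star F) (cls x g + lam x F (cls x g)))) <= (1 - u / 2) * nm (cls x g).
  move=> ux cg; have cfg := ccs_conv lcG haar_mu ux cf cg.
  have cuu : ccs (D x) (fun h => g h + conv f g h) by exact: ccsD.
  have cfs := ccs_cinvolution lcG cf.
  have cw := ccsD cuu (ccs_conv lcG haar_mu ux cfs cuu).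
  have ctw := ccsZ t%:C%C cw.
  have Eu : cls x g + lam x F (cls x g) = cls x (fun h => g h + conv f g h).
    by rewrite lam_cls// -(clsD lcG haar_mu ux).
  have Ew : cls x (fun h => g h + conv f g h) + lam x (bsa_star F) (cls x (fun h => g h + conv f g h)) =
      cls x (fun h => g h + conv f g h + conv (cinvolution Gam f) (fun h => g h + conv f g h) h).
    rewrite -rcs_emb_star; last exact: ccs_Cc.
    rewrite lam_cls// -(clsD lcG haar_mu ux)//; exact: ccs_conv.
  rewrite Eu Ew -(clsZ lcG haar_mu _ ux)// -(clsB lcG haar_mu ux)//.
  rewrite -ler_sqr ?nnegrE ?nm_ge0 ?mulr_ge0 ?nm_ge0//; last lra.
  rewrite (nm_cls_sqr lcG haar_mu ux); last exact: ccsB.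
  rewrite (N2_gradient_step lcG haar_mu t ux cf cg).
  have Nw := sFC x (cls x (fun h => g h + conv f g h)) ux.
  rewrite Ew in Nw.
  have Nu : (c / 2) * nm (cls x g) <= nm (cls x (fun h => g h + conv f g h)).
    rewrite -Eu; have := Hc x g ux cg.
    have -> : cls x g + lam x a (cls x g) = (cls x g + lam x F (cls x g)) + lam x (a - F) (cls x g).
      by rewrite (lin_sub (lam_linl _ ux)) -addrA [lam x F _ + _]addrCA subrr addr0.
    have H1 : nm (lam x (a - F) (cls x g)) <= c / 2 * nm (cls x g).
      apply: le_trans (lam_nm _ _ ux) _; apply: ler_wpM2r; first exact: nm_ge0.
      by apply: le_trans (ltW af) _.
    by move=> /le_trans/(_ (nmD _ _)) H2; exact: half_le H2 H1.
  rewrite -!(nm_cls_sqr lcG haar_mu ux)//.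
  exact: (gradient_step_bound t0 tC C0 c2 (nm_ge0 _) (nm_ge0 _) (nm_ge0 _) Nw Nu).
have core2 x g : gunits Gam x -> ccs (D x) g ->
   nm (cls x g - t%:C%C *: (cls x g + lam x a (cls x g) +
     lam x (bsa_star F) (cls x g + lam x a (cls x g)))) <= (1 - u / 4) * nm (cls x g).
  move=> ux cg; set v := cls x g.
  have laF : lam x a v = lam x F v + lam x (a - F) v.
    by rewrite (lin_sub (lam_linl _ ux)) addrCA subrr addr0.
  set z := lam x (a - F) v.
  have -> : v - t%:C%C *: (v + lam x a v + lam x (bsa_star F) (v + lam x a v)) =
      (v - t%:C%C *: (v + lam x F v + lam x (bsa_star F) (v + lam x F v))) -
      t%:C%C *: (z + lam x (bsa_star F) z).
    by rewrite laF -/z [v + (_ + z)]addrA (lin_add (lam_lin _ ux)) addrACA scalerDr opprD addrA.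
  apply: le_trans (nmB _ _) _; rewrite (nmZ _ (z + _)) cmod_real (ger0_norm (ltW t0)).
  have H1 := core x g ux cg; have H2 := sFC x z ux.
  have H3 : nm z <= eta * nm v.
    apply: le_trans (lam_nm _ _ ux) _; apply: ler_wpM2r; first exact: nm_ge0.
    exact: ltW.
  have H4 : t * nm (z + lam x (bsa_star F) z) <= u / 4 * nm v.
    apply: le_trans (_ : t * (C * (eta * nm v)) <= _).
      apply: ler_wpM2l; first exact: ltW.
      by apply: le_trans H2 _; apply: ler_wpM2l => //; exact: ltW.
    by rewrite !mulrA; apply: ler_wpM2r etau; exact: nm_ge0.
  by apply: le_trans (lerD H1 H4) _; rewrite -mulrDl; apply: ler_wpM2r; [exact: nm_ge0|lra].
move=> x xi ux.
set S := fun xi : L2 (mu x) => xi - t%:C%C *: (xi + lam x a xi + lam x (bsa_star F) (xi + lam x a xi)).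
have S_sub v w : S (v - w) = S v - S w.
  rewrite /S (id_plus_sub _ _ (lam_lin a ux)) (id_plus_sub _ _ (lam_lin (bsa_star F) ux)).
  by rewrite scalerBr !opprD !opprK addrACA.
set M := 1 + t * (C * (1 + nm a)).
have S_bound v : nm (S v) <= M * nm v.
  apply: le_trans (nmB _ _) _; rewrite nmZ cmod_real (ger0_norm (ltW t0)) /M.
  have -> : (1 + t * (C * (1 + nm a))) * nm v = nm v + t * (C * ((1 + nm a) * nm v)) by ring.
  rewrite lerD2l; apply: ler_wpM2l; first exact: ltW.
  apply: le_trans (sFC x _ ux) _; apply: ler_wpM2l; first exact: ltW.
  rewrite mulrDl mul1r; apply: le_trans (nmD _ _) _; rewrite lerD2l; exact: lam_nm.
rewrite -[X in nm X <= _]/(S xi) -subr_le0.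
apply: (@le_all_small _ _ (M + (1 - u / 4))) => e e0.
have [g cg xg] := cls_dense lcG haar_mu xi ux e0.
have q0 : 0 <= 1 - u / 4 by lra.
have H1 : nm (S xi) <= M * e + (1 - u / 4) * nm (cls x g).
  have -> : S xi = S (xi - cls x g) + S (cls x g) by rewrite S_sub subrK.
  apply: le_trans (nmD _ _) (lerD _ (core2 x g ux cg)).
  apply: le_trans (S_bound _) _; apply: ler_wpM2l (ltW xg).
  apply: addr_ge0 => //; apply: mulr_ge0; first exact: ltW.
  by apply: mulr_ge0; [exact: ltW|apply: addr_ge0 => //; exact: nm_ge0].
have H2 : nm (cls x g) <= nm xi + e.
  have -> : cls x g = xi - (xi - cls x g) by rewrite opprB addrC subrK.
  by apply: le_trans (nmB _ _) _; rewrite lerD2l ltW.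
by have := ler_wpM2l q0 H2; rewrite mulrDr mulrDl; lra.
Qed.

(** Read in the unitization, the equation is (1 + v)(1 + a) = 1. With 1 + p = (1 + s)(1 + a), a
    fixed point [B] of [Phi] satisfies (1 + tB)(1 + p) = 1, so 1 + v = (1 + tB)(1 + s) is a
    solution. Differences of [Phi] are right multiplications by 1 - t(1 + p), whose norm is bounded
    through the representations by [nm_le_lam]. *)
Lemma exists_left_inverse a (c : R) : 0 < c -> bounded_below a c ->
  exists v : A, v + a + bsa_mul v a = 0.
Proof.
move=> c0 Hc; have [t [q [f [t0 [q0 q1] cf HS]]]] := gradient_step_contraction c0 Hc.
set s := bsa_star (emb f) in HS.
pose p := a + s + bsa_mul s a.
pose Phi X : A := X - t%:C%C *: (X + bsa_mul X p) - p.
have mulDl (X Y Z : A) : bsa_mul (X + Y) Z = bsa_mul X Z + bsa_mul Y Z.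
  exact: (lin_add (@bsa_mul_linearl _ A Z)).
have mulDr (X Y Z : A) : bsa_mul X (Y + Z) = bsa_mul X Y + bsa_mul X Z.
  exact: (lin_add (@bsa_mul_linearr _ A X)).
have mulZl (z : R[i]) (X Z : A) : bsa_mul (z *: X) Z = z *: bsa_mul X Z.
  exact: (lin_scale (@bsa_mul_linearl _ A Z)).
have [|B HB] := @contraction_fixpoint R A Phi q q0 q1.
  move=> X Y.
  have -> : Phi X - Phi Y = (X - Y) - t%:C%C *: ((X - Y) + bsa_mul (X - Y) p).
    have cancel_p (u w u' w' z : A) : (u - u' - z) - (w - w' - z) = (u - w) - (u' - w').
      by rewrite opprB addrA subrK !opprD !opprK addrACA.
    rewrite /Phi cancel_p bsa_mulBl -scalerBr; congr (_ - _ *: _).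
    by rewrite opprD addrACA.
  move: (X - Y) => Z; apply: (nm_le_lam lcG); first by rewrite mulr_ge0// nm_ge0.
  move=> x xi ux; have linl : linear (fun b : A => lam x b xi) by exact: lam_linl.
  have -> : lam x (Z - t%:C%C *: (Z + bsa_mul Z p)) xi =
      lam x Z (xi - t%:C%C *: (xi + lam x a xi + lam x s (xi + lam x a xi))).
    rewrite (lin_sub linl) (lin_scale linl) (lin_add linl) /= (lam_mul lcG haar_mu)//.
    rewrite (lin_sub (lam_lin Z ux)) (lin_scale (lam_lin Z ux)); congr (_ - _ *: _).
    rewrite -(lin_add (lam_lin Z ux)); congr (lam x Z _).
    rewrite /p (lin_add linl) (lin_add linl) /= (lam_mul lcG haar_mu)//.
    by rewrite (lin_add (lam_lin s ux)) !addrA.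
  apply: le_trans (lam_nm _ _ ux) _.
  have -> : q * nm Z * nm xi = nm Z * (q * nm xi) by ring.
  by apply: ler_wpM2l; [exact: nm_ge0|exact: HS].
have E : t%:C%C *: (B + bsa_mul B p) = - p.
  move: HB; rewrite /Phi -addrA -[RHS]addr0 => /addrI; rewrite -opprD => /eqP.
  by rewrite oppr_eq0 addr_eq0 => /eqP.
exists (s + t%:C%C *: B + bsa_mul (t%:C%C *: B) s).
transitivity (p + t%:C%C *: (B + bsa_mul B p)); last by rewrite E subrr.
rewrite !mulDl !mulZl /p !mulDr !scalerDr bsa_mulA !addrA.
by rewrite [LHS](ACl (4*1*5*2*6*3*7))/=.
Qed.

Lemma invertible_of_bounded_below a (c : R) : 0 < c -> bounded_below a c ->
  (forall x, gunits Gam x -> op_invertible (fun xi : L2 (mu x) => xi + lam x a xi)) ->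
  unitization_invertible ((a, 1) : unitization A).
Proof.
move=> c0 Hc inv; have [v va] := exists_left_inverse c0 Hc.
exists (v, 1); rewrite /unitizationM /unitization1 /= !scale1r mulr1.
split; last by rewrite -va; congr (_, _); rewrite addrC addrA addrAC addrC addrA.
congr (_, _); apply: (lam_eq0 lcG) => x xi ux.
have [S [_ TS ST]] := inv x ux.
(* On each fiber 1 + v is a left inverse of an invertible operator, hence its inverse [S]. *)
have Vl w : (w + lam x a w) + lam x v (w + lam x a w) = w.
  have : lam x (v + a + bsa_mul v a) w = 0 by rewrite va (lin_zero (lam_linl w ux)).
  rewrite !(lin_add (lam_linl w ux)) (lam_mul lcG haar_mu)// (lin_add (lam_lin v ux)) => E.
  by rewrite -addrA [lam x a w + _]addrA [lam x a w + _]addrC E addr0.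
have Vxi : xi + lam x v xi = S xi by rewrite -{1 2}(ST xi) /= Vl.
have : (xi + lam x v xi) + lam x a (xi + lam x v xi) = xi by rewrite Vxi; exact: ST.
rewrite (lin_add (lam_lin a ux)) !(lin_add (lam_linl xi ux)) (lam_mul lcG haar_mu)// => E.
apply: (@addrI _ xi); rewrite addr0 -[RHS]E !addrA.
by rewrite [LHS](ACl (1*3*4*2))/=.
Qed.

End invertibility.

(** * Weights from amenability *)

Section variation.
Context (R : realType) (G : ptopologicalType).
Implicit Types (m : {measure set (borel G) -> \bar R}).

Lemma bounded_integrable m (F : set (borel G)) (u : borel G -> R) (B : R) : measurable F ->
  (m setT <= 1)%E -> measurable_fun F u -> (forall h, F h -> `|u h| <= B) ->
  m.-integrable F (EFin \o u).
Proof.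
move=> mF m1 mu uB; apply: measurable_bounded_integrable => //.
  by apply: le_lt_trans (ltry 1); apply: le_trans m1; apply: le_measure; rewrite ?inE.
exists B; split; first exact: num_real.
by move=> M BM h Fh; apply: le_trans (uB h Fh) (ltW BM).
Qed.

Lemma Rintegral_indic_finite m (F B : set (borel G)) : measurable F -> measurable B ->
  (\int[m]_(h in F) \1_B h)%R = fine (m (F `&` B)).
Proof. by move=> mF mB; rewrite /Rintegral integral_indic// setIC. Qed.

Lemma Rintegral_level_sum m (F : set (borel G)) (u : borel G -> R) (B : nat -> set (borel G)) n (v : nat -> R) (e : R) :
  measurable F -> (m setT <= 1)%E -> measurable_fun F u -> (forall h, F h -> `|u h| <= 1) ->
  (forall i, measurable (B i)) -> 0 <= e ->
  (forall h, F h -> `|u h - \sum_(i < n) v i * \1_(B i) h| <= e) ->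
  `|(\int[m]_(h in F) u h)%R - \sum_(i < n) v i * fine (m (F `&` B i))| <= e.
Proof.
move=> mF m1 mu u1 mB e0 uB.
have mFfin : (m F < +oo)%E.
  by apply: le_lt_trans (ltry 1); apply: le_trans m1; apply: le_measure; rewrite ?inE.
have m1B i : measurable_fun F (\1_(B i) : borel G -> R).
  by apply: measurable_funTS; exact: measurable_indic.
have i1B i : m.-integrable F (EFin \o (\1_(B i) : borel G -> R)).
  apply: (@bounded_integrable _ _ _ 1) => // h _.
  by rewrite indicE; case: (_ \in _); rewrite ?normr1 ?normr0.
have mi i : m.-integrable F (EFin \o (fun h => v i * \1_(B i) h)).
  apply: (@bounded_integrable _ _ _ `|v i|) => //; first exact: measurable_funM.
  by move=> h _; rewrite normrM ler_piMr// indicE; case: (_ \in _); rewrite ?normr1 ?normr0.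
have key k : m.-integrable F (EFin \o (fun h => \sum_(i < k) v i * \1_(B i) h)) /\
    (\int[m]_(h in F) (\sum_(i < k) v i * \1_(B i) h))%R = \sum_(i < k) v i * fine (m (F `&` B i)).
  elim: k => [|k [IH1 IH2]].
    rewrite (_ : (fun h => _) = (fun=> 0)); last by apply/funext => h; rewrite big_ord0.
    by split; [exact: integrable0|rewrite big_ord0 /Rintegral integral0].
  have E : (fun h => \sum_(i < k.+1) v i * \1_(B i) h) =
      (fun h => \sum_(i < k) v i * \1_(B i) h + v k * \1_(B k) h).
    by apply/funext => h; rewrite big_ord_recr.
  rewrite E; split; first exact: (integrableD mF IH1 (mi k)).
  rewrite RintegralD// IH2 big_ord_recr /=; congr (_ + _).
  rewrite RintegralZl//.
  by rewrite Rintegral_indic_finite.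
have iu : m.-integrable F (EFin \o u) by exact: (@bounded_integrable _ _ _ 1).
have [k1 <-] := key n.
rewrite -RintegralB//.
have isub : m.-integrable F (EFin \o (fun h => u h - \sum_(i < n) v i * \1_(B i) h)).
  exact: (integrableB mF iu k1).
apply: le_trans (le_normr_Rintegral mF isub) _.
have ie : m.-integrable F (EFin \o (fun=> e)) by apply: (@bounded_integrable _ _ _ `|e|).
apply: le_trans (le_Rintegral mF _ ie _) _ => //.
  exact: integrable_norm.
rewrite Rintegral_cst// ler_piMr//.
have : (m F <= 1)%E by apply: le_trans m1; apply: le_measure; rewrite ?inE.
by rewrite -(@fineK _ (m F)) ?ge0_fin_numE// lee_fin.
Qed.

(** [variation_norm] only tests finite partitions, so [u] is replaced by level sums. Their values
    lie in [-1, 1], hence the two sums differ by at most the variation. [F] and [tau] describe a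
    push-forward in the form of [gpush]. *)
Lemma variation_integral m m' (F : set (borel G)) (tau : G -> G) (u : borel G -> R) (e : R) :
  measurable F -> (m setT <= 1)%E -> (m' setT <= 1)%E ->
  measurable_fun setT u -> (forall B : set (borel G), measurable B -> measurable (F `&` (tau @^-1` B))) ->
  (forall h, `|u h| <= 1) ->
  (variation_norm (fun B => m B - m' (F `&` [set h | B (tau h)])) < e%:E)%E ->
  `|(\int[m]_h u h)%R - (\int[m']_(h in F) u (tau h))%R| <= e.
Proof.
move=> mF m1 m'1 mu mtau u1 Hvar.
apply/ler_addgt0Pr => eps eps0.
(* Each of the two integrals differs from its level sum by at most 1/N. *)
pose N := (Num.truncn (2 / eps)).+1.
have N0 : 0 < N%:R :> R by rewrite ltr0n.
have Neps : N%:R^-1 <= eps / 2.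
  rewrite -(invf_div 2 eps) lef_pV2 ?posrE ?divr_gt0//.
  by have /andP[_ /ltW] := truncn_itv (ltW (divr_gt0 (ltr0Sn R 1) eps0)).
pose y h : R := N%:R * (u h + 1).
have y0 h : 0 <= y h.
  by rewrite mulr_ge0 ?ler0n//; have := u1 h; rewrite ler_norml => /andP[]; lra.
(* level sets of u, of height 1/N *)
pose B k : set (borel G) := [set h | Num.truncn (y h) = k].
have my : measurable_fun setT y by apply: measurable_funM => //; exact: measurable_funD.
have mB k : measurable (B k).
  have -> : B k = setT `&` y @^-1` `[k%:R, k.+1%:R[%classic.
    rewrite setTI; apply/seteqP; split=> h /=; rewrite in_itv/=.
      by move=> <-; exact: truncn_itv.
    by move=> hk; apply: truncn_def.
  by apply: my => //; exact: measurable_itv.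
(* The level [2 * N] occurs where [u h = 1], hence the extra one. *)
pose n := (2 * N).+1.
pose v i : R := i%:R / N%:R - 1.
have kn h : (Num.truncn (y h) < n)%N.
  rewrite truncn_lt_nat// /n -natr1 natrM; apply: le_lt_trans (_ : N%:R * 2 < _).
    by apply: ler_wpM2l; [exact: ler0n|have := u1 h; rewrite ler_norml => /andP[]; lra].
  by rewrite mulrC ltrDl.
have sumE h : \sum_(i < n) v i * \1_(B i) h = v (Num.truncn (y h)).
  rewrite (bigD1 (Ordinal (kn h)))//= big1 ?addr0.
    by rewrite indicE mem_set ?mulr1.
  move=> i ih; rewrite indicE memNset ?mulr0// => /= ki.
  by move: ih; rewrite -val_eqE /= ki eqxx.
have N1 : 0 <= N%:R^-1 :> R by rewrite invr_ge0 ltW.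
have close h : `|u h - \sum_(i < n) v i * \1_(B i) h| <= N%:R^-1.
  rewrite sumE /v; have /andP[k1 k2] := truncn_itv (y0 h).
  have -> : u h - ((Num.truncn (y h))%:R / N%:R - 1) = (y h - (Num.truncn (y h))%:R) / N%:R.
    by rewrite /y; field; rewrite gt_eqF.
  rewrite normrM (ger0_norm N1); apply: ler_piMl => //.
  by rewrite ger0_norm ?subr_ge0// lerBlDl natr1 ltW.
have E1 := Rintegral_level_sum (v := v) (n := n) (F := setT) measurableT m1 mu (fun h _ => u1 h) mB N1 (fun h _ => close h).
have mutau : measurable_fun F (u \o tau).
  move=> _ Y mY; rewrite (_ : F `&` _ = F `&` (tau @^-1` (u @^-1` Y)))//.
  by apply: mtau; rewrite -[_ @^-1` _]setTI; exact: mu.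
have E2 : `|(\int[m']_(h in F) u (tau h))%R -
    \sum_(i < n) v i * fine (m' (F `&` [set h | B i (tau h)]))| <= N%:R^-1.
  pose B' i := F `&` [set h | B i (tau h)].
  have mB' i : measurable (B' i) by apply: (mtau (B i)).
  have close' h : F h -> `|(u \o tau) h - \sum_(i < n) v i * \1_(B' i) h| <= N%:R^-1.
    move=> Fh; have := close (tau h).
    rewrite (_ : \sum_(i < n) v i * \1_(B' i) h = \sum_(i < n) v i * \1_(B i) (tau h))//.
    apply: eq_bigr => i _; rewrite !indicE; congr (_ * (nat_of_bool _)%:R).
    apply/idP/idP => /set_mem H; apply/mem_set; last by split.
    by case: H.
  have := Rintegral_level_sum (v := v) (n := n) mF m'1 mutau (fun h _ => u1 (tau h)) mB' N1 close'.
  congr (_ <= _); congr `|_ - _|; apply: eq_bigr => i _; congr (_ * fine (m' _)).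
  by rewrite /B' setIA setIid.
have mfin (B0 : set (borel G)) : measurable B0 -> m B0 \is a fin_num.
  move=> mB0; rewrite ge0_fin_numE//; apply: le_lt_trans (ltry 1); apply: le_trans m1.
  by apply: le_measure; rewrite ?inE.
have m'fin (B0 : set (borel G)) : measurable B0 -> m' B0 \is a fin_num.
  move=> mB0; rewrite ge0_fin_numE//; apply: le_lt_trans (ltry 1); apply: le_trans m'1.
  by apply: le_measure; rewrite ?inE.
have E3 : \sum_(i < n) `|fine (m (setT `&` B i)) - fine (m' (F `&` [set h | B i (tau h)]))| <= e.
  rewrite -lee_fin; apply/ltW; apply: le_lt_trans Hvar.
  apply: ereal_sup_ubound; exists n, (fun i : 'I_n => B i); split => //.
  - move=> i j _ _ [h [/= Bi Bj]]; apply: val_inj; rewrite /= -Bi; exact: Bj.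
  - by apply/seteqP; split => // h _; exists (Ordinal (kn h)).
  rewrite -sumEFin; apply: eq_bigr => i _.
  have mt : measurable (F `&` [set h | B i (tau h)]) by exact: (mtau (B i)).
  by rewrite setTI -{2}(fineK (mfin _ (mB i))) -{2}(fineK (m'fin _ mt)).
have E4 : `|\sum_(i < n) v i * fine (m (setT `&` B i)) -
    \sum_(i < n) v i * fine (m' (F `&` [set h | B i (tau h)]))| <= e.
  apply: le_trans E3; rewrite -sumrB; apply: le_trans (ler_norm_sum _ _ _) _.
  apply: ler_sum => i _; rewrite -mulrBr normrM; apply: ler_piMl => //.
  rewrite /v ler_norml; apply/andP; split.
    by rewrite lerBrDr addNr; apply: divr_ge0; [exact: ler0n|exact: ltW].
  have : (i : nat)%:R <= N%:R * 2 :> R.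
    by rewrite mulrC -natrM ler_nat -ltnS; exact: ltn_ord.
  by rewrite -ler_pdivrMl// mulrC; lra.
set I1 := (\int[m]_h u h)%R in E1 *; set I2 := (\int[m']_(h in F) _)%R in E2 *.
set S1 := \sum_(i < n) _ in E1 E4; set S2 := \sum_(i < n) _ in E2 E4.
have -> : I1 - I2 = (I1 - S1) + (S1 - S2) - (I2 - S2) by ring.
apply: le_trans (ler_normB _ _) _; apply: le_trans (lerD (ler_normD _ _) (lexx _)) _.
by have := lerD (lerD E1 E4) E2; lra.
Qed.

Lemma cont_on_borel_preimage (D : set G) (tau : G -> G) (B : set (borel G)) : closed D ->
  cont_on D tau -> measurable B -> measurable ((D : set (borel G)) `&` (tau @^-1` B)).
Proof.
move=> clD ct mB; have mD := closed_borel clD.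
suff : measurable_fun (D : set (borel G)) (tau : borel G -> borel G) by apply.
apply: (@measurability _ _ (borel G) (borel G) D tau (@open G)) => //.
move=> _ [U oU <-].
rewrite (_ : D `&` _ = D `&` [set y | D y -> U (tau y)]°).
  by apply: measurableI => //; apply: open_borel; exact: open_interior.
apply/seteqP; split=> y [Dy H]; split => //; last by have /(_ Dy) := interior_subset H.
have nU : nbhs (tau y) U by apply: open_nbhs_nbhs; split.
exact: (ct y Dy _ nU).
Qed.

End variation.

Section amenability.
Context (R : realType) (G : ptopologicalType) (Gam : groupoid G).
Hypothesis lcG : locally_compact_groupoid Gam.
Hypothesis amG : topologically_amenable R Gam.
Local Notation s := (gsrc Gam).
Local Notation r := (grng Gam).
Local Notation mul := (gmul Gam).
Local Notation D := (gfiber Gam).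
Let hG := lcg_hausdorff lcG.
Let lG := lcg_locally_compact lcG.
Let clD x : closed (D x). Proof. exact: closed_gfiber. Qed.

(** One index of the amenability sequence, good for [L] and [e], is frozen. Its measures need not
    have compact support; the single cutoff [chi] keeps mass at least [1 - e] at all sources and
    ranges of points of [L]. It comes from inner regularity at each unit, continuity of the mass of
    a cutoff at nearby units, and compactness. *)
Lemma amenable_mean (L : set G) (e : R) : compact L -> 0 < e ->
  exists (nu : G -> {measure set (borel G) -> \bar R}) (chi : G -> R),
  [/\ continuous_family Gam nu,
     forall x u, gunits Gam x -> ccr (D x) u -> (forall h, D x h -> u h <= 1) ->
       rI (nu x) (D x) u <= 1,
     ccr setT chi /\ (forall h, 0 <= chi h <= 1),
     forall g, L g -> 1 - e <= rI (nu (s g)) (D (s g)) chi /\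
                      1 - e <= rI (nu (r g)) (D (r g)) chi
   & forall g u, L g -> ccr (D (s g)) u -> (forall h, D (s g) h -> `|u h| <= 1) ->
       `|rI (nu (s g)) (D (s g)) u - rI (nu (r g)) (D (r g)) (fun h => u (mul h g))| <= e].
Proof.
move=> cL e0; have [m [mrad mcont mmass mvar]] := amG.
have mD x : measurable (D x : set (borel G)) by exact: closed_borel.
(* One third each for the mass defect, inner regularity and the passage to nearby units. *)
have e3 : 0 < e / 3 by rewrite divr_gt0.
pose X := s @` L `|` r @` L.
have cX : compact X by apply: compactU; [exact: compact_gsrc|exact: compact_grng].
have Xu : X `<=` gunits Gam by move=> _ [[g _ <-]|[g _ <-]]; [exact: gunits_src|exact: gunits_rng].
have [N1 _ H1] := mmass X (e / 3) cX Xu e3.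
have [N2 _ H2] := mvar L e cL e0.
pose n := maxn N1 N2.
have {}H1 := H1 n (leq_maxl _ _); have {}H2 := H2 n (leq_maxr _ _).
pose nu := m n.
have m1 x : gunits Gam x -> (nu x setT <= 1)%E by move=> /(mrad n)[].
have fm x : gunits Gam x -> forall K : set G, compact K -> (nu x K < +oo)%E.
  by move=> ux K cK; have [rad _ _] := mrad n x ux; exact: radon_compact rad _ cK.
have cnu : continuous_family Gam nu.
  by split => // [x /(mrad n)[]|f cf] //; exact: mcont.
have mass x u : gunits Gam x -> ccr (D x) u -> (forall h, D x h -> u h <= 1) ->
    rI (nu x) (D x) u <= 1.
  move=> ux cu u1.
  have mDfin : (nu x (D x) <= 1)%E.
    by apply: le_trans (m1 x ux); apply: le_measure; rewrite ?inE.
  have Dfin : (nu x (D x) < +oo)%E by apply: le_lt_trans mDfin _; rewrite ltry.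
  apply: (@le_trans _ _ (\int[nu x]_(h in (D x : set (borel G))) 1)%R).
    apply: le_Rintegral => //.
    - exact: (ccr_integrable hG (@clD x) (fm x ux)).
    - apply: (@bounded_integrable _ _ _ _ _ 1) => //; [exact: m1|by move=> h _; rewrite normr1].
  rewrite Rintegral_cst// mul1r -lee_fin fineK// ge0_fin_numE//.
have Hchi x : exists K : set G, X x -> compact K /\
    forall chi : G -> R, ccr setT chi -> (forall h, 0 <= chi h <= 1) -> (forall h, K h -> chi h = 1) ->
      1 - e / 3 * 2 < rI (nu x) (D x) chi.
  have [Xx|] := pselect (X x); last by exists set0.
  have ux := Xu x Xx; have [rad _ nul] := mrad n x ux.
  have Tfin : nu x setT \is a fin_num by rewrite ge0_fin_numE//; apply: le_lt_trans (m1 x ux) _; rewrite ltry.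
  have mT : ((1 - e / 3)%:E < nu x setT)%E.
    have := H1 x Xx; rewrite -/(nu x) -(fineK Tfin) -[1%E]/(1%:E) -EFinB /= !lte_fin.
    by rewrite ltr_norml => /andP[+ _]; lra.
  have [K [cK _] HK] : exists2 K : set G, compact K /\ K `<=` setT & (nu x setT - (e / 3)%:E < nu x K)%E.
    have : (nu x setT - (e / 3)%:E < ereal_sup [set nu x K | K in [set K : set G | compact K /\ K `<=` setT]])%E.
      by rewrite -(radon_inner rad openT) lteBlDr// lteDl.
    by move=> /ereal_sup_gt[_ [K [cK KU] <-] HK]; exists K.
  exists K => _; split => // chi cchi chi01 chi1.
  have mK : measurable (K : set (borel G)) by exact: (closed_borel (compact_closed hG cK)).
  have Kfin : nu x K \is a fin_num by rewrite ge0_fin_numE//; exact: fm.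
  rewrite -(rI_setT lcG (fm x ux) nul cchi).
  apply: (@lt_le_trans _ _ (\int[nu x]_(h in (setT : set (borel G))) \1_(K : set (borel G)) h)%R).
    rewrite Rintegral_indic_finite// setTI.
    by move: HK mT; rewrite -(fineK Kfin) -(fineK Tfin) -EFinB !lte_fin; lra.
  apply: le_Rintegral => //.
  - apply: (@bounded_integrable _ _ _ _ _ 1) => //; first exact: m1.
    by move=> h _; rewrite indicE; case: (_ \in _); rewrite ?normr1 ?normr0.
  - by apply: (ccr_integrable hG closedT (fm x ux)).
  move=> h _; rewrite indicE; have [/set_mem Kh|_] := boolP (h \in (K : set (borel G))).
    by rewrite chi1.
  by have /andP[] := chi01 h.
have Hbump x : exists chi : G -> R, X x -> [/\ ccr setT chi, (forall h, 0 <= chi h <= 1) &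
    1 - e / 3 * 2 < rI (nu x) (D x) chi].
  have [Xx|] := pselect (X x); last by exists (fun=> 0).
  have [K HK] := Hchi x; have {HK}[cK HK] := HK Xx.
  have [chi [c1 c2 c3]] := exists_cutoff R lG hG cK.
  by exists chi => _; split => //; exact: HK.
have [b Hb] := choice Hbump.
have XN x : X x -> nbhs x [set y | gunits Gam y -> 1 - e < rI (nu y) (D y) (b x)].
  move=> Xx; have [c1 c2 c3] := Hb x Xx.
  have /(_ x (Xu x Xx)) := cont_onC_Re (cont_on_family lcG cnu (ccs_real c1)).
  move=> /cvgrPdist_lt/(_ _ e3) H.
  have H' : nbhs x [set y | gunits Gam y ->
    `|complex.Re (cI (nu x) (D x) (fun h => (b x h)%:C%C)) -
      complex.Re (cI (nu y) (D y) (fun h => (b x h)%:C%C))| < e / 3] by exact: H.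
  apply: filterS H' => y Hy uy; have := Hy uy; rewrite !cI_real /= ltr_norml => /andP[_].
  by lra.
have [k [t [tX Xt]]] := compact_finite_nbhs_cover point cX XN.
have Hsup x : exists S : set G, X x -> compact S /\ forall h, b x h != 0 -> S h.
  have [Xx|] := pselect (X x); last by exists set0.
  have [[_ [S cS HS]] _ _] := Hb x Xx.
  by exists S => _; split => // h; exact: HS.
have [S HS] := choice Hsup.
(* [chi] will be 1 on the supports of all chosen bumps, so it dominates each of them. *)
have cK : compact (\big[setU/set0]_(i < k) S (t i)).
  by apply: bigsetU_compact => i _; have [] := HS _ (tX i (ltn_ord i)).
have [chi [c1 c2 c3]] := exists_cutoff R lG hG cK.
have chimass x : X x -> 1 - e <= rI (nu x) (D x) chi.
  move=> Xx; have [i ik Hi] := Xt x Xx; have ux := Xu x Xx.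
  apply: le_trans (ltW (Hi ux)) _.
  have [cb b01 _] := Hb _ (tX i ik); have [_ bS] := HS _ (tX i ik).
  apply: (rI_le hG (@clD x) (fm x ux)).
  - exact: ccr_sub cb.
  - exact: ccr_sub c1.
  move=> h _; have [->|/bS Sh] := eqVneq (b (t i) h) 0; first by have /andP[] := c2 h.
  rewrite c3; first by have /andP[] := b01 h.
  by rewrite -(bigcup_mkord k (fun i => S (t i))); exists i.
exists nu, chi; split => //.
- by move=> g Lg; split; apply: chimass; [left|right]; exists g.
move=> g u Lg cu u1.
have us := gunits_src Gam g; have ur := gunits_rng Gam g.
have mu' : measurable_fun setT (u \_ (D (s g)) : borel G -> R).
  apply: (measurable_restrictT _ (mD (s g))).1.
  exact: (cont_on_measurable (@clD (s g)) cu.1).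
have u1' h : `|(u \_ (D (s g)) : borel G -> R) h| <= 1.
  by rewrite patchE; case: ifP => [/set_mem/u1//|_]; rewrite normr0.
have ct : cont_on (D (r g)) (fun h => mul h g).
  by apply: cont_on_mul => //; [exact: cont_on_id|exact: cont_on_cst].
have := variation_integral (mD (r g)) (m1 _ us) (m1 _ ur) mu'
  (fun B => cont_on_borel_preimage (@clD (r g)) ct (B := B)) u1' (H2 g Lg).
congr (_ <= _); congr `|_ - _|.
  by rewrite /rI [RHS]Rintegral_mkcond.
apply: eq_Rintegral => h /set_mem Dh; rewrite patchE mem_set//.
by rewrite /gfiber /= gsrc_mul.
Qed.

End amenability.

Section localization_weights.
Context (R : realType) (G : ptopologicalType) (Gam : groupoid G).
Hypothesis lcG : locally_compact_groupoid Gam.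
Hypothesis amG : topologically_amenable R Gam.
Local Notation s := (gsrc Gam).
Local Notation r := (grng Gam).
Local Notation inv := (ginv Gam).
Local Notation mul := (gmul Gam).
Local Notation D := (gfiber Gam).
Let hG := lcg_hausdorff lcG.
Let lG := lcg_locally_compact lcG.
Let clD x : closed (D x). Proof. exact: closed_gfiber. Qed.

Lemma ccr_translate (u : G -> R) g : ccr (D (s g)) u -> ccr (D (r g)) (fun h => u (mul h g)).
Proof. by move=> /ccs_real cu; exact: ccs_Re (ccs_translate lcG cu). Qed.

Lemma sqr_sqrtB_le (a b : R) : 0 <= a -> 0 <= b -> (Num.sqrt a - Num.sqrt b) ^+ 2 <= `|a - b|.
Proof.
move=> a0 b0.
have {2}-> : a = Num.sqrt a ^+ 2 by rewrite sqr_sqrtr.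
have {2}-> : b = Num.sqrt b ^+ 2 by rewrite sqr_sqrtr.
move: (sqrtr_ge0 a) (sqrtr_ge0 b); move: (Num.sqrt a) (Num.sqrt b) => p q p0 q0.
rewrite subr_sqr normrM -[leLHS]real_normK ?num_real// expr2; apply: ler_wpM2l => //.
apply: le_trans (ler_normB _ _) _.
by rewrite (ger0_norm p0) (ger0_norm q0) ger0_norm// addr_ge0.
Qed.

(** [K'] is fixed before [x] and [Kg]; the number of weights is not. If w_j is nonzero at h and a,
    there are z, y in [S] with z h and y a in the support of phi_j, so (z h)(y a)^-1 lies in [V] and
    h a^-1 lies in S^-1 V S. By $(\sqrt p-\sqrt q)^2\le|p-q|$ the variation reduces to that of the
    squares; its bound [3 * e] counts the move of the measure to another fiber and, twice, the tail
    cut off by [chi]. *)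
Lemma localization_weights (L : set G) (e : R) : compact L -> 0 < e ->
  exists2 K' : set G, compact K' & forall x (Kg : set G), gunits Gam x -> compact Kg ->
  exists N (w : nat -> G -> R),
  [/\ forall j, (j < N)%N -> cont_on (D x) (w j),
      forall h, D x h -> \sum_(j < N) w j h ^+ 2 <= 1,
      forall h g, D x h -> Kg h -> L g -> r h = r g -> 1 - e <= \sum_(j < N) w j h ^+ 2,
      forall h a, D x h -> D x a -> L (mul h (inv a)) ->
        \sum_(j < N) (w j a - w j h) ^+ 2 <= 3 * e
    & forall j h a, (j < N)%N -> D x h -> D x a -> w j h != 0 -> w j a != 0 ->
        K' (mul h (inv a))].
Proof.
move=> cL e0.
have [nu [chi [cnu mass [cchi chi01] chimass chivar]]] := amenable_mean lcG amG cL e0.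
have [_ [S cS chiS]] := cchi.
(* A compact neighbourhood [V] of the units in r(S). It will contain h k^-1 for nearby points h, k
   of a fiber with ranges close to r(S). *)
have [chiV [[cchiV [V cV chiVV]] chiV01 chiV1]] := exists_cutoff R lG hG (compact_grng lcG cS).
have Vnbhs y : (r @` S) y -> nbhs y V.
  move=> Sy; have cV0 := cont_onT cchiV; have /cvgrPdist_lt/(_ 1 ltr01) H := cV0 y.
  have H' : nbhs y [set z | `|chiV y - chiV z| < 1] by exact: H.
  apply: filterS H' => z; rewrite /= chiV1// => Hz; apply: chiVV => //.
  by apply: contraTneq Hz => ->; rewrite subr0 normr1 ltxx.
exists (gmulset Gam (gmulset Gam (inv @` S) V) S).
  by apply: compact_gmulset => //; apply: compact_gmulset => //; exact: compact_ginv.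
move=> x Kg ux cKg.
pose E := gmulset Gam S Kg `&` D x.
have cE : compact E by apply: compact_closedI; [exact: compact_gmulset|exact: clD].
have HU y : exists U : set G, E y -> nbhs y U /\
    forall h k, D x h -> D x k -> U h -> U k -> V (mul h (inv k)).
  have [Ey|] := pselect (E y); last by exists set0.
  have [[z [a [Sz _ za ->]]] Dza] := Ey.
  have cm : cont_on (cosource Gam) (fun z => mul z.1 (inv z.2)).
    apply: cont_on_mul => //.
    - by apply: continuous_cont_on => t; exact: cvg_fst.
    - by apply: cont_on_inv => //; apply: continuous_cont_on => t; exact: cvg_snd.
    - by move=> t Et; rewrite grng_inv.
  set y' := mul z a.
  have rS : (r @` S) (mul y' (inv y')) by rewrite gmulgV /y' grng_mul//; exists z.
  have [[A B] [/= Ay By] AB] : nbhs (y', y') [set t | cosource Gam t -> V (mul t.1 (inv t.2))].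
    exact: (cm (y', y') erefl _ (Vnbhs _ rS)).
  exists (A `&` B) => _; split; first exact: filterI.
  move=> h k Dh Dk [Ah _] [_ Bk]; apply: (AB (h, k)) => //=.
  by rewrite /cosource /= Dh Dk.
have [U HUE] := choice HU.
have [N [t [b [Hb bE]]]] := exists_bumps R lG hG cE (fun y Ey => (HUE y Ey).1).
pose phi j := pu_weight b j.
have b01 h i : (i < N)%N -> 0 <= b i h <= 1 by move=> /Hb[].
have phi0 j h : (j < N)%N -> 0 <= phi j h by apply: pu_weight_ge0; exact: b01.
have phi1 h : \sum_(j < N) phi j h <= 1 by apply: pu_weight_sum_le1; exact: b01.
have phiE h : E h -> \sum_(j < N) phi j h = 1 by move=> /bE[i iN bi]; exact: pu_weight_sum1 bi.
have cphi j : (j < N)%N -> ccr setT (phi j).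
  move=> jN; apply: ccrM_l; first by have [] := Hb j jN.
  apply: (@cont_on_prod R G setT j (fun i x => 1 - b i x)) => i ij.
  apply: cont_onB; first exact: cont_on_cst.
  by have [_ []] := Hb i (ltn_trans ij jN).
have phiV j h k : (j < N)%N -> D x h -> D x k -> phi j h != 0 -> phi j k != 0 -> V (mul h (inv k)).
  move=> jN Dh Dk; rewrite !mulf_eq0 !negb_or => /andP[bh _] /andP[bk _].
  have [Et _ _ bU] := Hb j jN.
  by apply: ((HUE _ Et).2 h k Dh Dk); exact: bU.
have chiD y : ccr (D y) chi by exact: ccr_sub cchi.
pose Phi j a z := phi j (mul z a).
have cPhi j a : (j < N)%N -> ccr (D (r a)) (Phi j a).
  by move=> jN; apply: ccr_translate; apply: ccr_sub (cphi j jN).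
(* w_j(a)^2 averages phi_j(z a) over the amenability measure at r(a) *)
pose w2 j a := rI (nu (r a)) (D (r a)) (fun z => Phi j a z * chi z).
have fmr a := cf_fin cnu (gunits_rng Gam a).
have cPc j a : (j < N)%N -> ccr (D (r a)) (fun z => Phi j a z * chi z).
  by move=> jN; apply: ccrM_l (cPhi j a jN) _; exact: (chiD _).1.
have w20 j a : (j < N)%N -> 0 <= w2 j a.
  move=> jN; apply: rI_ge0 => z _; apply: mulr_ge0; first exact: phi0.
  by have /andP[] := chi01 z.
have sumw2 a : \sum_(j < N) w2 j a = rI (nu (r a)) (D (r a)) (fun z => (\sum_(j < N) Phi j a z) * chi z).
  rewrite /w2 -(rI_sum hG (@clD (r a)) (fmr a) (u := fun j z => Phi j a z * chi z)); last first.
    by move=> j jN; exact: cPc.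
  by apply: rI_eq => z _; rewrite mulr_suml.
have cS1 a : ccr (D (r a)) (fun z => \sum_(j < N) Phi j a z).
  by apply: (@ccr_sum _ _ (D (r a)) N (fun j z => Phi j a z)) => j jN; exact: cPhi.
have cS2 a : ccr (D (r a)) (fun z => (\sum_(j < N) Phi j a z) * chi z).
  by apply: ccrM_l (cS1 a) _; exact: (chiD _).1.
exists N, (fun j a => Num.sqrt (w2 j a)).
have sq h : \sum_(j < N) Num.sqrt (w2 j h) ^+ 2 = \sum_(j < N) w2 j h.
  by apply: eq_bigr => j _; rewrite sqr_sqrtr// w20.
split.
- move=> j jN; apply: cont_on_sqrt.
  (* Since f(a^-1 z^-1) = phi_j(z a), the function [w2 j] is a family convolution evaluated at
     [inv a], hence continuous. *)
  pose f (g : G) : R[i] := (phi j (inv g))%:C%C.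
  have cf : ccs setT f.
    split.
      apply: cont_onC_real; apply: (@cont_on_comp _ _ _ setT setT inv (phi j)) => //.
        by apply: continuous_cont_on; exact: (lcg_inv_continuous lcG).
      exact: (cphi j jN).1.
    have [_ [P cP phiP]] := cphi j jN.
    exists (inv @` P); first exact: compact_ginv.
    move=> g _; rewrite /f -cmod_eq0 cmod_real normr_eq0 => /(phiP _ Logic.I) Pg.
    by exists (inv g) => //; rewrite ginvK.
  have cconv := (ccs_family_convolution lcG cnu cf (ccs_real cchi)).1.
  have cc : cont_on (D x) (fun a => complex.Re (family_convolution Gam nu f (fun h => (chi h)%:C%C) (inv a))).
    apply: cont_onC_Re; apply: (@cont_on_comp _ _ _ (D x) setT inv) => //.
    by apply: continuous_cont_on; exact: (lcg_inv_continuous lcG).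
  apply: cont_on_eq cc => a Da.
  rewrite /family_convolution gsrc_inv cI_Re; apply: rI_eq => z Dz.
  have za : s z = r a by [].
  by rewrite -ginvM// /f ginvK -rmorphM.
- move=> h Dh; rewrite sq sumw2; apply: mass; [exact: gunits_rng|exact: cS2|].
  move=> z _; have /andP[c0 c1] := chi01 z.
  by apply: mulr_ile1 => //; [apply: sumr_ge0 => j _; exact: phi0|exact: phi1].
- move=> h g Dh Kh Lg hg; rewrite sq sumw2.
  have -> : rI (nu (r h)) (D (r h)) (fun z => (\sum_(j < N) Phi j h z) * chi z) =
      rI (nu (r h)) (D (r h)) chi.
    apply: rI_eq => z Dz; have [->|/(chiS _ Logic.I) Sz] := eqVneq (chi z) 0; first by rewrite mulr0.
    rewrite phiE ?mul1r//; split; first by exists z, h.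
    by rewrite /gfiber /= gsrc_mul.
  by rewrite hg; have [] := chimass g Lg.
- move=> h a Dh Da Lha.
  apply: (@le_trans _ _ (\sum_(j < N) `|w2 j a - w2 j h|)).
    by apply: ler_sum => j _; apply: sqr_sqrtB_le; exact: w20.
  set g := mul h (inv a).
  have ha : s h = s a by rewrite Dh Da.
  have sg : s g = r a by rewrite gsrc_mulV.
  have rg : r g = r h by rewrite grng_mulV.
  have ga : mul g a = h by rewrite gmulgVK.
  (* The integrand u(1 - chi) + chi is at most 1, so its integral is at most 1, while [chi] alone
     already integrates to at least [1 - e]. *)
  have tail y u : gunits Gam y -> 1 - e <= rI (nu y) (D y) chi -> ccr (D y) u ->
      (forall z, D y z -> 0 <= u z <= 1) ->
      rI (nu y) (D y) u - rI (nu y) (D y) (fun z => u z * chi z) <= e.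
    move=> uy chiy cu u01; have fmy := cf_fin cnu uy.
    have cuc : ccr (D y) (fun z => u z * chi z) by apply: ccrM_l cu _; exact: (chiD _).1.
    have cub : ccr (D y) (fun z => u z - u z * chi z) by apply: ccrD => //; exact: ccrN.
    have : rI (nu y) (D y) (fun z => u z - u z * chi z + chi z) <= 1.
      apply: mass => //; first exact: ccrD.
      move=> z Dz; have /andP[c0 c1] := chi01 z; have /andP[v0 v1] := u01 z Dz.
      have := ler_wpM2r (_ : 0 <= 1 - chi z) v1; rewrite subr_ge0 => /(_ c1).
      by rewrite mulrBr mulr1 mul1r; lra.
    by rewrite (rID hG (@clD y) fmy)// (rIB hG (@clD y) fmy)//; lra.
  have fms := cf_fin cnu (gunits_src Gam g); have fmrg := cf_fin cnu (gunits_rng Gam g).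
  have [chis chir] := chimass g Lha.
  have cPs j : (j < N)%N -> ccr (D (s g)) (Phi j a) by rewrite sg; exact: cPhi.
  have cPr j : (j < N)%N -> ccr (D (r g)) (fun z => Phi j a (mul z g)).
    by move=> jN; apply: ccr_translate; exact: cPs.
  have cPsc j : (j < N)%N -> ccr (D (s g)) (fun z => Phi j a z * chi z).
    by move=> jN; apply: ccrM_l (cPs j jN) _; exact: (chiD _).1.
  have cPrc j : (j < N)%N -> ccr (D (r g)) (fun z => Phi j a (mul z g) * chi z).
    by move=> jN; apply: ccrM_l (cPr j jN) _; exact: (chiD _).1.
  pose A1 j := rI (nu (s g)) (D (s g)) (Phi j a).
  pose B1 j := rI (nu (r g)) (D (r g)) (fun z => Phi j a (mul z g)).
  have w2a j : w2 j a = rI (nu (s g)) (D (s g)) (fun z => Phi j a z * chi z) by rewrite sg.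
  have w2h j : w2 j h = rI (nu (r g)) (D (r g)) (fun z => Phi j a (mul z g) * chi z).
    rewrite /w2 -rg; apply: rI_eq => z Dz; congr (phi j _ * _).
    by rewrite -gmulA// ?ga.
  have A0 j : (j < N)%N -> 0 <= A1 j - w2 j a.
    move=> jN; rewrite w2a subr_ge0; apply: (rI_le hG (@clD (s g)) fms) => [||z _]; [exact: cPsc|exact: cPs|].
    by apply: ler_piMr; [exact: phi0|have /andP[] := chi01 z].
  have B0 j : (j < N)%N -> 0 <= B1 j - w2 j h.
    move=> jN; rewrite w2h subr_ge0; apply: (rI_le hG (@clD (r g)) fmrg) => [||z _]; [exact: cPrc|exact: cPr|].
    by apply: ler_piMr; [exact: phi0|have /andP[] := chi01 z].
  have sA : \sum_(j < N) (A1 j - w2 j a) <= e.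
    rewrite sumrB sumw2 -sg /A1 -(rI_sum hG (@clD (s g)) fms (u := fun j => Phi j a))//.
    apply: tail => //; [exact: gunits_src|by rewrite sg; exact: cS1|move=> z _].
    by apply/andP; split; [apply: sumr_ge0 => j _; exact: phi0|exact: phi1].
  have sB : \sum_(j < N) (B1 j - w2 j h) <= e.
    have -> : \sum_(j < N) (B1 j - w2 j h) = rI (nu (r g)) (D (r g)) (fun z => \sum_(j < N) Phi j a (mul z g)) -
        rI (nu (r g)) (D (r g)) (fun z => (\sum_(j < N) Phi j a (mul z g)) * chi z).
      rewrite sumrB (rI_sum hG (@clD (r g)) fmrg (u := fun j z => Phi j a (mul z g)))//; congr (_ - _).
      transitivity (rI (nu (r g)) (D (r g)) (fun z => \sum_(j < N) Phi j a (mul z g) * chi z)).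
        rewrite (rI_sum hG (@clD (r g)) fmrg (u := fun j z => Phi j a (mul z g) * chi z))//.
        by apply: eq_bigr => j _; exact: w2h.
      by apply: rI_eq => z _; rewrite mulr_suml.
    apply: tail => //; [exact: gunits_rng| |move=> z _].
      by apply: (@ccr_sum _ _ (D (r g)) N (fun j z => Phi j a (mul z g))) => j jN; exact: cPr.
    by apply/andP; split; [apply: sumr_ge0 => j _; exact: phi0|exact: phi1].
  (* Testing against a signed sum of the [Phi j a] bounds the sum of all absolute differences at
     once, whatever [N] is. *)
  pose sg_ j : R := if B1 j <= A1 j then 1 else -1.
  have sgE j : `|A1 j - B1 j| = sg_ j * (A1 j - B1 j).
    rewrite /sg_; case: leP => BA; first by rewrite mul1r ger0_norm// subr_ge0.
    by rewrite mulN1r ltr0_norm// subr_lt0.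
  have sg1 j : `|sg_ j| = 1 by rewrite /sg_; case: ifP; rewrite ?normrN normr1.
  have sAB : \sum_(j < N) `|A1 j - B1 j| <= e.
    have cPsi : ccr (D (s g)) (fun z => \sum_(j < N) sg_ j * Phi j a z).
      by apply: (@ccr_sum _ _ (D (s g)) N (fun j z => sg_ j * Phi j a z)) => j jN; apply: ccrZ; exact: cPs.
    have Psi1 z : D (s g) z -> `|\sum_(j < N) sg_ j * Phi j a z| <= 1.
      move=> _; apply: le_trans (ler_norm_sum _ _ _) (le_trans _ (phi1 (mul z a))).
      by apply: ler_sum => j _; rewrite normrM sg1 mul1r ger0_norm// phi0.
    have := chivar g _ Lha cPsi Psi1.
    rewrite (rI_sum hG (@clD (s g)) fms (u := fun j z => sg_ j * Phi j a z)); last first.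
      by move=> j jN; apply: ccrZ; exact: cPs.
    rewrite (rI_sum hG (@clD (r g)) fmrg (u := fun j z => sg_ j * Phi j a (mul z g))); last first.
      by move=> j jN; apply: ccrZ; exact: cPr.
    rewrite -sumrB => /(le_trans (ler_norm _)); apply: le_trans.
    apply: ler_sum => j _; rewrite sgE mulrBr.
    by rewrite (rIZ hG (@clD (s g)) fms)// ?(rIZ hG (@clD (r g)) fmrg)//; [exact: cPr|exact: cPs].
  apply: (@le_trans _ _ (\sum_(j < N) (`|A1 j - B1 j| + (A1 j - w2 j a) + (B1 j - w2 j h)))).
    apply: ler_sum => j _; have := A0 j (ltn_ord j); have := B0 j (ltn_ord j).
    have -> : w2 j a - w2 j h = (A1 j - B1 j) - (A1 j - w2 j a) + (B1 j - w2 j h) by ring.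
    move=> b0 a0; apply: le_trans (ler_normD _ _) _; rewrite [X in _ + X <= _]ger0_norm// lerD2r.
    by apply: le_trans (ler_normB _ _) _; rewrite [X in _ + X <= _]ger0_norm.
  rewrite big_split big_split /=; apply: le_trans (lerD (lerD sAB sA) sB) _; lra.
move=> j h a jN Dh Da; rewrite !sqrtr_eq0 -!ltNge => wh wa.
have HN k : 0 < w2 j k -> exists z, [/\ s z = r k, S z & phi j (mul z k) != 0].
  move=> wk; apply: contrapT => nex.
  suff : w2 j k = 0 by move: wk => /[swap] ->; rewrite ltxx.
  rewrite /w2 -[RHS](rI0 (nu (r k)) (D (r k))); apply: rI_eq => z Dz.
  have [->|/(chiS _ Logic.I) Sz] := eqVneq (chi z) 0; first by rewrite mulr0.
  have [pz|pz] := eqVneq (Phi j k z) 0; first by rewrite pz mul0r.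
  by exfalso; apply: nex; exists z.
have [z [zh Sz pz]] := HN h wh; have [y [ya Sy py]] := HN a wa.
have Vv : V (mul (mul z h) (inv (mul y a))).
  by apply: (phiV j) => //; rewrite /gfiber /= gsrc_mul.
have hzr : r (mul h (inv a)) = s z by rewrite grng_mulV ?Dh ?Da.
exists (mul (inv z) (mul (mul z h) (inv (mul y a)))), y.
have sza : s (mul z h) = s (mul y a) by rewrite !gsrc_mul// Dh Da.
have sv : s (mul (mul z h) (inv (mul y a))) = r y by rewrite gsrc_mulV// grng_mul.
have rv : s (inv z) = r (mul (mul z h) (inv (mul y a))) by rewrite gsrc_inv grng_mulV// grng_mul.
split => //.
- by exists (inv z), (mul (mul z h) (inv (mul y a))); split.
- by rewrite gsrc_mul.
rewrite -gmulA// ginvM// -gmulA ?gsrc_mul ?grng_mul ?gsrc_inv ?grng_inv ?Dh ?Da//.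
rewrite gmulgVK ?gsrc_inv// -gmulA ?grng_inv ?Dh ?Da//.
by rewrite gmulA ?gsrc_inv// gmulVg -hzr gmul_rng.
Qed.

End localization_weights.

(** * Localization of almost-kernel vectors *)

Section commutators.
Context (R : realType) (G : ptopologicalType) (Gam : groupoid G).
Hypothesis lcG : locally_compact_groupoid Gam.
Context (mu : G -> {measure set (borel G) -> \bar R}).
Hypothesis haar_mu : haar_system Gam mu.
Context (A : reduced_cstar Gam mu).
Local Notation inv := (ginv Gam).
Local Notation mul := (gmul Gam).
Local Notation D := (gfiber Gam).
Local Notation conv := (convolution Gam mu).
Local Notation emb := (rcs_emb A).
Local Notation N2 := (N2 Gam mu).
Let hG := lcg_hausdorff lcG.
Let clD x : closed (D x). Proof. exact: closed_gfiber. Qed.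
Implicit Types (f g : G -> R[i]).

Definition modulus f : G -> R[i] := fun z => (cmod (f z))%:C%C.

Lemma ccs_modulus E f : ccs E f -> ccs E (modulus f).
Proof. by move=> /ccs_cmod/ccs_real. Qed.

(** The sum over j is taken under the integral, so only $\sum_j(w_j(a)-w_j(h))^2$ matters and not
    the number of weights. *)
Lemma commutator_pointwise x f g N (w : nat -> G -> R) (k : R) h :
  gunits Gam x -> ccs setT f -> ccs (D x) g ->
  (forall j, (j < N)%N -> cont_on (D x) (w j)) ->
  (forall a, D x a -> f (mul h (inv a)) != 0 -> \sum_(j < N) (w j a - w j h) ^+ 2 <= k) ->
  0 <= k -> D x h ->
  \sum_(j < N) cmod (conv f (fun a => (w j a)%:C%C * g a) h - (w j h)%:C%C * conv f g h) ^+ 2 <=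
  k * cmod (conv (modulus f) (modulus g) h) ^+ 2.
Proof.
move=> ux cf cg cw wk k0 Dh; have fm := haar_fin haar_mu ux.
pose F a := f (mul h (inv a)) * g a.
have cF : ccs (D x) F by exact: ccs_kernel.
pose P a := cmod (F a); have cP : ccr (D x) P by exact: ccs_cmod.
pose I := rI (mu x) (D x).
have I0 : 0 <= I P by apply: rI_ge0 => a _; exact: cmod_nneg.
have -> : conv (modulus f) (modulus g) h = (I P)%:C%C.
  rewrite (conv_fiberE _ _ _ Dh) -cI_real; apply: cI_eq => a _.
  by rewrite /modulus -rmorphM -cmodM.
rewrite cmod_real (ger0_norm I0).
have cwk j : (j < N)%N -> cont_on (D x) (fun a => w j a - w j h).
  by move=> jN; apply: cont_onB; [exact: cw|exact: cont_on_cst].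
have cPw j : (j < N)%N -> ccr (D x) (fun a => P a * (w j a - w j h) ^+ 2).
  by move=> jN; apply: ccrM_l => //; apply: cont_on_sqr; exact: cwk.
have cFw j : (j < N)%N -> ccs (D x) (fun a => F a * (w j a - w j h)%:C%C).
  by move=> jN; apply: ccsM_l => //; apply: cont_onC_real; exact: cwk.
(* Cauchy-Schwarz with respect to the weight |f(h a^-1) g(a)| *)
have step j : (j < N)%N ->
    cmod (conv f (fun a => (w j a)%:C%C * g a) h - (w j h)%:C%C * conv f g h) ^+ 2 <=
    I P * I (fun a => P a * (w j a - w j h) ^+ 2).
  move=> jN; have cwg : ccs (D x) (fun a => (w j a)%:C%C * g a).
    by apply: ccsM_r => //; apply: cont_onC_real; exact: cw.
  rewrite !(conv_fiberE _ _ _ Dh) -(cIZ hG (@clD x) fm)// -(cIB hG (@clD x) fm)//; first last.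
  - exact: ccsZ.
  - exact: ccs_kernel.
  rewrite (@cI_eq _ _ _ _ _ (fun a => F a * (w j a - w j h)%:C%C)); last first.
    by move=> a _; rewrite /F rmorphB /=; ring.
  apply: le_trans (_ : I (fun a => cmod (F a * (w j a - w j h)%:C%C)) ^+ 2 <= _).
    rewrite ler_sqr ?nnegrE ?cmod_nneg//; first exact: (cmod_cI_le hG (@clD x) fm (cFw j jN)).
    by apply: rI_ge0 => a _; exact: cmod_nneg.
  apply: (rI_cauchy_schwarz hG (@clD x) fm) => //; [exact: cPw|exact/ccs_cmod/cFw| | |].
  - by move=> a _; exact: cmod_nneg.
  - by move=> a _; apply: mulr_ge0; [exact: cmod_nneg|exact: sqr_ge0].
  - move=> a _; rewrite cmodM cmod_real exprMn real_normK ?num_real//.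
    by rewrite /P mulrA -expr2.
apply: le_trans (_ : \sum_(j < N) I P * I (fun a => P a * (w j a - w j h) ^+ 2) <= _).
  by apply: ler_sum => j _; exact: step.
rewrite -mulr_sumr expr2 mulrCA; apply: ler_wpM2l => //.
rewrite -(rI_sum hG (@clD x) fm (u := fun j a => P a * (w j a - w j h) ^+ 2))//.
rewrite -(rIZ hG (@clD x) fm)//; apply: (rI_le hG (@clD x) fm).
- exact: (@ccr_sum _ _ (D x) N (fun j a => P a * (w j a - w j h) ^+ 2)).
- exact: ccrZ.
move=> a Da; rewrite -mulr_sumr mulrC.
have [f0|f0] := eqVneq (f (mul h (inv a))) 0.
  by rewrite /P /F f0 mul0r cmod0 !mulr0.
by apply: ler_wpM2r; [exact: cmod_nneg|exact: wk].
Qed.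

(** Write $w_jg+f*(w_jg)$ as $w_j(g+f*g)$ plus a commutator and use $(p+q)^2\le 2p^2+2q^2$. The
    commutators are dominated by the convolution of |f| with |g|, hence the norm of [modulus f] on
    the right. *)
Lemma commutator_bound x f g N (w : nat -> G -> R) (k : R) :
  gunits Gam x -> ccs setT f -> ccs (D x) g ->
  (forall j, (j < N)%N -> cont_on (D x) (w j)) ->
  (forall h, D x h -> \sum_(j < N) w j h ^+ 2 <= 1) ->
  (forall h a, D x h -> D x a -> f (mul h (inv a)) != 0 ->
     \sum_(j < N) (w j a - w j h) ^+ 2 <= k) -> 0 <= k ->
  \sum_(j < N) N2 x (fun h => (w j h)%:C%C * g h + conv f (fun a => (w j a)%:C%C * g a) h) <=
  2 * N2 x (fun h => g h + conv f g h) + 2 * k * nm (emb (modulus f)) ^+ 2 * N2 x g.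
Proof.
move=> ux cf cg cw w1 wk k0; have fm := haar_fin haar_mu ux.
have cmf := ccs_modulus cf; have cmg := ccs_modulus cg.
have cfg := ccs_conv lcG haar_mu ux cf cg.
have cu : ccs (D x) (fun h => g h + conv f g h) by exact: ccsD.
have cmm := ccs_conv lcG haar_mu ux cmf cmg.
have cgj j : (j < N)%N -> ccs (D x) (fun a => (w j a)%:C%C * g a).
  by move=> jN; apply: ccsM_r => //; apply: cont_onC_real; exact: cw.
have cuj j : (j < N)%N ->
    ccs (D x) (fun h => (w j h)%:C%C * g h + conv f (fun a => (w j a)%:C%C * g a) h).
  by move=> jN; apply: ccsD; [exact: cgj|apply: (ccs_conv lcG haar_mu) => //; exact: cgj].
rewrite -(rI_sum hG (@clD x) fm (u := fun j h =>
   cmod ((w j h)%:C%C * g h + conv f (fun a => (w j a)%:C%C * g a) h) ^+ 2)); last first.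
  by move=> j jN; apply: ccs_cmod2; exact: cuj.
have Ng : N2 x g = N2 x (modulus g).
  by apply: rI_eq => h _; rewrite cmod_real ger0_norm// cmod_nneg.
apply: le_trans (_ : 2 * N2 x (fun h => g h + conv f g h) +
    2 * k * N2 x (conv (modulus f) (modulus g)) <= _); last first.
  rewrite lerD2l -[leRHS]mulrA; apply: ler_wpM2l; first by rewrite mulr_ge0.
  by rewrite Ng; exact: (N2_conv lcG haar_mu A).
have c1 := ccrZ 2 (ccs_cmod2 cu); have c2 := ccrZ (2 * k) (ccs_cmod2 cmm).
rewrite -!(rIZ hG (@clD x) fm); [|exact: ccs_cmod2..].
rewrite -(rID hG (@clD x) fm)//; apply: (rI_le hG (@clD x) fm).
- apply: (@ccr_sum _ _ (D x) N (fun j h =>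
   cmod ((w j h)%:C%C * g h + conv f (fun a => (w j a)%:C%C * g a) h) ^+ 2)) => j jN.
  by apply: ccs_cmod2; exact: cuj.
- exact: ccrD.
move=> h Dh.
have H := commutator_pointwise ux cf cg cw (fun a Da => wk h a Dh Da) k0 Dh.
set u := g h + conv f g h.
apply: (@le_trans _ _ (\sum_(j < N) (2 * cmod u ^+ 2 * w j h ^+ 2 +
   2 * cmod (conv f (fun a => (w j a)%:C%C * g a) h - (w j h)%:C%C * conv f g h) ^+ 2))).
  apply: ler_sum => j _.
  set v := conv f (fun a => _) h.
  have -> : (w j h)%:C%C * g h + v = (w j h)%:C%C * u + (v - (w j h)%:C%C * conv f g h).
    by rewrite /u; ring.
  set z := v - _.
  have sq (p q m : R) : 0 <= m -> m <= p + q -> m ^+ 2 <= 2 * p ^+ 2 + 2 * q ^+ 2.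
    move=> m0 mpq; have : m ^+ 2 <= (p + q) ^+ 2 by rewrite ler_sqr ?nnegrE//; exact: le_trans mpq.
    by have := sqr_ge0 (p - q); rewrite sqrrB sqrrD; lra.
  have := sq _ _ _ (cmod_nneg _) (cmodD ((w j h)%:C%C * u) z).
  by rewrite cmodM cmod_real exprMn real_normK ?num_real// [w j h ^+ 2 * _]mulrC mulrA.
rewrite big_split /= -!mulr_sumr; apply: lerD.
  by apply: ler_piMr; [rewrite mulr_ge0// sqr_ge0|exact: w1].
by rewrite -mulrA; apply: ler_wpM2l.
Qed.

(** At [h] with [g h] nonzero, either some f(h a^-1) is nonzero and the weights keep at least half
    of $|g(h)|^2$, or $f*g$ vanishes at [h] and $|g(h)|^2$ is counted by the last term. *)
Lemma localization_mass x f g N (w : nat -> G -> R) :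
  gunits Gam x -> ccs setT f -> ccs (D x) g ->
  (forall j, (j < N)%N -> cont_on (D x) (w j)) ->
  (forall h a, D x h -> D x a -> f (mul h (inv a)) != 0 -> g h != 0 ->
     1 / 2 <= \sum_(j < N) w j h ^+ 2) ->
  N2 x g <= 2 * \sum_(j < N) N2 x (fun h => (w j h)%:C%C * g h) + N2 x (fun h => g h + conv f g h).
Proof.
move=> ux cf cg cw w2; have fm := haar_fin haar_mu ux.
have cfg := ccs_conv lcG haar_mu ux cf cg.
have cu : ccs (D x) (fun h => g h + conv f g h) by exact: ccsD.
have cgj j : (j < N)%N -> ccr (D x) (fun h => cmod ((w j h)%:C%C * g h) ^+ 2).
  by move=> jN; apply: ccs_cmod2; apply: ccsM_r => //; apply: cont_onC_real; exact: cw.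
rewrite -(rI_sum hG (@clD x) fm (u := fun j h => cmod ((w j h)%:C%C * g h) ^+ 2))//.
have cs := @ccr_sum _ _ (D x) N (fun j h => cmod ((w j h)%:C%C * g h) ^+ 2) cgj.
rewrite -(rIZ hG (@clD x) fm)// -(rID hG (@clD x) fm)//; [|exact: ccrZ|exact: ccs_cmod2].
apply: (rI_le hG (@clD x) fm); [exact: ccs_cmod2|by apply: ccrD; [exact: ccrZ|exact: ccs_cmod2]|].
move=> h Dh.
have -> : \sum_(j < N) cmod ((w j h)%:C%C * g h) ^+ 2 = (\sum_(j < N) w j h ^+ 2) * cmod (g h) ^+ 2.
  rewrite mulr_suml; apply: eq_bigr => j _.
  by rewrite cmodM cmod_real exprMn real_normK ?num_real.
have S0 : 0 <= \sum_(j < N) w j h ^+ 2 by apply: sumr_ge0 => j _; exact: sqr_ge0.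
have [g0|gh] := eqVneq (g h) 0.
  rewrite [in leLHS]g0 cmod0 expr0n; apply: addr_ge0; last exact: sqr_ge0.
  by apply: mulr_ge0 => //; apply: mulr_ge0 => //; exact: sqr_ge0.
have [[a [Da fa]]|nex] := pselect (exists a, D x a /\ f (mul h (inv a)) != 0).
  have := ler_wpM2r (sqr_ge0 (cmod (g h))) (w2 h a Dh Da fa gh).
  have := sqr_ge0 (cmod (g h + conv f g h)).
  set p := \sum_(_ < _) _; set q := cmod (g h) ^+ 2; set t := cmod _ ^+ 2.
  by rewrite [2 * (p * q)]mulrC -mulrA; move: (p * q) => pq; lra.
have -> : conv f g h = 0.
  rewrite (conv_fiberE _ _ _ Dh) (@cI_eq _ _ _ _ _ (fun a => (0 : R)%:C%C)).
    by rewrite cI_real rI0.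
  move=> a Da; have [->|fa] := eqVneq (f (mul h (inv a))) 0; first by rewrite mul0r.
  by exfalso; apply: nex; exists a.
rewrite addr0 lerDr; apply: mulr_ge0 => //; apply: mulr_ge0 => //; exact: sqr_ge0.
Qed.

End commutators.

Lemma weighted_pigeonhole (R : realType) N (p q : nat -> R) (c : R) :
  (forall j, 0 <= p j) -> (forall j, 0 <= q j) ->
  0 < \sum_(j < N) p j -> \sum_(j < N) q j <= c * \sum_(j < N) p j ->
  exists j, [/\ (j < N)%N, 0 < p j & q j <= c * p j].
Proof.
move=> p0 q0 sp sq; apply: contrapT => nex.
have H (j : 'I_N) : 0 < p j -> 0 < q j - c * p j.
  by move=> pj; rewrite subr_gt0 ltNge; apply/negP => qj; apply: nex; exists j.
have H0 (j : 'I_N) : true -> 0 <= q j - c * p j.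
  move=> _; have := p0 j; rewrite le_eqVlt => /orP[/eqP <-|/H/ltW//].
  by rewrite mulr0 subr0.
have S0 : \sum_(j < N) (q j - c * p j) = 0.
  apply/eqP; rewrite eq_le sumr_ge0 ?andbT; last by move=> j _; exact: H0.
  by rewrite sumrB -mulr_sumr subr_le0.
have Z := psumr_eq0P H0 S0.
suff : \sum_(j < N) p j <= 0 by rewrite leNgt sp.
apply: sumr_le0 => j _; rewrite leNgt; apply/negP => /H.
by rewrite Z// ltxx.
Qed.

Section localization.
Context (R : realType) (G : ptopologicalType) (Gam : groupoid G).
Hypothesis lcG : locally_compact_groupoid Gam.
Context (mu : G -> {measure set (borel G) -> \bar R}).
Hypothesis haar_mu : haar_system Gam mu.
Hypothesis amG : topologically_amenable R Gam.
Context (A : reduced_cstar Gam mu).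
Local Notation inv := (ginv Gam).
Local Notation mul := (gmul Gam).
Local Notation D := (gfiber Gam).
Local Notation conv := (convolution Gam mu).
Local Notation cls := (cls Gam mu).
Local Notation lam := (rcs_lambda A).
Local Notation emb := (rcs_emb A).
Local Notation N2 := (N2 Gam mu).

Lemma id_plus_perturb x (a b : A) (v : L2 (mu x)) : gunits Gam x ->
  nm (v + lam x a v) <= nm (v + lam x b v) + nm (a - b) * nm v.
Proof.
move=> ux.
have -> : v + lam x a v = (v + lam x b v) + lam x (a - b) v.
  by rewrite (lin_sub (lam_linl _ ux)) -addrA [lam x b v + _]addrCA subrr addr0.
by apply: le_trans (nmD _ _) _; rewrite lerD2l; exact: lam_nm.
Qed.

Lemma id_plus_cls x f g : gunits Gam x -> ccs setT f -> ccs (D x) g ->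
  nm (cls x g + lam x (emb f) (cls x g)) ^+ 2 = N2 x (fun h => g h + conv f g h).
Proof.
move=> ux cf cg; have cfg := ccs_conv lcG haar_mu ux cf cg.
by rewrite lam_cls// -(clsD lcG haar_mu ux)// (nm_cls_sqr lcG haar_mu ux)//; exact: ccsD.
Qed.

(** [e1] and [K'] depend on [a] and [d] only, which is what makes the step iterable. The weights
    keep at least a quarter of the squared norm, and the squared residues for [f] add up to at most
    $(d/2)^2$ times the part kept; by [weighted_pigeonhole] a single weight has this ratio. *)
Lemma localization (a : A) (d : R) : 0 < d -> exists (e1 : R) (K' : set G),
  [/\ 0 < e1, compact K' & forall x g, gunits Gam x -> ccs (D x) g ->
    0 < nm (cls x g) -> nm (cls x g + lam x a (cls x g)) <= e1 * nm (cls x g) ->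
    exists g', [/\ ccs (D x) g', 0 < nm (cls x g'),
      nm (cls x g' + lam x a (cls x g')) <= d * nm (cls x g'),
      forall h, g' h != 0 -> g h != 0 &
      forall h k, D x h -> D x k -> g' h != 0 -> g' k != 0 -> K' (mul h (inv k))]].
Proof.
(* Both [a] to [f] and the hypothesis on [g] cost [eta]. So the squared residue for [f] is at most
   $4\eta^2\le\min(d^2/64,1/4)$ times the squared norm. *)
move=> d0; pose eta := Num.min (d / 16) (1 / 4).
have eta0 : 0 < eta by rewrite lt_min !divr_gt0.
have etad : eta <= d / 16 by rewrite ge_min lexx.
have eta4 : eta <= 1 / 4 by rewrite ge_min lexx orbT.
have [f cf af] := emb_dense a eta0.
have [_ [L cL fL]] := cf.
pose M := nm (emb (modulus f)) ^+ 2 + 1.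
have M0 : 0 < M by rewrite ltr_wpDl// sqr_ge0.
(* [1 / 2] guarantees half of the mass; the other entry makes the commutator term at most $d^2/32$
   times the squared norm. The [+ 1] in [M] keeps the quotient defined. *)
pose e := Num.min (1 / 2) (d ^+ 2 / (192 * M)).
have e0 : 0 < e by rewrite lt_min !divr_gt0// ?exprn_gt0// mulr_gt0.
have e2 : e <= 1 / 2 by rewrite ge_min lexx.
have eM : 6 * e * nm (emb (modulus f)) ^+ 2 <= d ^+ 2 / 32.
  apply: le_trans (_ : 6 * e * M <= _).
    by apply: ler_wpM2l; [rewrite mulr_ge0// ltW|rewrite lerDl].
  have : e <= d ^+ 2 / (192 * M) by rewrite ge_min lexx orbT.
  rewrite ler_pdivlMr ?mulr_gt0// => H; rewrite ler_pdivlMr//.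
  by apply: le_trans H; rewrite le_eqVlt; apply/orP; left; apply/eqP; ring.
have [K' cK' HK] := localization_weights lcG amG cL e0.
exists eta, K'; split => // x g ux cg g0 Tg.
have [_ [Kg cKg gK]] := cg.
have [N [w [cw w1 wmass wvar wK]]] := HK x Kg ux cKg.
pose gj j h := (w j h)%:C%C * g h.
have cgj j : (j < N)%N -> ccs (D x) (gj j).
  by move=> jN; apply: ccsM_r => //; apply: cont_onC_real; exact: cw.
have comm := commutator_bound lcG haar_mu A ux cf cg cw w1
  (fun h b Dh Db fhb => wvar h b Dh Db (fL _ Logic.I fhb)).
have mass := localization_mass lcG haar_mu ux cf cg cw.
have {}comm := comm (mulr_ge0 (ler0n R 3) (ltW e0)).
have {}mass : N2 x g <= 2 * \sum_(j < N) N2 x (gj j) + N2 x (fun h => g h + conv f g h).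
  apply: mass => h b Dh Db fhb gh.
  have := wmass h (mul h (inv b)) Dh (gK _ Dh gh) (fL _ Logic.I fhb).
  by rewrite grng_mulV ?Dh ?Db// => /(_ erefl); apply: le_trans; lra.
set n2 := N2 x g in comm mass.
have n2E : nm (cls x g) ^+ 2 = n2 by rewrite (nm_cls_sqr lcG haar_mu ux).
have n20 : 0 < n2 by rewrite -n2E exprn_gt0.
have af' : nm (emb f - a) <= eta by rewrite nm_distC ltW.
have Tf : N2 x (fun h => g h + conv f g h) <= (2 * eta) ^+ 2 * n2.
  rewrite -(id_plus_cls ux cf cg) -n2E -exprMn ler_sqr ?nnegrE ?nm_ge0//; last first.
    by rewrite !mulr_ge0 ?nm_ge0// ltW.
  apply: le_trans (id_plus_perturb (emb f) a _ ux) _.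
  rewrite [2 * eta]mulrC mulrDr mulr1 mulrDl; apply: lerD => //.
  by apply: ler_wpM2r => //; exact: nm_ge0.
set u2 := N2 x (fun h => g h + conv f g h) in comm mass Tf.
have eta2 : (2 * eta) ^+ 2 <= 1 / 4.
  have -> : 1 / 4 = (1 / 2) ^+ 2 :> R by field.
  by rewrite ler_sqr ?nnegrE; lra.
have etad2 : (2 * eta) ^+ 2 <= d ^+ 2 / 64.
  have -> : d ^+ 2 / 64 = (d / 8) ^+ 2 :> R by field.
  by rewrite ler_sqr ?nnegrE; lra.
set S := \sum_(j < N) N2 x (gj j) in mass.
have u2a : u2 <= 1 / 4 * n2 by apply: le_trans Tf _; apply: ler_wpM2r => //; exact: ltW.
have u2b : u2 <= d ^+ 2 / 64 * n2 by apply: le_trans Tf _; apply: ler_wpM2r => //; exact: ltW.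
have Sn : n2 <= 4 * S by lra.
have S0 : 0 < S by lra.
have TS : \sum_(j < N) N2 x (fun h => gj j h + conv f (gj j) h) <= (d / 2) ^+ 2 * S.
  apply: le_trans comm _.
  have -> : 2 * (3 * e) * nm (emb (modulus f)) ^+ 2 = 6 * e * nm (emb (modulus f)) ^+ 2 by ring.
  have B := ler_wpM2r (ltW n20) eM.
  have C : d ^+ 2 / 16 * n2 <= (d / 2) ^+ 2 * S.
    have -> : (d / 2) ^+ 2 * S = d ^+ 2 / 16 * (4 * S) by field.
    by apply: ler_wpM2l => //; rewrite divr_ge0// sqr_ge0.
  by apply: le_trans C; rewrite -[X in 2 * X]/u2; move: B u2b; lra.
have [j [jN pj qj]] := weighted_pigeonhole (fun j => N2_ge0 Gam mu x (gj j))
  (fun j => N2_ge0 Gam mu x (fun h => gj j h + conv f (gj j) h)) S0 TS.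
exists (gj j).
have nE : nm (cls x (gj j)) ^+ 2 = N2 x (gj j) by rewrite (nm_cls_sqr lcG haar_mu ux)//; exact: cgj.
split.
- exact: cgj.
- by rewrite lt_neqAle nm_ge0 andbT eq_sym -sqrf_eq0 nE gt_eqF.
- apply: le_trans (id_plus_perturb a (emb f) _ ux) _.
  have T1 : nm (cls x (gj j) + lam x (emb f) (cls x (gj j))) <= d / 2 * nm (cls x (gj j)).
    rewrite -ler_sqr ?nnegrE ?nm_ge0//; last by rewrite mulr_ge0 ?nm_ge0// divr_ge0// ltW.
    by rewrite exprMn (id_plus_cls ux cf (cgj j jN)) nE.
  have T2 : nm (a - emb f) * nm (cls x (gj j)) <= d / 2 * nm (cls x (gj j)).
    by apply: ler_wpM2r; [exact: nm_ge0|move: af etad d0; lra].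
  by apply: le_trans (lerD T1 T2) _; rewrite -mulrDl -splitr.
- by move=> h; rewrite mulf_eq0 negb_or => /andP[].
- move=> h k Dh Dk; rewrite !mulf_eq0 !negb_or => /andP[wh _] /andP[wk _].
  have W t : (w j t)%:C%C != 0 :> R[i] -> w j t != 0.
    by apply: contra => /eqP ->.
  by apply: (wK j) => //; exact: W.
Qed.

End localization.

(** * The uniform lower bound *)

Section uniform_approximation.
Context (R : realType) (G : ptopologicalType) (Gam : groupoid G).
Hypothesis lcG : locally_compact_groupoid Gam.
Context (mu : G -> {measure set (borel G) -> \bar R}).
Hypothesis haar_mu : haar_system Gam mu.
Local Notation inv := (ginv Gam).
Local Notation mul := (gmul Gam).
Local Notation D := (gfiber Gam).
Local Notation conv := (convolution Gam mu).
Local Notation cls := (cls Gam mu).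
Local Notation N2 := (N2 Gam mu).
Let hG := lcg_hausdorff lcG.
Let lG := lcg_locally_compact lcG.
Let clD x : closed (D x). Proof. exact: closed_gfiber. Qed.

Lemma nm_cls_le x g (B : R) : gunits Gam x -> ccs (D x) g -> 0 <= B ->
  (nm (cls x g) <= B) = (N2 x g <= B ^+ 2).
Proof.
by move=> ux cg B0; rewrite -(nm_cls_sqr lcG haar_mu ux cg) ler_sqr ?nnegrE ?nm_ge0.
Qed.

Lemma nm_cls_bounded (p : G -> R[i]) : ccs setT p ->
  exists2 B : R, 0 <= B & forall x, gunits Gam x -> nm (cls x p) <= B.
Proof.
move=> cp; have [B B0 HB] := family_bound lcG (haar_family lcG haar_mu) (ccs_cmod2 cp).
exists (Num.sqrt B); first exact: sqrtr_ge0.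
move=> x ux; rewrite nm_cls_le ?sqrtr_ge0//; last exact: ccs_sub cp.
by rewrite sqr_sqrtr//; apply: le_trans (HB x ux); exact: ler_norm.
Qed.

Lemma fiber_pairing_bounded (q : G -> R[i]) : ccs setT q ->
  exists2 B : R, 0 <= B & forall x h, gunits Gam x -> ccs (D x) h ->
    rI (mu x) (D x) (fun a => cmod (q a * h a)) <= B * nm (cls x h).
Proof.
move=> cq; have [B B0 HB] := nm_cls_bounded cq; exists B => // x h ux ch.
have fm := haar_fin haar_mu ux; have cqx : ccs (D x) q by exact: ccs_sub cq.
apply: le_trans (_ : nm (cls x q) * nm (cls x h) <= _); last first.
  by apply: ler_wpM2r; [exact: nm_ge0|exact: HB].
rewrite -ler_sqr ?nnegrE ?mulr_ge0 ?nm_ge0//; last first.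
  by apply: rI_ge0 => a _; exact: cmod_nneg.
rewrite exprMn !(nm_cls_sqr lcG haar_mu ux)//.
apply: (rI_cauchy_schwarz hG (@clD x) fm).
- exact: ccs_cmod2.
- exact: ccs_cmod2.
- exact: (ccs_cmod (ccsM_l cqx ch.1)).
- by move=> a _; exact: sqr_ge0.
- by move=> a _; exact: sqr_ge0.
- by move=> a _; rewrite cmodM exprMn.
Qed.

(** Cauchy-Schwarz against a cutoff equal to 1 on [K], whose fiber norms are bounded over all
    units. *)
Lemma fiber_mean_bounded (K : set G) : compact K ->
  exists2 B : R, 0 <= B & forall x h, gunits Gam x -> ccs (D x) h ->
    (forall z, D x z -> h z != 0 -> K z) ->
    rI (mu x) (D x) (fun a => cmod (h a)) <= B * nm (cls x h).
Proof.
move=> cK; have [chi [cchi chi01 chi1]] := exists_cutoff R lG hG cK.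
have [B B0 HB] := fiber_pairing_bounded (ccs_real cchi).
exists B => // x h ux ch hK; apply: le_trans (HB x h ux ch).
rewrite le_eqVlt; apply/orP; left; apply/eqP; apply: rI_eq => a Da.
have [->|ha] := eqVneq (h a) 0; first by rewrite mulr0.
by rewrite chi1 ?mul1r//; exact: hK.
Qed.

(** The same [p i] and [q i] serve all fibers, which makes vectors over different units comparable.
    The pointwise error is at most [e'] times the L^1 norm of [h], itself at most [BK] times its L^2
    norm; being supported in [L], the error gains only the factor [Num.sqrt BL] in L^2. *)
Lemma finite_rank_convolution (f : G -> R[i]) (K : set G) (e : R) :
  ccs setT f -> compact K -> 0 < e ->
  exists n (p q : nat -> G -> R[i]), (forall i, ccs setT (p i) /\ ccs setT (q i)) /\
    forall x h, gunits Gam x -> ccs (D x) h -> (forall z, D x z -> h z != 0 -> K z) ->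
    nm (cls x (fun g => conv f h g -
      \sum_(i < n) p i g * cI (mu x) (D x) (fun a => q i a * h a))) <= e * nm (cls x h).
Proof.
move=> cf cK e0; have [L [cL fL Happ]] := kernel_approx lcG cf cK.
have [chi [cchi chi01 chi1]] := exists_cutoff R lG hG cL.
have [BL BL0 HBL] := family_bound lcG (haar_family lcG haar_mu) cchi.
have [BK BK0 HBK] := fiber_mean_bounded cK.
pose C := BK * Num.sqrt BL + 1.
have C0 : 0 < C by rewrite ltr_wpDl// mulr_ge0// sqrtr_ge0.
pose e' := e / C; have e'0 : 0 < e' by rewrite divr_gt0.
have [n [p [q [pq pL Hpq]]]] := Happ _ e'0.
exists n, p, q; split => // x h ux ch hK.
have fm := haar_fin haar_mu ux.
set v := fun g => _.
have cv : ccs (D x) v.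
  apply: ccsB; first exact: (ccs_conv lcG haar_mu).
  apply: (@ccs_sum _ _ (D x) n (fun i g => p i g * cI (mu x) (D x) (fun a => q i a * h a))) => i _.
  apply: ccsM_l; first exact: ccs_sub (pq i).1.
  exact: cont_on_cst.
set I := rI (mu x) (D x) (fun a => cmod (h a)).
have I0 : 0 <= I by apply: rI_ge0 => a _; exact: cmod_nneg.
have vI g : D x g -> cmod (v g) <= e' * I.
  move=> Dg; rewrite /v (conv_fiberE _ _ _ Dg).
  exact: (kernel_integral_approx lcG fm cf ch hK pq Dg Hpq).
have vL g : D x g -> v g != 0 -> L g.
  move=> Dg; apply: contraNP => Lg; apply/eqP; rewrite /v big1 => [|i _]; last first.
    have [->|/pL//] := eqVneq (p i g) 0; by rewrite mul0r.
  rewrite subr0 (conv_fiberE _ _ _ Dg) (@cI_eq _ _ _ _ _ (fun a => (0 : R)%:C%C)).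
    by rewrite cI_real rI0.
  move=> a Da; have [->|ha] := eqVneq (h a) 0; first by rewrite mulr0.
  have [->|fa] := eqVneq (f (mul g (inv a))) 0; first by rewrite mul0r.
  exfalso; apply: Lg; apply: (fL g a) => //; first by rewrite Dg Da.
  exact: hK.
have H1 : nm (cls x v) <= e' * I * Num.sqrt BL.
  have B0 : 0 <= e' * I * Num.sqrt BL.
    by apply: mulr_ge0; [apply: mulr_ge0 => //; exact: ltW|exact: sqrtr_ge0].
  rewrite (nm_cls_le ux cv B0).
  rewrite exprMn sqr_sqrtr//.
  apply: le_trans (_ : (e' * I) ^+ 2 * rI (mu x) (D x) chi <= _); last first.
    apply: ler_wpM2l; first exact: sqr_ge0.
    by apply: le_trans (HBL x ux); exact: ler_norm.
  have cc : ccr (D x) chi by exact: ccr_sub cchi.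
  rewrite -(rIZ hG (@clD x) fm)//; apply: (rI_le hG (@clD x) fm); [exact: ccs_cmod2|exact: ccrZ|].
  move=> g Dg; have /andP[c0 _] := chi01 g.
  have [->|vg] := eqVneq (v g) 0.
    by rewrite cmod0 expr0n mulr_ge0// sqr_ge0.
  rewrite chi1 ?mulr1; last exact: vL.
  rewrite ler_sqr ?nnegrE ?cmod_nneg//; first exact: vI.
  by rewrite mulr_ge0// ltW.
apply: le_trans H1 _.
apply: le_trans (_ : e' * (BK * nm (cls x h)) * Num.sqrt BL <= _).
  apply: ler_wpM2r; first exact: sqrtr_ge0.
  by apply: ler_wpM2l; [exact: ltW|exact: HBK].
have -> : e' * (BK * nm (cls x h)) * Num.sqrt BL = e' * (BK * Num.sqrt BL) * nm (cls x h) by ring.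
apply: ler_wpM2r; first exact: nm_ge0.
by rewrite /e' -mulrA ler_piMr ?(ltW e0)// mulrC ler_pdivrMr// mul1r lerDl.
Qed.

End uniform_approximation.

(** * Nested localization and right translation of almost-kernel vectors *)

Section shifted_almost_kernels.
Context (R : realType) (G : ptopologicalType) (Gam : groupoid G).
Hypothesis lcG : locally_compact_groupoid Gam.
Context (mu : G -> {measure set (borel G) -> \bar R}).
Hypothesis haar_mu : haar_system Gam mu.
Context (A : reduced_cstar Gam mu).
Local Notation s := (gsrc Gam).
Local Notation r := (grng Gam).
Local Notation inv := (ginv Gam).
Local Notation mul := (gmul Gam).
Local Notation D := (gfiber Gam).
Local Notation conv := (convolution Gam mu).
Local Notation cls := (cls Gam mu).
Local Notation lam := (rcs_lambda A).
Local Notation emb := (rcs_emb A).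
Local Notation N2 := (N2 Gam mu).

Lemma N2_translate (g : G -> R[i]) t : ccs (D (s t)) g ->
  N2 (r t) (fun h => g (mul h t)) = N2 (s t) g.
Proof.
move=> cg; have cgg : ccs (D (s t)) (fun h => g h * ((g h)^*)%C).
  exact: (ccsM_l cg (ccs_conj cg).1).
by apply: complexI; rewrite !N2_cI; exact: (haar_translate lcG haar_mu cgg).
Qed.

Lemma conv_translate (f g : G -> R[i]) t z : ccs setT f -> ccs (D (s t)) g -> s z = r t ->
  conv f (fun h => g (mul h t)) z = conv f g (mul z t).
Proof.
move=> cf cg zt; have szt : s (mul z t) = s t by rewrite gsrc_mul.
rewrite (conv_fiberE _ _ _ zt) (conv_fiberE _ _ _ szt).
rewrite -(haar_translate lcG haar_mu); last exact: ccs_kernel.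
by apply: cI_eq => a Da; rewrite gmul_mulV.
Qed.

Lemma nm_cls_translate (g : G -> R[i]) t : ccs (D (s t)) g ->
  nm (cls (r t) (fun h => g (mul h t))) = nm (cls (s t) g).
Proof.
move=> cg; rewrite (nm_cls lcG haar_mu (gunits_rng Gam t)); last exact: ccs_translate.
by rewrite (nm_cls lcG haar_mu (gunits_src Gam t))// N2_translate.
Qed.

(** Right translation is isometric and commutes with left convolution, so the two norms agree for
    [f] in [Cc]; the error of approximating [a] by [f] is arbitrarily small. *)
Lemma id_plus_translate (a : A) (g : G -> R[i]) t : ccs (D (s t)) g ->
  nm (cls (r t) (fun h => g (mul h t)) + lam (r t) a (cls (r t) (fun h => g (mul h t)))) <=
  nm (cls (s t) g + lam (s t) a (cls (s t) g)).
Proof.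
move=> cg; have ur := gunits_rng Gam t; have us := gunits_src Gam t.
have cgt := ccs_translate lcG cg.
rewrite -subr_le0; apply: (@le_all_small _ _ (2 * nm (cls (s t) g))) => e e0.
have [f cf af] := emb_dense a e0.
have E : nm (cls (r t) (fun h => g (mul h t)) + lam (r t) (emb f) (cls (r t) (fun h => g (mul h t)))) =
    nm (cls (s t) g + lam (s t) (emb f) (cls (s t) g)).
  apply/eqP; rewrite -(@eqrXn2 _ 2) ?nm_ge0//; apply/eqP.
  rewrite !(id_plus_cls lcG haar_mu)// -N2_translate; last first.
    by apply: ccsD => //; exact: (ccs_conv lcG haar_mu).
  by apply: N2_eq => h Dh; rewrite conv_translate.
have H1 := id_plus_perturb a (emb f) (cls (r t) (fun h => g (mul h t))) ur.
have H2 := id_plus_perturb (emb f) a (cls (s t) g) us.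
rewrite E nm_cls_translate// in H1; rewrite nm_distC in H2.
have := ler_wpM2r (nm_ge0 (cls (s t) g)) (ltW af).
by move: H1 H2; lra.
Qed.

Lemma exists_nonzero_point x (g : G -> R[i]) : gunits Gam x -> 0 < nm (cls x g) ->
  exists2 t, D x t & g t != 0.
Proof.
move=> ux g0; apply: contrapT => nex.
have : cls x g = cls x (fun=> 0).
  apply: cls_eq => h Dh; apply/eqP; apply: contrapT => /negP gh.
  by apply: nex; exists h.
move=> E; move: g0; rewrite E (nm_cls lcG haar_mu ux); last exact: ccs0.
rewrite /N2 (@rI_eq _ _ _ _ _ (fun=> 0)) ?rI0 ?sqrtr0 ?ltxx// => h _.
by rewrite cmod0 expr0n.
Qed.

Definition localizes (a : A) (e d : R) (K : set G) := forall x g, gunits Gam x -> ccs (D x) g ->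
  0 < nm (cls x g) -> nm (cls x g + lam x a (cls x g)) <= e * nm (cls x g) ->
  exists g', [/\ ccs (D x) g', 0 < nm (cls x g'),
    nm (cls x g' + lam x a (cls x g')) <= d * nm (cls x g'),
    forall h, g' h != 0 -> g h != 0 &
    forall h k, D x h -> D x k -> g' h != 0 -> g' k != 0 -> K (mul h (inv k))].

Context (a : A) (d : nat -> R) (K : nat -> set G).
Hypothesis loc : forall k, localizes a (d k.+1) (d k) (K k).

Lemma nested_localization n x g : gunits Gam x -> ccs (D x) g -> 0 < nm (cls x g) ->
  nm (cls x g + lam x a (cls x g)) <= d n * nm (cls x g) ->
  exists (t : G) (gs : nat -> G -> R[i]), [/\ D x t, g t != 0 &
    forall j, (j < n)%N -> [/\ ccs (D x) (gs j), 0 < nm (cls x (gs j)),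
      nm (cls x (gs j) + lam x a (cls x (gs j))) <= d j * nm (cls x (gs j)), gs j t != 0 &
      forall h k, D x h -> D x k -> gs j h != 0 -> gs j k != 0 -> K j (mul h (inv k))]].
Proof.
elim: n g => [|n IH] g ux cg g0 Tg.
  by have [t Dt gt] := exists_nonzero_point ux g0; exists t, (fun=> g).
have [g' [cg' g'0 Tg' g'g g'K]] := loc ux cg g0 Tg.
have [t [gs [Dt g't Hgs]]] := IH g' ux cg' g'0 Tg'.
exists t, (fun j => if j == n then g' else gs j); split => //; first exact: g'g.
move=> j; rewrite ltnS leq_eqVlt => /orP[/eqP ->|jn]; first by rewrite eqxx.
by rewrite (ltn_eqF jn); exact: Hgs.
Qed.

(** Each [gs j] is nonzero at [t]. If its translate is nonzero at [z], then [gs j] is nonzero at z t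
    as well, so $z=(zt)t^{-1}$ lies in [K j]. *)
Lemma shifted_localization n x g : gunits Gam x -> ccs (D x) g -> 0 < nm (cls x g) ->
  nm (cls x g + lam x a (cls x g)) <= d n * nm (cls x g) ->
  exists (y : G) (hs : nat -> G -> R[i]), gunits Gam y /\
    forall j, (j < n)%N -> [/\ ccs (D y) (hs j), nm (cls y (hs j)) = 1,
      nm (cls y (hs j) + lam y a (cls y (hs j))) <= d j &
      forall z, D y z -> hs j z != 0 -> K j z].
Proof.
move=> ux cg g0 Tg; have [t [gs [Dt _ Hgs]]] := nested_localization ux cg g0 Tg.
have uy := gunits_rng Gam t.
exists (r t), (fun j h => ((nm (cls x (gs j)))^-1)%:C%C * gs j (mul h t)); split => // j jn.
have [cj j0 Tj jt jK] := Hgs j jn.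
have cj' : ccs (D (s t)) (gs j) by rewrite Dt.
have cjt := ccs_translate lcG cj'.
have ij0 : 0 < (nm (cls x (gs j)))^-1 by rewrite invr_gt0.
have mE (v : L2 (mu (r t))) : nm ((nm (cls x (gs j)))^-1%:C%C *: v) = (nm (cls x (gs j)))^-1 * nm v.
  by rewrite nmZ cmod_real ger0_norm// ltW.
rewrite (clsZ lcG haar_mu _ uy)// (lin_scale (lam_lin a uy)) -scalerDr !mE.
split.
- exact: ccsZ.
- by rewrite nm_cls_translate// Dt mulVf// gt_eqF.
- rewrite mulrC ler_pdivrMr//; apply: le_trans Tj.
  by apply: le_trans (id_plus_translate a cj') _; rewrite Dt.
- move=> z Dz; rewrite mulf_eq0 negb_or => /andP[_ zt].
  have -> : z = mul (mul z t) (inv t) by rewrite gmulgK.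
  by apply: jK => //; rewrite /gfiber /= gsrc_mul.
Qed.

End shifted_almost_kernels.

(** * Limits along an ultrafilter *)

Section ultrafilter_limits.
Context (T : Type) (F : set_system T) (UF : UltraFilter F).

Lemma ultra_cvg (U : topologicalType) (u : T -> U) (E : set U) : compact E ->
  (\forall n \near F, E (u n)) -> exists2 p, E p & u @ F --> p.
Proof.
move=> cE uE; have [p [Ep clp]] := cE (u @ F) _ uE; exists p => // V Vp.
have [//|nV] := in_ultra_setVsetC (u @^-1` V) UF.
have [z [nVz Vz]] : (~` V) `&` V !=set0 by apply: clp => //; exact: nV.
by case: (nVz Vz).
Qed.

Lemma ultra_cvg_complex (R : realType) (u : T -> R[i]) (B : R) :
  (\forall n \near F, cmod (u n) <= B) -> exists l : R[i], u @ F --> l.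
Proof.
move=> uB; have part (v : T -> R) : (\forall n \near F, `|v n| <= B) -> exists2 p, `[- B, B]%classic p & v @ F --> p.
  move=> vB; apply: ultra_cvg; first exact: segment_compact.
  by apply: filterS vB => n /=; rewrite in_itv /= ler_norml.
have [|a _ ua] := part (fun n => complex.Re (u n)).
  by apply: filterS uB => n; apply: le_trans (Re_norm_le _).
have [|b _ ub] := part (fun n => complex.Im (u n)).
  by apply: filterS uB => n; apply: le_trans (Im_norm_le _).
by exists (a +i* b)%C; apply/cvgCP.
Qed.

End ultrafilter_limits.

Lemma near_sum_small (R : realType) (T : Type) (F : set_system T) {FF : Filter F}
    (u : nat -> T -> R[i]) (l : nat -> R[i]) (B : nat -> R) m (e : R) :
  (forall i, 0 <= B i) -> (forall i, u i @ F --> l i) -> 0 < e ->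
  \forall n \near F, \sum_(i < m) cmod (u i n - l i) * B i <= e.
Proof.
move=> B0 ul; elim: m e => [|m IH] e e0.
  by apply: filterE => n; rewrite big_ord0 ltW.
have e2 : 0 < e / 2 by rewrite divr_gt0.
have B1 : 0 < B m + 1 by rewrite ltr_wpDl.
have eB : 0 < e / 2 / (B m + 1) by rewrite divr_gt0.
have /cvgCdist/(_ _ eB) H := ul m.
apply: filterS2 (IH _ e2) H => n H1 H2.
rewrite big_ord_recr /= (splitr e); apply: lerD => //.
apply: le_trans (_ : e / 2 / (B m + 1) * (B m + 1) <= _); last by rewrite divfK// gt_eqF.
by apply: ler_pM => //; [exact: cmod_nneg|exact: ltW|rewrite lerDl].
Qed.

Lemma cont_on_cvg (T U : topologicalType) (S : Type) (F : set_system S) {FF : Filter F}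
    (D : set T) (u : T -> U) (y : S -> T) x : cont_on D u -> D x -> y @ F --> x ->
  (\forall n \near F, D (y n)) -> (fun n => u (y n)) @ F --> u x.
Proof.
move=> cu Dx yx Dy A uA.
have H : nbhs x [set z | D z -> A (u z)] := cu x Dx A uA.
have H' : \forall n \near F, D (y n) -> A (u (y n)) by exact: yx H.
by apply: filterS2 Dy H' => n Dn; apply.
Qed.

Section limit_of_almost_kernels.
Context (R : realType) (G : ptopologicalType) (Gam : groupoid G).
Hypothesis lcG : locally_compact_groupoid Gam.
Context (mu : G -> {measure set (borel G) -> \bar R}).
Hypothesis haar_mu : haar_system Gam mu.
Context (A : reduced_cstar Gam mu).
Local Notation D := (gfiber Gam).
Local Notation conv := (convolution Gam mu).
Local Notation cls := (cls Gam mu).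
Local Notation lam := (rcs_lambda A).
Local Notation emb := (rcs_emb A).

Lemma cont_on_nm_cls (p : G -> R[i]) : ccs setT p ->
  cont_on (gunits Gam) (fun x => nm (cls x p)).
Proof.
move=> cp; have cp2 := ccs_cmod2 cp.
have c := cont_on_family lcG (haar_family lcG haar_mu) (ccs_real cp2).
apply: cont_on_eq (cont_on_sqrt (cont_onC_Re c)) => x ux.
by rewrite (nm_cls lcG haar_mu ux) ?cI_real//; exact: ccs_sub cp.
Qed.

Lemma nm_cls_sum x n (p : nat -> G -> R[i]) (z : nat -> R[i]) : gunits Gam x ->
  (forall i, ccs (D x) (p i)) ->
  nm (cls x (fun g => \sum_(i < n) p i g * z i)) <= \sum_(i < n) cmod (z i) * nm (cls x (p i)).
Proof.
move=> ux cp; elim: n => [|n IH].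
  rewrite big_ord0 (@cls_eq _ _ _ _ _ _ (fun=> 0 * 0)); last first.
    by move=> h _; rewrite big_ord0 mul0r.
  by rewrite (clsZ lcG haar_mu _ ux) ?scale0r ?nm0//; exact: ccs0.
rewrite big_ord_recr /= (@cls_eq _ _ _ _ _ _ (fun g => \sum_(i < n) p i g * z i + z n * p n g)); last first.
  by move=> h _; rewrite big_ord_recr /= [z n * _]mulrC.
rewrite (clsD lcG haar_mu ux); [| |exact: ccsZ]; last first.
  apply: (@ccs_sum _ _ (D x) n (fun i g => p i g * z i)) => i _.
  by apply: ccsM_l => //; exact: cont_on_cst.
by apply: le_trans (nmD _ _) _; rewrite (clsZ lcG haar_mu _ ux)// nmZ lerD2r.
Qed.

(** [w] is one function on G, so its fiber norms are continuous in the unit and can be read off at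
    [y0]. Over a suitable y_n it is within [4 * d] of h_n: [2 * d] from the residue for [f], [d]
    from the finite-rank approximation and [d] from the coefficients. This gives a residue of at
    most [(10 + 4 * nm a) * d] for [f] over y_n; moving to [y0] adds [d], and replacing [f] by [a]
    adds [6 * d]. *)
Lemma limit_almost_kernel (F : set_system nat) (UF : UltraFilter F) (a : A)
    (y : nat -> G) (y0 : G) (h : nat -> G -> R[i]) (K : set G) (d : R) :
  compact K -> 0 < d -> d <= 1 -> gunits Gam y0 -> y @ F --> y0 ->
  (forall n, gunits Gam (y n)) ->
  (\forall n \near F, [/\ ccs (D (y n)) (h n), nm (cls (y n) (h n)) = 1,
     nm (cls (y n) (h n) + lam (y n) a (cls (y n) (h n))) <= d &
     forall z, D (y n) z -> h n z != 0 -> K z]) ->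
  exists w : G -> R[i], [/\ ccs setT w, 1 - 5 * d <= nm (cls y0 w) &
    nm (cls y0 w + lam y0 a (cls y0 w)) <= (17 + 4 * nm a) * d].
Proof.
move=> cK d0 d1 uy0 yy0 uy Hh.
have [f cf af] := emb_dense a d0.
have [m [p [q [pq Hpq]]]] := finite_rank_convolution lcG haar_mu cf cK d0.
pose c i n := cI (mu (y n)) (D (y n)) (fun t => q i t * h n t).
have /choice[l cl] : forall i, exists l : R[i], c i @ F --> l.
  move=> i; have [B B0 HB] := fiber_pairing_bounded lcG haar_mu (pq i).2.
  apply: (@ultra_cvg_complex _ _ _ _ _ B); apply: filterS Hh => n [ch nh _ _].
  have := HB _ _ (uy n) ch; rewrite nh mulr1; apply: le_trans.
  apply: (cmod_cI_le (lcg_hausdorff lcG) (closed_gfiber lcG (x := y n)) (haar_fin haar_mu (uy n))).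
  by apply: (ccsM_r _ ch); have [] : ccs (D (y n)) (q i) by exact: ccs_sub (pq i).2.
have /choice[B HB] : forall i, exists B : R, 0 <= B /\ forall x, gunits Gam x -> nm (cls x (p i)) <= B.
  by move=> i; have [B B0 HB] := nm_cls_bounded lcG haar_mu (pq i).1; exists B.
pose w g := - \sum_(i < m) p i g * l i.
have cw : ccs setT w.
  apply: ccsN; apply: (@ccs_sum _ _ setT m (fun i g => p i g * l i)) => i _.
  by apply: (ccsM_l (pq i).1); exact: cont_on_cst.
have cwx x : ccs (D x) w by exact: ccs_sub cw.
have cfw := ccs_convT lcG haar_mu cf cw.
have cTw := ccsD cw cfw.
have Tw x : gunits Gam x -> cls x w + lam x (emb f) (cls x w) = cls x (fun g => w g + conv f w g).
  move=> ux; rewrite lam_cls// (clsD lcG haar_mu ux)//; exact: ccs_sub cfw.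
have near1 : \forall n \near F, \sum_(i < m) cmod (c i n - l i) * B i <= d.
  by apply: near_sum_small => // i; exact: (HB i).1.
have uyF : \forall n \near F, gunits Gam (y n) by exact: filterE.
have near2 : \forall n \near F, `|nm (cls y0 w) - nm (cls (y n) w)| < d.
  have C : (fun n => nm (cls (y n) w)) @ F --> nm (cls y0 w).
    exact: (cont_on_cvg (cont_on_nm_cls cw) uy0 yy0 uyF).
  by move/cvgrPdist_lt : C => /(_ _ d0).
have near3 : \forall n \near F, `|nm (cls y0 (fun g => w g + conv f w g)) -
    nm (cls (y n) (fun g => w g + conv f w g))| < d.
  have C : (fun n => nm (cls (y n) (fun g => w g + conv f w g))) @ F --> nm (cls y0 (fun g => w g + conv f w g)).
    exact: (cont_on_cvg (cont_on_nm_cls cTw) uy0 yy0 uyF).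
  by move/cvgrPdist_lt : C => /(_ _ d0).
have [n [[ch nh Th hK] [n1 [n2 n3]]]] := @filter_ex _ F _ _
  (@filterI _ F _ _ _ Hh (@filterI _ F _ _ _ near1 (@filterI _ F _ _ _ near2 near3))).
exists w; have u := uy n; set H := cls (y n) (h n) in nh Th.
have cp i : ccs (D (y n)) (p i) by exact: ccs_sub (pq i).1.
have cps (z : nat -> R[i]) : ccs (D (y n)) (fun g => \sum_(i < m) p i g * z i).
  apply: (@ccs_sum _ _ (D (y n)) m (fun i g => p i g * z i)) => i _.
  by apply: ccsM_l => //; exact: cont_on_cst.
set X := cls (y n) (fun g => \sum_(i < m) p i g * c i n).
have HX : nm (lam (y n) (emb f) H - X) <= d.
  rewrite /H lam_cls// /X.
  rewrite -(clsB lcG haar_mu u (ccs_conv lcG haar_mu u cf ch) (cps (fun i => c i n))).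
  by have := Hpq _ _ u ch hK; rewrite -/H nh mulr1.
have HW : nm (X + cls (y n) w) <= d.
  rewrite /X -(clsD lcG haar_mu u (cps (fun i => c i n)) (cwx _)).
  rewrite (@cls_eq _ _ _ _ _ _ (fun g => \sum_(i < m) p i g * (c i n - l i))); last first.
    by move=> g _; rewrite /w -sumrB; apply: eq_bigr => i _; rewrite mulrBr.
  apply: le_trans (nm_cls_sum m (fun i => c i n - l i) u cp) _.
  apply: le_trans n1; apply: ler_sum => i _; apply: ler_wpM2l; first exact: cmod_nneg.
  exact: (HB i).2.
have faH : nm (H + lam (y n) (emb f) H) <= 2 * d.
  apply: le_trans (id_plus_perturb (emb f) a _ u) _; rewrite nh mulr1 nm_distC.
  by move: Th af; lra.
have Hw : nm (H - cls (y n) w) <= 4 * d.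
  have -> : H - cls (y n) w = (H + lam (y n) (emb f) H) - (lam (y n) (emb f) H - X) - (X + cls (y n) w).
    by rewrite !opprD !opprK !addrA !addrK.
  apply: le_trans (nmB _ _) _; apply: le_trans (lerD (nmB _ _) (lexx _)) _.
  by move: HX HW faH; lra.
have w1 : 1 - 4 * d <= nm (cls (y n) w).
  have := nmD (H - cls (y n) w) (cls (y n) w); rewrite subrK nh; move: Hw; lra.
have w2 : nm (cls (y n) w) <= 1 + 4 * d.
  have := nmB H (H - cls (y n) w); rewrite opprB addrCA subrr addr0 nh; move: Hw; lra.
have nf : nm (emb f) <= nm a + d.
  by have := nmB a (a - emb f); rewrite opprB addrCA subrr addr0; move: af; lra.
have Tfw : nm (cls (y n) w + lam (y n) (emb f) (cls (y n) w)) <= (10 + 4 * nm a) * d.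
  have -> : cls (y n) w + lam (y n) (emb f) (cls (y n) w) =
     (H + lam (y n) (emb f) H) - ((H - cls (y n) w) + lam (y n) (emb f) (H - cls (y n) w)).
    rewrite (id_plus_sub _ _ (lam_lin (emb f) u)) opprB addrCA subrr addr0; reflexivity.
  apply: le_trans (nmB _ _) _; apply: le_trans (lerD faH (nmD _ _)) _.
  have L : nm (lam (y n) (emb f) (H - cls (y n) w)) <= (nm a + 1) * (4 * d).
    apply: le_trans (lam_nm _ _ u) _; apply: ler_pM => //; try exact: nm_ge0.
    by move: nf d1; lra.
  by move: Hw L; lra.
rewrite Tw// in Tfw.
have z1 := ler_norm (nm (cls (y n) w) - nm (cls y0 w)).
rewrite distrC in z1.
have z2 := ler_norm (nm (cls y0 w) - nm (cls (y n) w)).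
have z3 := ler_norm (nm (cls y0 (fun g => w g + conv f w g)) - nm (cls (y n) (fun g => w g + conv f w g))).
split => //; first by move: w1 z1 n2; lra.
apply: le_trans (id_plus_perturb a (emb f) _ uy0) _; rewrite Tw//.
have w6 : nm (cls y0 w) <= 6 by move: z2 n2 w2 d1; lra.
have L : nm (a - emb f) * nm (cls y0 w) <= d * 6.
  by apply: ler_pM => //; [exact: nm_ge0|exact: nm_ge0|exact: ltW].
by move: Tfw z3 n3 L; lra.
Qed.

End limit_of_almost_kernels.

Section uniform_lower_bound.
Context (R : realType) (G : ptopologicalType) (Gam : groupoid G).
Hypothesis lcG : locally_compact_groupoid Gam.
Context (mu : G -> {measure set (borel G) -> \bar R}).
Hypothesis haar_mu : haar_system Gam mu.
Hypothesis amG : topologically_amenable R Gam.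
Context (A : reduced_cstar Gam mu).
Local Notation D := (gfiber Gam).
Local Notation cls := (cls Gam mu).
Local Notation lam := (rcs_lambda A).

Lemma op_invertible_bound (V : normedModType R[i]) (T : V -> V) : op_invertible T ->
  exists2 M : R, 0 <= M & forall v, nm v <= M * nm (T v).
Proof.
move=> [S [[_ [M HM]] TS _]]; exists (cmod M); first exact: cmod_nneg.
move=> v; have := HM (T v); rewrite TS !nmE lecE => /andP[_] /=.
rewrite ReM /= mulr0 subr0 => /le_trans; apply; apply: ler_wpM2r; first exact: nm_ge0.
exact: le_trans (ler_norm _) (Re_norm_le _).
Qed.

Lemma exists_bounded_below (a : A) :
  (forall x, gunits Gam x -> op_invertible (fun xi : L2 (mu x) => xi + lam x a xi)) ->
  exists2 c : R, 0 < c & bounded_below a c.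
Proof.
move=> inv; apply: contrapT => nex.
have near_kernel (c : R) : 0 < c -> exists x g, [/\ gunits Gam x, ccs (D x) g, 0 < nm (cls x g) &
    nm (cls x g + lam x a (cls x g)) <= c * nm (cls x g)].
  move=> c0; apply: contrapT => nxg; apply: nex; exists c => // x g ux cg.
  rewrite leNgt; apply/negP => Tg; apply: nxg; exists x, g; split => //; last exact: ltW.
  by move: (le_lt_trans (nm_ge0 _) Tg); rewrite pmulr_rgt0.
have /choice[eK HeK] : forall d : R, exists eK : R * set G, 0 < d ->
    [/\ 0 < eK.1, compact eK.2 & localizes a eK.1 d eK.2].
  move=> d; have [d0|d0] := ltP 0 d; last by exists (0, set0).
  by have [e [K HK]] := localization lcG haar_mu amG a d0; exists (e, K).
(* The first entry of the minimum makes level k + 1 fine enough to be localized to level k; the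
   second forces the errors to 0. *)
pose d := fix d k : R := if k is k'.+1 then Num.min (eK (d k')).1 (k'.+2%:R)^-1 else 1.
have d0 k : 0 < d k.
  by elim: k => [|k IH] //=; rewrite lt_min invr_gt0 ltr0n andbT; have [] := HeK _ IH.
have dk k : d k <= (k.+1%:R)^-1.
  by case: k => [|k] /=; [rewrite invr1|rewrite ge_min lexx orbT].
have loc k : localizes a (d k.+1) (d k) (eK (d k)).2.
  move=> x g ux cg g0 Tg; have [_ _ H] := HeK _ (d0 k).
  apply: H => //; apply: le_trans Tg _; apply: ler_wpM2r; first exact: nm_ge0.
  by rewrite /= ge_min lexx.
have /choice[Y HY] : forall n, exists Y : G * (nat -> G -> R[i]), gunits Gam Y.1 /\
    forall j, (j < n)%N -> [/\ ccs (D Y.1) (Y.2 j), nm (cls Y.1 (Y.2 j)) = 1,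
      nm (cls Y.1 (Y.2 j) + lam Y.1 a (cls Y.1 (Y.2 j))) <= d j &
      forall z, D Y.1 z -> Y.2 j z != 0 -> (eK (d j)).2 z].
  move=> n; have [x [g [ux cg g0 Tg]]] := near_kernel _ (d0 n).
  have [y [hs H]] := shifted_localization lcG haar_mu loc ux cg g0 Tg.
  by exists (y, hs).
have [F [UF Foo]] := ultraFilterLemma eventually_filter.
(* Level j is available for all n > j, hence along [F], which refines the filter of large n. *)
have gtF j : \forall n \near F, (j < n)%N by apply: Foo; exact: nbhs_infty_gt.
pose y n := (Y n).1.
have cK0 : compact (gsrc Gam @` (eK (d 0%N)).2).
  by apply: compact_gsrc => //; have [] := HeK _ (d0 0%N).
(* Level 0 already confines y_n: its vector has norm 1, so it is nonzero at a point of the level 0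
   compact set, and the source of that point is y_n. *)
have yK : \forall n \near F, (gsrc Gam @` (eK (d 0%N)).2) (y n).
  apply: filterS (gtF 0%N) => n n0; have [uy /(_ _ n0)[c0 n1 _ K0]] := HY n.
  have [|t Dt ht] := exists_nonzero_point lcG haar_mu (g := (Y n).2 0%N) uy.
    by rewrite n1.
  by exists t => //; exact: K0.
have [y0 _ yy0] := ultra_cvg UF cK0 yK.
have uy0 : gunits Gam y0.
  apply: (@closed_cvg _ _ F _ y (gunits Gam) (closed_gunits lcG)) yy0.
  by apply: filterE => n; exact: (HY n).1.
have [M M0 HM] := op_invertible_bound (inv _ uy0).
(* Invertibility at [y0] gives $1-5d_j\le M(17+4\|a\|)d_j$ at every level, that is $1\le Cd_j$,
   although $d_j$ tends to 0. *)
pose C := 5 + M * (17 + 4 * nm a).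
have C0 : 0 <= C.
  by apply: addr_ge0 => //; apply: mulr_ge0 => //; apply: addr_ge0 => //; apply: mulr_ge0 => //; exact: nm_ge0.
have Cd j : 1 <= C * d j.
  have [_ cKj _] := HeK _ (d0 j).
  have d1 : d j <= 1 by apply: le_trans (dk j) _; rewrite invf_le1 ?ler1n ?ltr0n.
  have [w [_ w1 Tw]] := limit_almost_kernel lcG haar_mu UF cKj (d0 j) d1 uy0 yy0
    (fun n => (HY n).1) (filterS (fun n => (HY n).2 j) (gtF j)).
  have := le_trans (HM (cls y0 w)) (ler_wpM2l M0 Tw).
  rewrite mulrA /C [(5 + _) * _]mulrDl; move: (M * _ * _) w1 => t w1; lra.
have := archi_boundP C0; set k := Num.bound C => Ck.
have := le_trans (Cd k) (ler_wpM2l C0 (dk k)).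
rewrite ler_pdivlMr ?ltr0n// mul1r leNgt => /negP; apply.
by apply: lt_trans Ck _; rewrite ltr_nat.
Qed.

Lemma invertible_regular_representation (a v : A) x : gunits Gam x ->
  bsa_mul a v + v + a = 0 -> bsa_mul v a + a + v = 0 ->
  op_invertible (fun xi : L2 (mu x) => xi + lam x a xi).
Proof.
move=> ux av va.
have can (b c : A) : bsa_mul b c + c + b = 0 ->
    forall xi : L2 (mu x), (xi + lam x c xi) + lam x b (xi + lam x c xi) = xi.
  move=> bc xi; have : lam x (bsa_mul b c + c + b) xi = 0 by rewrite bc (lin_zero (lam_linl xi ux)).
  rewrite !(lin_add (lam_linl xi ux)) (lam_mul lcG haar_mu)// (lin_add (lam_lin b ux)) => E.
  by rewrite -[RHS]addr0 -E !addrA; rewrite [LHS](ACl (1*4*2*3))/=.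
exists (fun xi => xi + lam x v xi); split; last first.
- by move=> xi; exact: can av xi.
- by move=> xi; exact: can va xi.
split=> [c u w|].
  rewrite (lin_add (lam_lin v ux)) (lin_scale (lam_lin v ux)).
  by rewrite scalerDr addrACA.
exists (1 + nm v)%:C%C => u; rewrite !nmE -rmorphM lecR mulrDl mul1r.
by apply: le_trans (nmD _ _) _; rewrite lerD2l; exact: lam_nm.
Qed.

End uniform_lower_bound.

Theorem theorem1p3 (R : realType) (G : ptopologicalType) (Gam : groupoid G)
    (mu : G -> {measure set (borel G) -> \bar R})
    (lcG : locally_compact_groupoid Gam)
    (scG : sigma_compact G)
    (amG : topologically_amenable R Gam)
    (haar_mu : haar_system Gam mu)
    (A : reduced_cstar Gam mu) (a : A) :
  unitization_invertible ((a, 1) : unitization A) <->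
  (forall x : G, gunits Gam x ->
     op_invertible (fun xi : L2 (mu x) => xi + rcs_lambda A x a xi)).
Proof.
split=> [[[v z] []]|inv].
  rewrite /unitizationM /unitization1 /= mul1r scale1r => -[av z1] [va _] x ux.
  move: av va; rewrite z1 !scale1r => av va.
  exact: (invertible_regular_representation lcG haar_mu ux av va).
have [c c0 ac] := exists_bounded_below lcG haar_mu amG inv.
exact: (invertible_of_bounded_below lcG haar_mu c0 ac inv).
Qed.
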